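(* Let $n\ge 1$ be an integer, let $q\in\left(2,\frac{4n}{2n-1}\right)$ (note $\frac{4n}{2n-1}=\frac{2\cdot 4n}{4n-2}$ is the critical Sobolev exponent in real dimension $4n$), and for every positive integer $k$ put $\mu_k=\mu_{k,q}:=\frac{4k(k+2n+1)}{q-2}$. If $\lambda\in(\mu_{k,q},\mu_{k+1,q}]$, then the equation $$-\Delta_{g_{H}}u+\lambda u=\lambda u^{q-1}$$ has at least $k$ positive solutions on $(\mathbb{H}\mathbf{P}^n,g_H)$ which are invariant under the action of $Sp(n)$.
   Context: $g_H$ is the canonical (Fubini–Study type) metric on the quaternionic projective space $\mathbb{H}\mathbf{P}^n$, normalized so that the eigenvalues of $-\Delta_{g_H}$ are $4k(k+2n+1)$, $k=0,1,2,\dots$ (diameter $\pi/2$). $\Delta_{g_H}$ is the Laplace–Beltrami operator (nonpositive). The symplectic group $Sp(n)$ acts isometrically on $\mathbb{H}\mathbf{P}^n$ by $A\cdot[z_0:z_1:\dots:z_n]=[z_0:A(z_1,\dots,z_n)]$; this is a cohomogeneity one action fixing a point $p_0=[1:0:\dots:0]$, whose other singular orbit is $\mathbb{H}\mathbf{P}^{n-1}=\{z_0=0\}$ and whose orbit space is isometric to $[0,\pi/2]$ (the quotient map is the distance to $p_0$). A solution is called invariant if it is constant on the orbits. *)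

(* Defs.v *)
From HB Require Import structures.
From mathcomp Require Import all_boot all_order all_algebra.
From mathcomp Require Import all_classical all_reals all_analysis.
Set Implicit Arguments. Unset Strict Implicit. Unset Printing Implicit Defensive.
Import Order.TTheory GRing.Theory Num.Theory.
Import numFieldNormedType.Exports.
Local Open Scope ring_scope.

(* Model of HP^n: the quaternionic Hopf fibration S^{4n+3} -> HP^n,
   z |-> [z_0 : ... : z_n] (right quaternionic scalars).  A point of
   H^{n+1} = R^{4(n+1)} is a matrix z : 'M[R]_(n.+1,4); row i of z is the
   quaternion z_i = z i 0 + z i 1 * i + z i 2 * j + z i 3 * k.  A function on
   HP^n is a function on H^{n+1} whose values on the unit sphere are
   invariant under right multiplication by unit quaternions; g_H is the
   quotient metric of the round unit sphere (diameter pi/2, spectrum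
   4k(k+2n+1)). *)

Section Defs.
Variable R : realType.

Definition quat := 'rV[R]_4.
Definition qc (a : quat) (j : nat) : R := a ord0 (inord j).

Definition qmul (a b : quat) : quat :=
  \row_(c < 4)
    (if val c == 0%N then qc a 0 * qc b 0 - qc a 1 * qc b 1 - qc a 2 * qc b 2 - qc a 3 * qc b 3
     else if val c == 1%N then qc a 0 * qc b 1 + qc a 1 * qc b 0 + qc a 2 * qc b 3 - qc a 3 * qc b 2
     else if val c == 2%N then qc a 0 * qc b 2 - qc a 1 * qc b 3 + qc a 2 * qc b 0 + qc a 3 * qc b 1
     else qc a 0 * qc b 3 + qc a 1 * qc b 2 - qc a 2 * qc b 1 + qc a 3 * qc b 0).

Definition qconj (a : quat) : quat :=
  \row_(c < 4) (if val c == 0%N then a ord0 c else - a ord0 c).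

Definition qone : quat := \row_(c < 4) (if val c == 0%N then 1 else 0).

Definition unit_quat (a : quat) : Prop := \sum_(c < 4) a ord0 c ^+ 2 = 1.

Definition Hvec (n : nat) := 'M[R]_(n.+1, 4).

Definition sq_norm n (z : Hvec n) : R := \sum_(i < n.+1) \sum_(c < 4) z i c ^+ 2.
Definition enorm n (z : Hvec n) : R := Num.sqrt (sq_norm z).

Definition on_sphere n (z : Hvec n) : Prop := sq_norm z = 1.

Definition rscale n (z : Hvec n) (a : quat) : Hvec n :=
  \matrix_(i < n.+1, c < 4) qmul (row i z) a ord0 c.

Definition is_Sp (n : nat) (A : 'I_n -> 'I_n -> quat) : Prop :=
  forall i j : 'I_n,
    \sum_(l < n) qmul (qconj (A l i)) (A l j) = if i == j then qone else 0.

Definition Sp_act n (A : 'I_n -> 'I_n -> quat) (z : Hvec n) : Hvec n :=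
  \matrix_(i < n.+1, c < 4)
    (match unlift ord0 i with
     | None => z i c
     | Some i' => (\sum_(j < n) qmul (A i' j) (row (lift ord0 j) z)) ord0 c
     end).

Definition hext n (u : Hvec n -> R) : Hvec n -> R :=
  fun z => u ((enorm z)^-1 *: z).

Definition eucl_lap n (F : Hvec n -> R) (z : Hvec n) : R :=
  \sum_(i < n.+1) \sum_(c < 4)
     'D_(delta_mx i c) ('D_(delta_mx i c) F) z.

(* Laplace-Beltrami operator of the unit sphere = Euclidean Laplacian of the
   0-homogeneous extension, evaluated on the sphere; for Sp(1)-invariant u
   this is Delta_{g_H} of the induced function on HP^n. *)
Definition lap_HP n (u : Hvec n -> R) (z : Hvec n) : R := eucl_lap (hext u) z.

Definition HP_function n (u : Hvec n -> R) : Prop :=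
  forall z a, on_sphere z -> unit_quat a -> u (rscale z a) = u z.

(* C^2 regularity of the homogeneous extension on R^{4(n+1)} \ {0}
   (equivalently, the induced function on HP^n is C^2) *)
Definition C2_HP n (u : Hvec n -> R) : Prop :=
  forall z : Hvec n, z != 0 ->
    differentiable (hext u) z /\
    (forall (i : 'I_n.+1) (c : 'I_4), differentiable ('D_(delta_mx i c) (hext u)) z) /\
    (forall (i j : 'I_n.+1) (c d : 'I_4),
        {for z, continuous ('D_(delta_mx j d) ('D_(delta_mx i c) (hext u)))}).

Definition Sp_invariant n (u : Hvec n -> R) : Prop :=
  forall A z, is_Sp A -> on_sphere z -> u (Sp_act A z) = u z.

Definition pos_inv_solution n (lambda q : R) (u : Hvec n -> R) : Prop :=
  [/\ HP_function u, C2_HP u, Sp_invariant u,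
      (forall z, on_sphere z -> 0 < u z) &
      (forall z, on_sphere z ->
         - lap_HP u z + lambda * u z = lambda * (u z) `^ (q - 1))].

Definition HP_distinct n (u v : Hvec n -> R) : Prop :=
  exists z, on_sphere z /\ u z <> v z.

Definition mu (n k : nat) (q : R) : R := (4 * (k%:R) * (k%:R + 2 * n%:R + 1)) / (q - 2).

End Defs.

(* Main.v *)
(** With x = 1 - |z_0|^2, the squared sine of the distance to p_0, the invariant function
    u(z) = w(x) solves the equation iff
      x (1 - x) w'' + (2n - (2n + 2) x) w' + kappa (w^(q-1) - w) = 0,   kappa = lambda / 4,
    on [0,1], with w regular at the two singular endpoints.  Truncate the nonlinearity and shoot
    from x = 0 with w(0) = a in (0,1).  Count the oscillations of w about 1: for a near 0 there is
    at most one crossing, while for a near 1 there are at least k, by Sturm comparison of the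
    linearization at 1 with the Jacobi polynomial of degree k, since kappa (q - 2) exceeds
    k (k + 2n + 1).  For 0 < j < k let c_j be the supremum of the a for which w - 1 does not change
    sign j + 1 times.  A profile that is unbounded at x = 1 is "trapped" on one side of 1 near the
    endpoint; this is an open condition on a which freezes the number of sign changes, so the
    profile of c_j is bounded, hence regular at x = 1, and it has exactly j sign changes.
    A Pohozaev identity (subcritical because q < 4, the singular orbit x = 1 having codimension 4)
    bounds these regular profiles independently of the truncation, and a maximum principle makes
    them positive.  Together with the constant 1 this gives k solutions, which are distinguished
    by their values a at p_0. *)

(* The variable z = x / (1 - x) sends the end x = 1 to infinity. A globally Lipschitz nonlinearity
   then gives every starting value a profile on all of [0, 1), depending on a uniformly on each
   [0, X] with X < 1; this is what the truncation buys, and regularity at x = 1 becomes a condition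
   that selects a. The obstacle is that the number of sign changes is not continuous in a: uniform
   dependence is lost at x = 1, and a zero may escape there. Two facts control this. Past a fixed X
   near 1 a profile has at most one zero, so at most one can escape; past a point where it is
   trapped it has none. A start below 1 at p_0 keeps the energy negative as long as the geodesic
   spheres about p_0 grow, so large values can only arise beyond the largest sphere, towards the
   orbit x = 1. There the critical exponent is that of dimension 4, and 4n / (2n - 1) <= 4. The
   truncation level M has to be chosen before a; the final comparison is between M^(q-2) and M^2,
   which is decided by q < 4. *)
Require Import Defs.
From HB Require Import structures.
From mathcomp Require Import all_boot all_order all_algebra.
From mathcomp Require Import all_classical all_reals all_analysis.
From mathcomp Require Import ring lra.
Set Implicit Arguments. Unset Strict Implicit. Unset Printing Implicit Defensive.
Import Order.TTheory GRing.Theory Num.Theory.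
Import numFieldNormedType.Exports.
Local Open Scope classical_set_scope.
Local Open Scope ring_scope.

(** * One-variable calculus *)

Tactic Notation "lra_from" ne_hyp_list(H) := clear -H; lra.

Section RealCalculus.
Variable R : realType.
Implicit Types (f g df dg : R -> R) (a b c x y d e : R).

Lemma is_derive1_cst c x : is_derive x (1 : R) (fun=> c) 0.
Proof. exact: is_derive_cst. Qed.

Lemma is_derive1_id x : is_derive x (1 : R) (fun t => t) 1.
Proof. exact: is_derive_id. Qed.

Lemma is_derive1D f g x a b : is_derive x 1 f a -> is_derive x 1 g b ->
  is_derive x (1 : R) (fun t => f t + g t) (a + b).
Proof. exact: is_deriveD. Qed.

Lemma is_derive1B f g x a b : is_derive x 1 f a -> is_derive x 1 g b ->
  is_derive x (1 : R) (fun t => f t - g t) (a - b).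
Proof. exact: is_deriveB. Qed.

Lemma is_derive1N f x a : is_derive x 1 f a ->
  is_derive x (1 : R) (fun t => - f t) (- a).
Proof. exact: is_deriveN. Qed.

Lemma is_derive1M f g x a b : is_derive x 1 f a -> is_derive x 1 g b ->
  is_derive x (1 : R) (fun t => f t * g t) (a * g x + f x * b).
Proof.
move=> fa gb; apply: (is_derive_eq (is_deriveM fa gb)).
by rewrite /GRing.scale /= addrC mulrC.
Qed.

Lemma is_derive1X f n x a : is_derive x 1 f a ->
  is_derive x (1 : R) (fun t => f t ^+ n) (n%:R * f x ^+ n.-1 * a).
Proof.
move=> fa; have -> : (fun t => f t ^+ n) = f ^+ n.
  by apply/funext => t; rewrite exprfctE.
by apply: (is_derive_eq (is_deriveX n fa)).
Qed.

Lemma is_derive1V f x a : is_derive x 1 f a -> f x != 0 ->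
  is_derive x (1 : R) (fun t => (f t)^-1) (- a / f x ^+ 2).
Proof.
move=> fa fx; apply: (is_derive_eq (@is_deriveV _ _ _ _ _ fx fa)).
by rewrite /GRing.scale /= mulNr mulrC mulNr.
Qed.

Lemma is_derive1_chain f g x a b : is_derive (g x) 1 f a -> is_derive x 1 g b ->
  is_derive x (1 : R) (fun t => f (g t)) (a * b).
Proof.
move=> fa gb; apply: (is_derive_eq (is_derive1_comp fa gb)).
by rewrite mulrC.
Qed.

Lemma is_derive_cvg f x a : is_derive x 1 f a -> {for x, continuous f}.
Proof.
move=> fa; apply: differentiable_continuous; apply/derivable1_diffP.
exact: (@ex_derive _ _ _ _ _ _ _ fa).
Qed.

Lemma continuous1M f g x : {for x, continuous f} -> {for x, continuous g} ->
  {for x, continuous (fun t => f t * g t)}.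
Proof. by move=> cf cg; apply: cvgM. Qed.

Lemma continuous1D f g x : {for x, continuous f} -> {for x, continuous g} ->
  {for x, continuous (fun t => f t + g t)}.
Proof. by move=> cf cg; apply: cvgD. Qed.

Lemma continuous1B f g x : {for x, continuous f} -> {for x, continuous g} ->
  {for x, continuous (fun t => f t - g t)}.
Proof. by move=> cf cg; apply: cvgB. Qed.

Lemma continuous1V f x : f x != 0 -> {for x, continuous f} ->
  {for x, continuous (fun t => (f t)^-1)}.
Proof. by move=> f0 cf; apply: cvgV. Qed.

Lemma continuous1_chain f g x : {for g x, continuous f} -> {for x, continuous g} ->
  {for x, continuous (fun t => f (g t))}.
Proof. by move=> cf cg; exact: (continuous_comp cg cf). Qed.

Lemma continuous_atP f x : {for x, continuous f} <->
  (forall e, 0 < e -> exists2 d, 0 < d & forall y, `|y - x| < d -> `|f y - f x| < e).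
Proof.
split=> [/cvgrPdist_lt cf e e0|H].
  have /nbhs_ballP[d d0 dH] := cf _ e0.
  exists d => // y yd; rewrite distrC; apply: (dH y).
  by rewrite /ball /= distrC.
apply/cvgrPdist_lt => e e0; have [d d0 dH] := H e e0.
apply/nbhs_ballP; exists d => // y; rewrite /ball /= => yd.
by rewrite distrC dH // distrC.
Qed.

(** This division-free form includes y = x. It serves to glue two formulas at a point and to
    differentiate the flux at the degenerate point 0. *)
Lemma is_derive1P f x d : is_derive x (1 : R) f d <->
  (forall e, 0 < e -> exists2 r, 0 < r &
    forall y, `|y - x| < r -> `|f y - f x - d * (y - x)| <= e * `|y - x|).
Proof.
split=> [fd e e0|H].
  have dfx : derivable f x 1 by exact: (@ex_derive _ _ _ _ _ _ _ fd).
  have : (fun h => h^-1 *: ((f \o shift x) (h *: 1) - f x)) @ 0^' --> d.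
    by have := dfx; rewrite /derivable => /cvg_ex[/= l Hl];
      rewrite -(@derive_val _ _ _ _ _ _ _ fd) /derive (cvg_lim _ Hl).
  move=> /cvgrPdist_le /(_ e e0); rewrite near_withinE => /nbhs_ballP[r /= r0 rH].
  exists r => // y yr; case: (eqVneq y x) => [->|yx].
    by rewrite !subrr mulr0 subr0 normr0 mulr0.
  have := rH (y - x); rewrite /ball /= sub0r normrN => /(_ yr); rewrite subr_eq0.
  move=> /(_ yx); rewrite /= /GRing.scale /= mulr1 subrK => h.
  have -> : f y - f x - d * (y - x) = - ((d - (y - x)^-1 * (f y - f x)) * (y - x)).
    by field; rewrite subr_eq0.
  by rewrite normrN normrM ler_wpM2r.
suff Hl : (fun h => h^-1 *: ((f \o shift x) (h *: 1) - f x)) @ 0^' --> d.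
  apply: DeriveDef; first by rewrite /derivable; apply/cvg_ex; exists d.
  by rewrite /derive; exact: (cvg_lim _ Hl).
apply/cvgrPdist_le => e e0; rewrite near_withinE; have [r r0 rH] := H e e0.
apply/nbhs_ballP; exists r => // h; rewrite /ball /= sub0r normrN => hr h0.
have := rH (h + x); rewrite addrK => /(_ hr).
rewrite /= /GRing.scale /= mulr1 => hh.
have -> : d - h^-1 * (f (h + x) - f x) = - (h^-1 * (f (h + x) - f x - d * h)).
  by field.
rewrite normrN normrM normfV mulrC ler_pdivrMr ?normr_gt0//.
Qed.

Lemma is_derive1_glue f f1 f2 x d r : 0 < r ->
  (forall y, x - r < y <= x -> f y = f1 y) -> (forall y, x <= y < x + r -> f y = f2 y) ->
  is_derive x 1 f1 d -> is_derive x 1 f2 d -> is_derive x (1 : R) f d.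
Proof.
move=> r0 E1 E2 /is_derive1P H1 /is_derive1P H2; apply/is_derive1P => e e0.
have [r1 r10 H1'] := H1 e e0; have [r2 r20 H2'] := H2 e e0.
exists (Num.min r (Num.min r1 r2)); first by rewrite !lt_min r0 r10.
move=> y; rewrite !lt_min => /and3P[yr yr1 yr2].
move: yr; rewrite ltr_norml => /andP[ya yb]; case: (leP y x) => yx.
  by rewrite (E1 y) ?(E1 x) ?H1'//; lra.
by rewrite (E2 y) ?(E2 x) ?H2'//; lra.
Qed.

Lemma within_cc a b f : (forall x, a <= x <= b -> {for x, continuous f}) ->
  {within `[a, b], continuous f}.
Proof.
move=> cf; apply: continuous_in_subspaceT => x; rewrite inE/= in_itv/= => xab.
exact: cf.
Qed.

Lemma is_derive1_near f g x a r : 0 < r -> (forall y, `|y - x| < r -> f y = g y) ->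
  is_derive x 1 f a -> is_derive x (1 : R) g a.
Proof.
move=> r0 fg; apply: near_eq_is_derive.
apply/nbhs_ballP; exists r => // y; rewrite /ball /= => yx.
by apply: fg; rewrite distrC.
Qed.

Lemma continuous_near f g x r : 0 < r -> (forall y, `|y - x| < r -> f y = g y) ->
  {for x, continuous f} -> {for x, continuous g}.
Proof.
move=> r0 fg /continuous_atP cf; apply/continuous_atP => e /cf[d d0 dH].
exists (Num.min d r); first by rewrite lt_min d0.
move=> y; rewrite lt_min => /andP[yd yr].
by rewrite -!fg ?subrr ?normr0//; exact: dH.
Qed.

Lemma MVT_cc f df a b : a < b ->
  (forall x, a <= x <= b -> {for x, continuous f}) ->
  (forall x, a < x < b -> is_derive x (1 : R) f (df x)) ->
  exists2 c, a < c < b & f b - f a = df c * (b - a).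
Proof.
move=> ab cf fd.
have fd' x : x \in `]a, b[ -> is_derive x (1 : R) f (df x).
  by rewrite in_itv/=; exact: fd.
have [c cab E] := MVT ab fd' (within_cc cf).
by exists c => //; move: cab; rewrite in_itv.
Qed.

Lemma nondecr_cc f df a b : a <= b ->
  (forall x, a <= x <= b -> {for x, continuous f}) ->
  (forall x, a < x < b -> is_derive x (1 : R) f (df x)) ->
  (forall x, a < x < b -> 0 <= df x) -> f a <= f b.
Proof.
move=> ab cf fd d0; move: ab; rewrite le_eqVlt => /predU1P[->//|ab].
have [c cab E] := MVT_cc ab cf fd.
by rewrite -subr_ge0 E mulr_ge0 ?d0// subr_ge0 ltW.
Qed.

Lemma nonincr_cc f df a b : a <= b ->
  (forall x, a <= x <= b -> {for x, continuous f}) ->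
  (forall x, a < x < b -> is_derive x (1 : R) f (df x)) ->
  (forall x, a < x < b -> df x <= 0) -> f b <= f a.
Proof.
move=> ab cf fd d0; move: ab; rewrite le_eqVlt => /predU1P[->//|ab].
have [c cab E] := MVT_cc ab cf fd.
by rewrite -subr_le0 E mulr_le0_ge0 ?d0// subr_ge0 ltW.
Qed.

Lemma IVT_cc f a b y : a <= b ->
  (forall x, a <= x <= b -> {for x, continuous f}) ->
  (f a <= y <= f b) || (f b <= y <= f a) -> exists2 x, a <= x <= b & f x = y.
Proof.
move=> ab cf Hy.
have Hy' : Num.min (f a) (f b) <= y <= Num.max (f a) (f b).
  by case: (leP (f a) (f b)) => fab; case/orP: Hy => //; lra.
have [c cab E] := IVT ab (within_cc cf) Hy'.
by exists c => //; move: cab; rewrite in_itv.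
Qed.

Lemma max_cc f a b : a <= b -> (forall x, a <= x <= b -> {for x, continuous f}) ->
  exists2 c, a <= c <= b & forall x, a <= x <= b -> f x <= f c.
Proof.
move=> ab cf; have [c] := EVT_max ab (within_cc cf).
by rewrite in_itv/= => cab H; exists c => // x xab; apply: H; rewrite in_itv.
Qed.

Lemma min_cc f a b : a <= b -> (forall x, a <= x <= b -> {for x, continuous f}) ->
  exists2 c, a <= c <= b & forall x, a <= x <= b -> f c <= f x.
Proof.
move=> ab cf; have [c] := EVT_min ab (within_cc cf).
by rewrite in_itv/= => cab H; exists c => // x xab; apply: H; rewrite in_itv.
Qed.

(** Take the supremum of the points up to which [f] stays positive; by continuity [f] can be neither
    positive nor negative there. *)
Lemma first_zero f a b : a <= b -> (forall x, a <= x <= b -> {for x, continuous f}) ->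
  0 < f a -> f b <= 0 ->
  exists c, [/\ a < c <= b, f c = 0 & forall x, a <= x < c -> 0 < f x].
Proof.
move=> ab cf fa fb.
pose S := [set x | a <= x <= b /\ forall y, a <= y <= x -> 0 < f y].
have Sa : S a by split; [rewrite lexx|move=> y; rewrite -eq_le => /eqP <-].
have Sub : ubound S b by move=> x [/andP[]].
have hS : has_sup S by split; [exists a|exists b].
set c := sup S.
have ac : a <= c by apply: ub_le_sup => //; exists b.
have cb : c <= b by apply: ge_sup => //; exists a.
have below x : a <= x < c -> 0 < f x.
  move=> /andP[ax xc].
  have [z [zab Hz] xz] : exists2 z, S z & x < z.
    have [z Sz] := sup_adherent (eps := c - x) (ltac:(lra)) hS.
    by rewrite -/c opprB addrC subrK => xz; exists z.
  by apply: Hz; rewrite ax ltW.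
have /continuous_atP cfc := cf c (ltac:(lra)).
have fc0 : ~ 0 < f c.
  move=> fc; have [d d0 dH] := cfc _ fc.
  have cb' : c < b by rewrite lt_neqAle cb andbT; apply/eqP => E; move: fc; rewrite E; lra.
  pose x := c + Num.min (d / 2) (b - c).
  have m0 : 0 < Num.min (d / 2) (b - c) by rewrite lt_min; apply/andP; split; lra.
  have md : Num.min (d / 2) (b - c) <= d / 2 by rewrite ge_min lexx.
  have mb : Num.min (d / 2) (b - c) <= b - c by rewrite ge_min lexx orbT.
  suff : S x by move/(ub_le_sup (ex_intro _ b Sub)); rewrite -/c /x; lra.
  split; first by rewrite /x; lra.
  move=> y /andP[ay yx]; case: (ltP y c) => yc; first by apply: below; lra.
  have : `|f y - f c| < f c by apply: dH; rewrite ger0_norm; rewrite /x in yx; lra.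
  by rewrite ltr_norml; lra.
have ac' : a < c by rewrite lt_neqAle ac andbT; apply/eqP => E; apply: fc0; rewrite -E.
exists c; split => //; first by rewrite ac'.
apply/eqP; rewrite eq_le; apply/andP; split; first by rewrite leNgt; apply/negP.
rewrite leNgt; apply/negP => fc.
have [d d0 dH] := cfc (- f c) (ltac:(lra)).
pose x := c - Num.min (d / 2) (c - a).
have m0 : 0 < Num.min (d / 2) (c - a) by rewrite lt_min; apply/andP; split; lra.
have md : Num.min (d / 2) (c - a) <= d / 2 by rewrite ge_min lexx.
have mb : Num.min (d / 2) (c - a) <= c - a by rewrite ge_min lexx orbT.
have := below x (ltac:(rewrite /x; lra)).
have : `|f x - f c| < - f c by apply: dH; rewrite ltr_norml /x; lra.
by rewrite ltr_norml; lra.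
Qed.

Lemma last_zero f a b : a <= b -> (forall x, a <= x <= b -> {for x, continuous f}) ->
  f a <= 0 -> 0 < f b ->
  exists c, [/\ a <= c < b, f c = 0 & forall x, c < x <= b -> 0 < f x].
Proof.
move=> ab cf fa fb.
have [||||c [cab fc H]] := @first_zero (fun x => f (- x)) (- b) (- a).
- by rewrite lerN2.
- move=> x xab; apply: continuous_comp; first exact: (is_derive_cvg (is_derive1N (is_derive1_id x))).
  by apply: cf; lra.
- by rewrite opprK.
- by rewrite opprK.
exists (- c); split => //; first by lra.
by move=> x xc; rewrite -[x]opprK; apply: H; lra.
Qed.

(** Heine-Cantor by compactness. The point [t] may lie outside [a, b], so that small overshoots past
    an endpoint need no separate treatment. *)
Lemma unif_continuous_cc f a b e : 0 < e ->
  (forall x : R, a <= x <= b -> {for x, continuous f}) ->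
  exists2 h : R, 0 < h & forall x t : R, a <= x <= b -> `|t - x| < h -> `|f t - f x| < e.
Proof.
move=> e0 cf; have := @segment_compact R a b.
rewrite compact_near_coveringP => /(_ R (0 : R)^'+ (fun h x => forall t, `|t - x| < h -> `|f t - f x| < e)) /=.
have FF : Filter ((0 : R)^'+) by exact: at_right_proper_filter.
move=> /(_ FF) H.
have : \forall h \near (0 : R)^'+, `[a, b] `<=` (fun x => forall t, `|t - x| < h -> `|f t - f x| < e).
  apply: H => x; rewrite /= in_itv/= => xab.
  have e2 : 0 < e / 2 by lra.
  have /continuous_atP/(_ _ e2)[d d0 dH] := cf x xab.
  have d2 : 0 < d / 2 by lra.
  exists (ball x (d / 2), [set h | h < d / 2]) => /=.
    split; first exact: nbhsx_ballx.
    exact: nbhs_right_lt.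
  move=> [x' h] [/=]; rewrite /ball /= => xx hd t th.
  have h1 : `|f t - f x| < e / 2 by apply: dH; move: xx th; rewrite !ltr_norml; lra.
  have h2 : `|f x' - f x| < e / 2 by apply: dH; move: xx th; rewrite !ltr_norml; lra.
  by move: h1 h2; rewrite !ltr_norml; lra.
rewrite near_withinE => /nbhs_ballP[r /= r0 rH].
have r2 : 0 < r / 2 by lra.
exists (r / 2) => // x t xab.
have := rH (r / 2); rewrite /ball /= sub0r normrN gtr0_norm// => /(_ _ r2 x); apply; first by lra.
by rewrite /= in_itv.
Qed.

(** The fundamental theorem applies to the right of a base point. The base point is therefore moved
    to the left of both 0 and x, and [key] shows that differences of values do not depend on it, so
    that the result is differentiable on the whole line. *)
Lemma antiderivative_ex f : continuous f ->
  exists F, F 0 = 0 /\ forall x, is_derive x (1 : R) F (f x).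
Proof.
move=> cf.
pose G (m : R) x : R := \int[@lebesgue_measure R]_(t in [set` `[m, x]]) (f t).
have GD m x : m < x -> is_derive x (1 : R) (G m) (f x).
  move=> mx.
  have [||||dG EG] := @continuous_FTC1 R f (BLeft m) x (x + 1).
  - by rewrite ltrDl.
  - apply: continuous_compact_integrable; first exact: segment_compact.
    by apply: within_cc => y _; exact: cf.
  - by rewrite /= lte_fin.
  - exact: cf.
  by apply: DeriveDef; [exact: dG|rewrite -derive1E EG].
pose F x := G (Num.min x 0 - 1) x - G (Num.min x 0 - 1) 0.
have FE m x : m < x -> m < 0 -> F x = G m x - G m 0.
  move=> mx m0.
  have key p r y : p < r -> r < y -> r < 0 -> G p y - G p 0 = G r y - G r 0.
    move=> pr ry r0.
    wlog: y ry / y <= 0.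
      move=> W; case: (leP y 0) => [/W|y0]; first exact.
      apply/eqP; rewrite -subr_eq0; apply/eqP.
      have [||c _] := @MVT_cc (fun t => G p t - G r t) (fun t => f t - f t) 0 y y0.
      - by move=> t t0; apply: is_derive_cvg; apply: is_derive1B; apply: GD; lra.
      - by move=> t t0; apply: is_derive1B; apply: GD; lra.
      by rewrite subrr mul0r => H; rewrite -[RHS]H; ring.
    move=> y0; move: (y0); rewrite le_eqVlt => /predU1P[->|y0']; first by rewrite !subrr.
    have [||c _] := @MVT_cc (fun t => G p t - G r t) (fun t => f t - f t) y 0 y0'.
    - by move=> t t0; apply: is_derive_cvg; apply: is_derive1B; apply: GD; lra.
    - by move=> t t0; apply: is_derive1B; apply: GD; lra.
    rewrite subrr mul0r => H; apply/eqP; rewrite -subr_eq0; apply/eqP.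
    by rewrite -[RHS]oppr0 -[in RHS]H; ring.
  have n1 : Num.min x 0 <= x by rewrite ge_min lexx.
  have n2 : Num.min x 0 <= 0 by rewrite ge_min lexx orbT.
  rewrite /F; case: (ltgtP m (Num.min x 0 - 1)) => [h|h|->//].
    by symmetry; apply: key; lra.
  by apply: key; lra.
exists F; split; first by rewrite /F subrr.
move=> x; pose m := Num.min x 0 - 1.
have n1 : Num.min x 0 <= x by rewrite ge_min lexx.
have n2 : Num.min x 0 <= 0 by rewrite ge_min lexx orbT.
apply: (@is_derive1_near (fun t => G m t - G m 0) _ _ _ (x - m)).
- by rewrite /m; lra.
- by move=> y; rewrite ltr_norml => yx; rewrite (@FE m) //; rewrite /m in yx *; lra.
apply: (is_derive_eq (is_derive1B (GD m x _) (is_derive1_cst _ _))); rewrite ?subr0 //.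
by rewrite /m; lra.
Qed.

End RealCalculus.

(** * The truncated nonlinearity *)

Section TruncatedPower.
Variable R : realType.
Variables q M : R.

Definition trunc (w : R) : R := Num.min (Num.max w 0) M.
Definition pot (w : R) : R := trunc w `^ (q - 2).
(** Only the factor w^(q-2) is truncated. Hence [nlin] is the original nonlinearity on [0, M], is
    linear above M, and equals -w for w <= 0, the sign that the maximum principle needs. *)
Definition nlin (w : R) : R := w * (pot w - 1).
(** An antiderivative of [nlin] on w > 0: the term with trunc w ^ q makes the power formula below M
    and the quadratic one above M agree at M. *)
Definition prim (w : R) : R :=
  (q^-1 - 2^-1) * trunc w `^ q + pot w * w ^+ 2 / 2 - w ^+ 2 / 2.

Hypothesis q2 : 2 < q.
Hypothesis M1 : 1 < M.

Let q0 : 0 < q. Proof. have [q2' M1'] := (q2, M1). lra. Qed.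

Lemma trunc_ge0 w : 0 <= trunc w.
Proof. have [q2' M1'] := (q2, M1). by rewrite /trunc le_min le_max lexx orbT; lra. Qed.

Lemma trunc_id w : 0 <= w <= M -> trunc w = w.
Proof. have [q2' M1'] := (q2, M1).
move=> /andP[w0 wM]; rewrite /trunc (max_idPl w0); exact/min_idPl.
Qed.

Lemma trunc_le0 w : w <= 0 -> trunc w = 0.
Proof. have [q2' M1'] := (q2, M1). by move=> w0; rewrite /trunc (max_idPr w0); apply/min_idPl; lra. Qed.

Lemma trunc_geM w : M <= w -> trunc w = M.
Proof. have [q2' M1'] := (q2, M1).
by move=> w0; rewrite /trunc (max_idPl _); [apply/min_idPr|lra].
Qed.

Lemma trunc_mono u w : u <= w -> trunc u <= trunc w.
Proof. have [q2' M1'] := (q2, M1).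
move=> uw; rewrite /trunc le_min !ge_min; apply/andP; split; last by rewrite lexx orbT.
by apply/orP; left; rewrite ge_max le_max uw /= le_max lexx orbT.
Qed.

Lemma pot_ge0 w : 0 <= pot w. Proof. exact: powR_ge0. Qed.

Lemma pot_mono u w : u <= w -> pot u <= pot w.
Proof. have [q2' M1'] := (q2, M1).
move=> uw; apply: ge0_ler_powR; rewrite ?nnegrE ?trunc_ge0 ?trunc_mono//.
by lra.
Qed.

Lemma pot_le0 w : w <= 0 -> pot w = 0.
Proof. have [q2' M1'] := (q2, M1). by move=> w0; rewrite /pot trunc_le0// powR0// subr_eq0; apply/eqP; lra. Qed.

Lemma pot_geM w : M <= w -> pot w = M `^ (q - 2).
Proof. have [q2' M1'] := (q2, M1). by move=> w0; rewrite /pot trunc_geM. Qed.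

Lemma pot_id w : 0 <= w <= M -> pot w = w `^ (q - 2).
Proof. have [q2' M1'] := (q2, M1). by move=> w0; rewrite /pot trunc_id. Qed.

Lemma pot_leM w : pot w <= M `^ (q - 2).
Proof. have [q2' M1'] := (q2, M1).
apply: ge0_ler_powR; rewrite ?nnegrE ?trunc_ge0//; [lra|lra|].
by rewrite /trunc ge_min lexx orbT.
Qed.

Lemma pot1 : pot 1 = 1.
Proof. have [q2' M1'] := (q2, M1). by rewrite pot_id ?powR1//; lra. Qed.

Lemma mul_pot w : 0 <= w <= M -> w * pot w = w `^ (q - 1).
Proof. have [q2' M1'] := (q2, M1).
move=> wM; rewrite pot_id// -[RHS]mulr_powRB1; [|lra|lra].
by rewrite (_ : q - 1 - 1 = q - 2)//; lra.
Qed.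

Lemma nlinE w : 0 <= w <= M -> nlin w = w `^ (q - 1) - w.
Proof. have [q2' M1'] := (q2, M1). by move=> wM; rewrite /nlin mulrBr mul_pot// mulr1. Qed.

Lemma nlin0 : nlin 0 = 0. Proof. by rewrite /nlin mul0r. Qed.

Lemma nlin1 : nlin 1 = 0. Proof. have [q2' M1'] := (q2, M1). by rewrite /nlin pot1 subrr mulr0. Qed.

Lemma pot_lt1 w : w < 1 -> pot w < 1.
Proof. have [q2' M1'] := (q2, M1).
move=> w1; rewrite [ltRHS](_ : 1 = 1 `^ (q - 2)); last by rewrite powR1.
rewrite /pot.
apply: gt0_ltr_powR; rewrite ?nnegrE ?trunc_ge0//; first by lra.
case: (leP w 0) => w0; first by rewrite trunc_le0.
by rewrite trunc_id//; lra.
Qed.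

Lemma pot_gt1 w : 1 < w -> 1 < pot w.
Proof. have [q2' M1'] := (q2, M1).
move=> w1; rewrite [ltLHS](_ : 1 = 1 `^ (q - 2)); last by rewrite powR1.
rewrite /pot.
apply: gt0_ltr_powR; rewrite ?nnegrE ?trunc_ge0//; first by lra.
case: (leP w M) => w0; first by rewrite trunc_id//; lra.
by rewrite trunc_geM//; lra.
Qed.

Lemma nlin_lt0 w : 0 < w < 1 -> nlin w < 0.
Proof. have [q2' M1'] := (q2, M1). by move=> w01; have := @pot_lt1 w; rewrite /nlin; nra. Qed.

Lemma nlin_gt0 w : 1 < w -> 0 < nlin w.
Proof. have [q2' M1'] := (q2, M1). by move=> w01; have := @pot_gt1 w; rewrite /nlin; nra. Qed.

Lemma nlin_le0 w : w <= 0 -> nlin w = - w.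
Proof. have [q2' M1'] := (q2, M1). by move=> w0; rewrite /nlin pot_le0//; lra. Qed.

(** The slopes of w * pot w are 0, (q - 1) w^(q-2) and M^(q-2) in the three regimes, all between 0
    and (q - 1) M^(q-2). Intervals are cut at 0 and M by transitivity of [S], and the additional 1
    pays for the term -w. *)
Lemma nlin_lipschitz :
  exists2 L, 0 < L & forall u w, `|nlin u - nlin w| <= L * `|u - w|.
Proof. have [q2' M1'] := (q2, M1).
pose P := M `^ (q - 2); have P0 : 0 <= P by exact: powR_ge0.
pose L := (q - 1) * P.
have LP : P <= L by rewrite /L; nra.
pose g w := w * pot w.
have seg0 u w : u <= w -> 0 <= g w - g u.
  move=> uw; rewrite /g; case: (leP u 0) => u0.
    rewrite (pot_le0 u0) mulr0 subr0; case: (leP w 0) => w0.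
      by rewrite pot_le0// mulr0.
    by rewrite mulr_ge0 ?pot_ge0// ltW.
  by have := pot_mono uw; have := pot_ge0 u; nra.
pose S u w := g w - g u <= L * (w - u).
have tr u v w : S u v -> S v w -> S u w by rewrite /S; lra.
have n0 u w : u <= w -> w <= 0 -> S u w.
  move=> uw w0; rewrite /S /g !pot_le0//; last by lra.
  by rewrite !mulr0 subrr; nra.
have nM u w : M <= u -> u <= w -> S u w.
  by move=> uw w0; rewrite /S /g !pot_geM//; [rewrite -/P; nra|lra].
have n1 u w : 0 < u -> u <= w -> w <= M -> S u w.
  move=> u0 uw wM; move: (uw); rewrite le_eqVlt => /predU1P[->|uw'].
    by rewrite /S !subrr mulr0.
  have dg x : u <= x <= w -> is_derive x (1 : R) (fun t => t `^ (q - 1)) ((q - 1) * x `^ (q - 1 - 1)).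
    by move=> xu; apply: is_derive1_powR; lra.
  have [||c cu E] := @MVT_cc R (fun t => t `^ (q - 1)) (fun x => (q - 1) * x `^ (q - 1 - 1)) u w uw'.
  - by move=> x xu; apply: is_derive_cvg; apply: dg.
  - by move=> x xu; apply: dg; lra.
  rewrite /S /g !mul_pot ?E; [|lra|lra].
  rewrite ler_wpM2r ?subr_ge0// /L ler_wpM2l//; first by lra.
  rewrite (_ : q - 1 - 1 = q - 2); last by lra.
  by rewrite -pot_id ?pot_leM//; lra.
have n2 w : 0 <= w -> w <= M -> S 0 w.
  move=> w0 wM; rewrite /S /g mul0r; have := pot_leM w; rewrite -/P.
  by move=> ?; nra.
have n01 u w : 0 <= u -> u <= w -> w <= M -> S u w.
  by rewrite le_eqVlt => /predU1P[<-|]; [exact: n2|exact: n1].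
have n0M u w : 0 <= u -> u <= w -> S u w.
  move=> u0 uw; case: (leP w M) => wM; first exact: n01.
  case: (leP M u) => uM; first by apply: nM.
  by apply: (tr _ M); [apply: n01|apply: nM]; lra.
have nn u w : u <= w -> S u w.
  move=> uw; case: (leP w 0) => w0; first exact: n0.
  case: (leP 0 u) => uM; first by apply: n0M.
  by apply: (tr _ 0); [apply: n0|apply: n0M]; lra.
exists (L + 1) => [|u w]; first by lra.
have fE x : nlin x = g x - x by rewrite /nlin /g; ring.
wlog uw : u w / u <= w.
  move=> W; case/orP: (le_total u w) => uw; first exact: W.
  by rewrite distrC (distrC u); apply: W.
have := seg0 _ _ uw; have := nn _ _ uw; rewrite /S => h1 h2.
rewrite [X in _ * X]ler0_norm ?subr_le0// !fE ler_norml.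
by apply/andP; split; nra.
Qed.

Lemma prim_id w : 0 < w <= M -> prim w = w `^ q / q - w ^+ 2 / 2.
Proof. have [q2' M1'] := (q2, M1).
move=> wM; rewrite /prim trunc_id ?pot_id; [|lra|lra].
have -> : w `^ q = w `^ (q - 2) * w ^+ 2.
  rewrite -powR_mulrn; last by lra.
  rewrite -powRD; first by congr (_ `^ _); lra.
  by apply/implyP => _; apply/eqP; lra.
by field; rewrite gt_eqF.
Qed.

Lemma prim_pot w : 0 < w <= M -> prim w = w ^+ 2 * (pot w / q - 2^-1).
Proof. have [q2' M1'] := (q2, M1).
move=> wM; rewrite prim_id// pot_id; last by lra.
have -> : w `^ q = w `^ (q - 2) * w ^+ 2.
  rewrite -powR_mulrn; last by lra.
  rewrite -powRD; first by congr (_ `^ _); lra.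
  by apply/implyP => _; apply/eqP; lra.
by field; rewrite gt_eqF.
Qed.

Lemma prim_geM w : M <= w ->
  prim w = (q^-1 - 2^-1) * M `^ q + M `^ (q - 2) * w ^+ 2 / 2 - w ^+ 2 / 2.
Proof. have [q2' M1'] := (q2, M1). by move=> wM; rewrite /prim trunc_geM// pot_geM. Qed.

Lemma is_derive_prim (w : R) : 0 < w -> is_derive w (1 : R) prim (nlin w).
Proof. have [q2' M1'] := (q2, M1).
move=> w0.
pose f1 (t : R) := t `^ q * q^-1 - t ^+ 2 * 2^-1.
pose f2 (t : R) := ((q^-1 - 2^-1) * M `^ q + M `^ (q - 2) * (t ^+ 2 * 2^-1)) - t ^+ 2 * 2^-1.
have E1 t : 0 < t <= M -> prim t = f1 t by exact: prim_id.
have E2 t : M <= t -> prim t = f2 t by move=> tM; rewrite prim_geM// /f2; lra.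
have D1 : w <= M -> is_derive w 1 f1 (nlin w).
  move=> wM; apply: (is_derive_eq (is_derive1B (is_derive1M (is_derive1_powR _ w0)
     (is_derive1_cst _ _)) (is_derive1M (is_derive1X 2 (is_derive1_id w)) (is_derive1_cst _ _)))).
  rewrite nlinE ?expr1; last by lra.
  by field; rewrite gt_eqF.
have D2 : M <= w -> is_derive w 1 f2 (nlin w).
  move=> wM; apply: (is_derive_eq (is_derive1B (is_derive1D (is_derive1_cst _ _)
     (is_derive1M (is_derive1_cst _ _) (is_derive1M (is_derive1X 2 (is_derive1_id w)) (is_derive1_cst _ _))))
     (is_derive1M (is_derive1X 2 (is_derive1_id w)) (is_derive1_cst _ _)))).
  by rewrite /nlin pot_geM//; lra.
case: (ltgtP w M) => wM.
- apply: (@is_derive1_near _ f1 _ _ _ (Num.min w (M - w))); last by apply: D1; exact: ltW.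
    by rewrite lt_min w0; lra.
  by move=> y; rewrite lt_min !ltr_norml => ?; rewrite E1//; lra.
- apply: (@is_derive1_near _ f2 _ _ _ (w - M)); last by apply: D2; exact: ltW.
    by lra.
  by move=> y; rewrite ltr_norml => ?; rewrite E2//; lra.
apply: (@is_derive1_glue _ _ f1 f2 _ _ w) => //; [|move=> y /andP[? ?]; rewrite E2//; lra|by apply: D1; rewrite wM|by apply: D2; rewrite wM].
by move=> y ?; rewrite E1//; lra.
Qed.

Lemma prim_lt0 w : 0 < w <= 1 -> prim w < 0.
Proof. have [q2' M1'] := (q2, M1).
move=> w1; rewrite prim_pot; last by lra.
have p1 : pot w <= 1 by rewrite -pot1 pot_mono//; lra.
have w2 : 0 < w ^+ 2 by rewrite exprn_gt0//; lra.
suff : pot w / q < 2^-1 by nra.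
by rewrite ltr_pdivrMr//; lra.
Qed.

Lemma prim_ge0_gt1 w : 0 < w -> 0 <= prim w -> 1 < w.
Proof. have [q2' M1'] := (q2, M1). by move=> w0 pw; rewrite ltNge; apply/negP => w1; have := @prim_lt0 w; lra. Qed.

Lemma prim_mono u w : 1 <= u -> u <= w -> prim u <= prim w.
Proof.
have [q2' M1'] := (q2, M1).
move=> u1 uw.
have D x : u <= x -> is_derive x (1 : R) prim (nlin x) by move=> ux; apply: is_derive_prim; lra.
apply: (@nondecr_cc R prim nlin u w uw).
- by move=> x /andP[ux _]; exact: (is_derive_cvg (D x ux)).
- by move=> x /andP[ux _]; exact: (D x (ltW ux)).
- by move=> x xu; apply: ltW; apply: nlin_gt0; lra.
Qed.

Lemma prim_smono u w : 1 <= u -> u < w -> prim u < prim w.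
Proof.
have [q2' M1'] := (q2, M1).
move=> u1 uw.
have D x : u <= x -> is_derive x (1 : R) prim (nlin x) by move=> ux; apply: is_derive_prim; lra.
have [||c cu E] := @MVT_cc R prim nlin u w uw.
- by move=> x /andP[ux _]; exact: (is_derive_cvg (D x ux)).
- by move=> x /andP[ux _]; exact: (D x (ltW ux)).
by have := @nlin_gt0 c; nra.
Qed.

(** Below M, [prim] is w^2 (pot w / q - 1/2), and 2 / q > 1/2; above M it is increasing. *)
Lemma prim_gt0 w : 0 < w -> q < 4 -> 2 <= pot w -> 0 < prim w.
Proof. have [q2' M1'] := (q2, M1).
move=> w0 q4 pw.
have pos u : 0 < u <= M -> 2 <= pot u -> 0 < prim u.
  move=> uM pu; rewrite prim_pot//.
  have u2 : 0 < u ^+ 2 by rewrite exprn_gt0//; lra.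
  suff : 2^-1 < pot u / q by nra.
  by rewrite ltr_pdivlMr//; lra.
case: (leP w M) => wM; first by apply: pos; rewrite ?w0.
apply: lt_le_trans (pos M _ _) (prim_mono _ (ltW wM)); [|move: pw; rewrite pot_geM ?(pot_geM (lexx M))//; lra|]; lra.
Qed.

(** On [0, M] this is an equality; above M the two sides differ by (2 - 4/q) (pot w * w^2 - trunc w
    ^ q). The coefficient 4/q - 1 is positive exactly for q < 4: this is where subcriticality in
    dimension 4 enters. *)
Lemma pohozaev_density w : q < 4 -> 0 <= w ->
  w ^+ 2 * ((4 / q - 1) * pot w - 1) <= 4 * prim w - w * nlin w.
Proof. have [q2' M1'] := (q2, M1).
move=> q4 w0; rewrite /prim /nlin.
have Et : trunc w `^ q = pot w * trunc w ^+ 2.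
  rewrite /pot -powR_mulrn ?trunc_ge0//.
  rewrite -powRD; first by congr (_ `^ _); lra.
  by apply/implyP => /eqP; lra.
have tw : trunc w <= w.
  case: (leP w M) => wM; first by rewrite trunc_id ?w0.
  by rewrite trunc_geM; lra.
have h : trunc w `^ q <= pot w * w ^+ 2.
  by rewrite Et ler_wpM2l ?pot_ge0// lerXn2r// nnegrE ?trunc_ge0.
have c2 : q^-1 <= 2^-1 by rewrite lef_pV2 ?posrE//; lra.
have : 0 <= (2^-1 - q^-1) * (pot w * w ^+ 2 - trunc w `^ q) by rewrite mulr_ge0//; lra.
by lra.
Qed.

(** Hence kappa (q - 2) is the number to compare with the eigenvalues k (k + 2n + 1). *)
Lemma is_derive_nlin1 : is_derive (1 : R) (1 : R) nlin (q - 2).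
Proof. have [q2' M1'] := (q2, M1).
apply: (@is_derive1_near _ (fun t => t `^ (q - 1) - t) _ _ _ (Num.min 1 (M - 1))).
- by rewrite lt_min; lra.
- by move=> y; rewrite lt_min !ltr_norml => ?; rewrite nlinE//; lra.
apply: (is_derive_eq (is_derive1B (is_derive1_powR _ ltr01) (is_derive1_id _))).
by rewrite powR1; lra.
Qed.

End TruncatedPower.

(** * The singular initial value problem *)

Section Antiderivative.
Variable R : realType.
Implicit Types (h f g : R -> R) (x z : R).

(** For continuous [h], the antiderivative vanishing at 0. If there is no such function the zero
    function is returned. *)
Definition antider h : R -> R :=
  xget (fun=> 0) [set F | F 0 = 0 /\ forall x, is_derive x (1 : R) F (h x)].

Lemma antiderP h : continuous h ->
  antider h 0 = 0 /\ forall x, is_derive x (1 : R) (antider h) (h x).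
Proof.
move=> ch; have [F HF] := antiderivative_ex ch.
by rewrite /antider; case: xgetP => [y _ //|/(_ F)].
Qed.

Lemma antider0 h : continuous h -> antider h 0 = 0.
Proof. by case/antiderP. Qed.

Lemma is_derive_antider h x : continuous h -> is_derive x (1 : R) (antider h) (h x).
Proof. by case/antiderP. Qed.

(** Stands for bounding the integral of h - g by that of dG: both G minus and G plus the difference
    of antiderivatives are nondecreasing on [0, z]. *)
Lemma antider_diff_le h g G dG z : continuous h -> continuous g -> 0 <= z ->
  (forall x, 0 <= x <= z -> is_derive x (1 : R) G (dG x)) ->
  (forall x, 0 < x < z -> `|h x - g x| <= dG x) ->
  `|antider h z - antider g z| <= G z - G 0.
Proof.
move=> ch cg z0 GD hg.
have hD x := is_derive_antider x ch; have gD x := is_derive_antider x cg.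
have D1 x : 0 <= x <= z -> is_derive x (1 : R) (fun t => G t - (antider h t - antider g t)) (dG x - (h x - g x)).
  by move=> xz; exact: (is_derive1B (GD x xz) (is_derive1B (hD x) (gD x))).
have D2 x : 0 <= x <= z -> is_derive x (1 : R) (fun t => G t + (antider h t - antider g t)) (dG x + (h x - g x)).
  by move=> xz; exact: (is_derive1D (GD x xz) (is_derive1B (hD x) (gD x))).
have [h0 g0] := (antider0 ch, antider0 cg).
have := @nondecr_cc R _ _ 0 z z0 (fun x xz => is_derive_cvg (D1 x xz)).
move=> /(_ (fun x => dG x - (h x - g x))) H1.
have := @nondecr_cc R _ _ 0 z z0 (fun x xz => is_derive_cvg (D2 x xz)).
move=> /(_ (fun x => dG x + (h x - g x))) H2.
have {}H1 := H1 (fun x (xz : 0 < x < z) => D1 x (ltac:(lra))).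
have {}H2 := H2 (fun x (xz : 0 < x < z) => D2 x (ltac:(lra))).
have {}H1 := H1 (fun x xz => ltac:(have := hg x xz; rewrite ler_norml; lra)).
have {}H2 := H2 (fun x xz => ltac:(have := hg x xz; rewrite ler_norml; lra)).
by rewrite /= h0 g0 in H1 H2; rewrite ler_norml; lra.
Qed.

(* z^-(m+1) \int_0^z t^m h(t) dt, extended to z <= 0 by its limit at 0+ *)
Definition avg m h z : R :=
  if z <= 0 then h 0 / m.+1%:R else antider (fun t => t ^+ m * h t) z / z ^+ m.+1.

Lemma pow_mul_continuous m h : continuous h -> continuous (fun t : R => t ^+ m * h t).
Proof.
move=> ch x.
exact: (continuous1M (is_derive_cvg (is_derive1X m (is_derive1_id x))) (ch x)).
Qed.

(** Only 0 is delicate. Replacing [h] on [0, z] by the constant h 0, whose average is exact, costs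
    at most e / 2 / (m + 1). *)
Lemma avg_continuous m h : continuous h -> continuous (avg m h).
Proof.
move=> ch z; have ck := @pow_mul_continuous m h ch.
have m0 : m.+1%:R != 0 :> R by rewrite pnatr_eq0.
have mp : 0 < m.+1%:R :> R by rewrite ltr0n.
case: (ltgtP z 0) => z0.
- apply: (@continuous_near _ (fun=> h 0 / m.+1%:R) _ _ (- z)); first by lra.
    by move=> y; rewrite ltr_norml => yz; rewrite /avg ifT//; lra.
  exact: (is_derive_cvg (is_derive1_cst _ _)).
- apply: (@continuous_near _ (fun z => antider (fun t => t ^+ m * h t) z * (z ^+ m.+1)^-1) _ _ z) => //.
    by move=> y; rewrite ltr_norml => yz; rewrite /avg ifF//; apply/negbTE; rewrite -ltNge; lra.
  have z1 : z ^+ m.+1 != 0 by rewrite expf_neq0// gt_eqF.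
  exact: (is_derive_cvg (is_derive1M (is_derive_antider z ck)
    (is_derive1V (is_derive1X m.+1 (is_derive1_id z)) z1))).
rewrite z0; apply/continuous_atP => e e0.
have e2 : 0 < e / 2 by lra.
have /continuous_atP/(_ _ e2)[d d0 dH] := ch 0.
exists d => // y; rewrite subr0 => yd.
case: (leP y 0) => y0; first by rewrite /avg y0 lexx subrr normr0.
rewrite {2}/avg lexx /avg ifF; last by apply/negbTE; rewrite -ltNge.
have cg : continuous (fun t : R => t ^+ m * h 0).
  by apply: pow_mul_continuous => x; exact: (is_derive_cvg (is_derive1_cst _ _)).
have gE : antider (fun t : R => t ^+ m * h 0) y = h 0 / m.+1%:R * y ^+ m.+1.
  have D x : is_derive x (1 : R) (fun t => antider (fun t : R => t ^+ m * h 0) t - h 0 / m.+1%:R * t ^+ m.+1) 0.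
    apply: (is_derive_eq (is_derive1B (is_derive_antider x cg) (is_derive1M (is_derive1_cst _ _) (is_derive1X m.+1 (is_derive1_id x))))).
    by rewrite /=; field.
  have [c _] := @MVT_cc R _ (fun=> 0) 0 y y0 (fun x _ => is_derive_cvg (D x)) (fun x _ => D x).
  rewrite mul0r antider0// expr0n /= mulr0 !subr0 => /eqP.
  by rewrite subr_eq0 => /eqP.
have y1 : 0 < y ^+ m.+1 by exact: exprn_gt0.
rewrite -[h 0 / m.+1%:R](mulfK (lt0r_neq0 y1)) -gE -mulrBl normrM normfV (gtr0_norm y1).
rewrite ltr_pdivrMr//.
have : `|antider (fun t : R => t ^+ m * h t) y - antider (fun t : R => t ^+ m * h 0) y|
   <= e / 2 / m.+1%:R * y ^+ m.+1 - e / 2 / m.+1%:R * 0 ^+ m.+1.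
  apply: (@antider_diff_le _ _ (fun t => e / 2 / m.+1%:R * t ^+ m.+1) (fun t => e / 2 * t ^+ m)); [exact: ck|exact: cg|exact: ltW| |].
    move=> x _; apply: (is_derive_eq (is_derive1M (is_derive1_cst _ _) (is_derive1X m.+1 (is_derive1_id x)))).
    by rewrite /=; field.
  move=> x xy; rewrite -mulrBr normrM ger0_norm ?exprn_ge0//; last by lra.
  rewrite mulrC ler_wpM2r ?exprn_ge0//; first by lra.
  apply: ltW; apply: dH; rewrite subr0; move: yd; rewrite !gtr0_norm//; lra.
rewrite expr0n /= mulr0 subr0 => H; apply: (le_lt_trans H).
rewrite ltr_pM2r// ltr_pdivrMr//.
have : 1 <= m.+1%:R :> R by rewrite ler1n.
by nra.
Qed.

End Antiderivative.

(** * Geometrically convergent sequences *)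

Section GeometricCauchy.
Variable R : realType.

Lemma geometric_small (x C : R) : (forall k, x <= C * 2^-1 ^+ k) -> x <= 0.
Proof.
move=> H; rewrite leNgt; apply/negP => x0.
have C0 : 0 < C by have := H 0%N; rewrite expr0 mulr1; lra.
have bern k : (k%:R + 1) * 2^-1 ^+ k <= (1 : R).
  elim: k => [|k IH]; first by rewrite expr0 mulr1 add0r.
  have p0 : (0 : R) <= 2^-1 ^+ k by rewrite exprn_ge0// invr_ge0.
  have k0 : 0 <= (k%:R : R) by [].
  have kp : 0 <= k%:R * 2^-1 ^+ k :> R by rewrite mulr_ge0.
  by rewrite exprS -natr1; lra.
have := H (Num.truncn (C / x)).
set k := Num.truncn _ => Hk.
have : C / x < k.+1%:R by apply: truncnS_gt.
rewrite ltr_pdivrMr// -natr1 => h1.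
have := bern k; have : (0 : R) < 2^-1 ^+ k by rewrite exprn_gt0// invr_gt0.
by nra.
Qed.

(** The intervals of radius 2 C 2^-k about u k are nested, and the limit is the supremum of their
    left ends. *)
Lemma geometric_cauchy (u : nat -> R) C :
  (forall k, `|u k.+1 - u k| <= C * 2^-1 ^+ k) ->
  exists l, forall k, `|l - u k| <= 2 * C * 2^-1 ^+ k.
Proof.
move=> H.
have st k : 2^-1 ^+ k.+1 = 2^-1 * 2^-1 ^+ k :> R by rewrite exprS.
have lo j k : (j <= k)%N -> u j - 2 * C * 2^-1 ^+ j <= u k - 2 * C * 2^-1 ^+ k.
  move=> /subnK <-; elim: (k - j)%N => [|i IH]; first by rewrite add0n.
  apply: (le_trans IH); rewrite addSn st; have := H (i + j)%N; rewrite ler_norml; lra.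
have up j k : (j <= k)%N -> u k + 2 * C * 2^-1 ^+ k <= u j + 2 * C * 2^-1 ^+ j.
  move=> /subnK <-; elim: (k - j)%N => [|i IH]; first by rewrite add0n.
  apply: (le_trans _ IH); rewrite addSn st; have := H (i + j)%N; rewrite ler_norml; lra.
have C0 : 0 <= C by have := H 0%N; rewrite expr0 mulr1; apply: le_trans.
have p0 k : 0 <= C * 2^-1 ^+ k by rewrite mulr_ge0// exprn_ge0// invr_ge0.
have lu j k : u j - 2 * C * 2^-1 ^+ j <= u k + 2 * C * 2^-1 ^+ k.
  have := p0 j; have := p0 k.
  case/orP: (leq_total j k) => [/[dup]/lo h1 /up h2|/[dup]/lo h1 /up h2]; lra.
pose S := [set x | exists j, x = u j - 2 * C * 2^-1 ^+ j].
have S0 : S !=set0 by exists (u 0%N - 2 * C * 2^-1 ^+ 0); exists 0%N.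
have Sub k : ubound S (u k + 2 * C * 2^-1 ^+ k) by move=> x [j ->].
exists (sup S) => k; rewrite ler_norml.
have : sup S <= u k + 2 * C * 2^-1 ^+ k by apply: ge_sup.
have : u k - 2 * C * 2^-1 ^+ k <= sup S.
  by apply: ub_le_sup; [exists (u 0%N + 2 * C * 2^-1 ^+ 0)|exists k].
by move=> ? ?; lra.
Qed.

End GeometricCauchy.

(** * Picard iteration on the half-line z = x / (1 - x) *)

Section SingularVolterra.
Variable R : realType.
Variables (f : R -> R) (L kappa : R) (m : nat).
Hypothesis L0 : 0 < L.
Hypothesis kappa0 : 0 < kappa.
Hypothesis fL : forall u w, `|f u - f w| <= L * `|u - w|.

Let f_continuous : continuous f.
Proof.
have [L0' fL'] := (L0, fL).
move=> x; apply/continuous_atP => e e0; exists (e / L) => [|y yx]; first exact: divr_gt0.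
by apply: (le_lt_trans (fL' _ _)); rewrite mulrC -ltr_pdivlMr.
Qed.

(** Under z = x / (1 - x) the measure x^m (1 - x) dx becomes z^m (1 + z)^(-m-3) dz, and x = z / (1 +
    z). For z > 0, [flux] is therefore x^(-m-1) times the integral of s^m (1 - s) phi over [0, x].
    The absolute values keep the formulas continuous for z < 0. *)
Definition damp (phi : R -> R) (z : R) : R := (1 + `|z|) ^- m.+3 * phi z.
Definition flux (phi : R -> R) (z : R) : R := (1 + `|z|) ^+ m.+1 * avg m (damp phi) z.

Let one_norm (z : R) : 0 < 1 + `|z|.
Proof. by rewrite ltr_pwDl. Qed.

Let one_norm_cont k : continuous (fun z : R => (1 + `|z|) ^+ k).
Proof.
move=> z; apply: (@continuous1_chain _ (fun t => (1 + t) ^+ k) (fun t => `|t|)); last exact: norm_continuous.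
exact: (is_derive_cvg (is_derive1X k (is_derive1D (is_derive1_cst 1 _) (is_derive1_id _)))).
Qed.

Let damp_continuous (phi : R -> R) : continuous phi -> continuous (damp phi).
Proof.
move=> cp z.
have n0 : (1 + `|z|) ^+ m.+3 != 0 by rewrite expf_neq0// gt_eqF.
have h1 := @continuous1V R (fun z => (1 + `|z|) ^+ m.+3) z n0 (@one_norm_cont m.+3 z).
exact: (continuous1M h1 (cp z)).
Qed.

Let flux_continuous (phi : R -> R) : continuous phi -> continuous (flux phi).
Proof.
move=> cp z.
have h2 : {for z, continuous (avg m (damp phi))} by exact: (@avg_continuous R m _ (@damp_continuous phi cp) z).
exact: (@continuous1M R (fun z => (1 + `|z|) ^+ m.+1) _ z (@one_norm_cont m.+1 z) h2).
Qed.

(* (z/(1+z))^(m+1) has derivative at least z^m (1+z)^(-m-3), the weight in the average *)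
Let flux_diff_le (phi psi : R -> R) (B z : R) : continuous phi -> continuous psi -> 0 <= z ->
  (forall s, 0 <= s <= z -> `|phi s - psi s| <= B) -> `|flux phi z - flux psi z| <= B.
Proof.
move=> cp cq; rewrite le_eqVlt => /predU1P[<-|z0] H.
  rewrite /flux /avg lexx /damp normr0 addr0 !expr1n invr1 !mul1r -mulrBl normrM normfV.
  have H0 : `|phi 0 - psi 0| <= B by apply: H; rewrite lexx.
  rewrite ler_pdivrMr ?normr_gt0// (le_trans H0)// ger0_norm//.
  have B0 : 0 <= B by exact: le_trans H0.
  by rewrite ler_peMr// ler1n.
have B0 : 0 <= B by apply: (le_trans (normr_ge0 _) (H z _)); rewrite lexx ltW.
have zF : (z <= 0) = false by apply/negbTE; rewrite -ltNge.
rewrite /flux /avg zF.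
rewrite -mulrBr -mulrBl normrM normrM normfV (gtr0_norm (exprn_gt0 _ (one_norm z))).
rewrite (gtr0_norm (exprn_gt0 _ z0)) mulrCA -ler_pdivlMr; last first.
  by rewrite divr_gt0// exprn_gt0.
have ck := @pow_mul_continuous R m _ (@damp_continuous phi cp).
have cl := @pow_mul_continuous R m _ (@damp_continuous psi cq).
have nz (t : R) : 0 <= t -> 1 + t != 0 by move=> t0; rewrite gt_eqF// ltr_pwDl.
have D (t : R) : 0 <= t <= z -> is_derive t (1 : R) (fun t : R => B * (t * (1 + t)^-1) ^+ m.+1)
   (B * (m.+1%:R * (t * (1 + t)^-1) ^+ m * (1 + t) ^- 2)).
  move=> /andP[t0 _].
  apply: (is_derive_eq (is_derive1M (is_derive1_cst B _) (is_derive1X m.+1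
   (is_derive1M (is_derive1_id t) (is_derive1V (is_derive1D (is_derive1_cst 1 _) (is_derive1_id t)) (nz _ t0)))))).
  by rewrite /=; field; exact: nz.
have HH (t : R) : 0 < t < z -> `|t ^+ m * damp phi t - t ^+ m * damp psi t| <=
    B * (m.+1%:R * (t * (1 + t)^-1) ^+ m * (1 + t) ^- 2).
  move=> /andP[t0 tz]; rewrite /damp -!mulrBr (gtr0_norm t0) !normrM.
  have t1 : 0 < 1 + t by lra.
  rewrite normfV !(gtr0_norm (exprn_gt0 _ _))// exprMn exprVn.
  have -> : (1 + t) ^- m.+3 = (1 + t) ^- m * (1 + t) ^- 2 * (1 + t) ^-1.
    by rewrite -!invfM -exprD -exprSr addnC.
  set X := (1 + t) ^- m; set Y := (1 + t) ^- 2.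
  have X0 : 0 <= X by rewrite invr_ge0 exprn_ge0// ltW.
  have Y0 : 0 <= Y by rewrite invr_ge0 exprn_ge0// ltW.
  have i1 : (1 + t)^-1 <= 1 by rewrite invf_le1//; lra.
  have i0 : 0 <= (1 + t)^-1 by rewrite invr_ge0 ltW.
  have m1 : 1 <= m.+1%:R :> R by rewrite ler1n.
  have P0 : 0 <= t ^+ m * X * Y by rewrite !mulr_ge0// exprn_ge0// ltW.
  have h : `|phi t - psi t| <= B by apply: H; rewrite !ltW.
  have -> : t ^+ m * (X * Y * (1 + t)^-1 * `|phi t - psi t|) = (t ^+ m * X * Y) * ((1 + t)^-1 * `|phi t - psi t|) by ring.
  have -> : B * (m.+1%:R * (t ^+ m * X) * Y) = (t ^+ m * X * Y) * (m.+1%:R * B) by ring.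
  rewrite ler_wpM2l//; apply: ler_pM => //.
  exact: le_trans i1 m1.
have := antider_diff_le ck cl (ltW z0) D HH.
rewrite mul0r expr0n /= mulr0 subr0 => /le_trans; apply.
by rewrite (gtr0_norm z0) exprMn exprVn invf_div.
Qed.

Definition picard_map (a : R) (w : R -> R) (z : R) : R :=
  a - kappa * antider (flux (fun t => f (w t))) z.

Let fw_continuous (w : R -> R) : continuous w -> continuous (fun t => f (w t)).
Proof. by move=> cw z; exact: (@continuous1_chain R f w z (@f_continuous (w z)) (cw z)). Qed.

Let is_derive_picard (a : R) (w : R -> R) (z : R) : continuous w ->
  is_derive z (1 : R) (picard_map a w) (- kappa * flux (fun t => f (w t)) z).
Proof.
move=> cw; have cf := @flux_continuous _ (@fw_continuous _ cw).
apply: (is_derive_eq (is_derive1B (is_derive1_cst a _) (is_derive1M (is_derive1_cst kappa _) (is_derive_antider z cf)))).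
by rewrite mul0r !add0r mulNr.
Qed.

Let picard_continuous (a : R) (w : R -> R) : continuous w -> continuous (picard_map a w).
Proof. by move=> cw z; exact: (is_derive_cvg (is_derive_picard a z cw)). Qed.

Let picard0 (a : R) (w : R -> R) : continuous w -> picard_map a w 0 = a.
Proof. by move=> cw; rewrite /picard_map antider0 ?mulr0 ?subr0//; exact: @flux_continuous _ (@fw_continuous _ cw). Qed.

Let Lam := 2 * kappa * L.
(** Bielecki weight: with respect to the supremum of |w| / weight on the half-line the Picard map
    contracts by the factor 1/2. *)
Definition weight (z : R) : R := expR (Lam * z).

Let Lam0 : 0 < Lam.
Proof. by rewrite /Lam !mulr_gt0. Qed.

Let weight_gt0 z : 0 < weight z. Proof. exact: expR_gt0. Qed.

Let weight_mono (s z : R) : s <= z -> weight s <= weight z.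
Proof. by move=> sz; rewrite /weight ler_expR ler_pM2l. Qed.

Let weight_ge1 z : 0 <= z -> 1 <= weight z.
Proof. by move=> z0; rewrite /weight -expR0 ler_expR mulr_ge0// ltW. Qed.

Let flux_lip (w v : R -> R) (D z : R) : continuous w -> continuous v -> 0 <= D -> 0 <= z ->
  (forall s, 0 <= s <= z -> `|w s - v s| <= D * weight s) ->
  `|flux (fun t => f (w t)) z - flux (fun t => f (v t)) z| <= L * D * weight z.
Proof.
move=> cw cv D0 z0 H; apply: flux_diff_le => //; try exact: fw_continuous.
move=> s sz; apply: (le_trans (fL _ _)); rewrite -mulrA ler_pM2l//.
apply: (le_trans (H _ sz)); rewrite ler_wpM2l//; apply: weight_mono; by case/andP: sz.
Qed.

(** The flux does not increase sup norms, [f] costs a factor L, and kappa L times the integral of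
    [weight] is at most weight / 2 because Lam = 2 kappa L. Allowing two starting values lets one
    estimate serve both convergence and dependence on a. *)
Let picard_contract (a b : R) (w v : R -> R) (D z : R) : continuous w -> continuous v -> 0 <= D -> 0 <= z ->
  (forall s, 0 <= s -> `|w s - v s| <= D * weight s) ->
  `|picard_map a w z - picard_map b v z| <= `|a - b| + D / 2 * weight z.
Proof.
move=> cw cv D0 z0 H.
have k0 := kappa0; have l0 := L0.
have cf := @flux_continuous _ (@fw_continuous _ cw); have cg := @flux_continuous _ (@fw_continuous _ cv).
have DG x : 0 <= x <= z -> is_derive x (1 : R) (fun t => D / (2 * kappa) * weight t) (L * D * weight x).
  move=> _; rewrite /weight.
  apply: (is_derive_eq (is_derive1M (is_derive1_cst _ _) (is_derive1_chain (is_derive_expR _) (is_derive1M (is_derive1_cst _ _) (is_derive1_id _))))).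
  by rewrite /Lam; field; rewrite gt_eqF.
have H2 x : 0 < x < z -> `|flux (fun t => f (w t)) x - flux (fun t => f (v t)) x| <= L * D * weight x.
  by move=> xz; apply: flux_lip => // [|s /andP[s0 _]]; [lra|exact: H].
have := antider_diff_le cf cg z0 DG H2.
rewrite /picard_map => h.
have -> : a - kappa * antider (flux (fun t => f (w t))) z - (b - kappa * antider (flux (fun t => f (v t))) z)
  = (a - b) - kappa * (antider (flux (fun t => f (w t))) z - antider (flux (fun t => f (v t))) z) by ring.
apply: (le_trans (ler_normB _ _)); rewrite lerD2l normrM gtr0_norm//.
have -> : D / 2 * weight z = kappa * (D / (2 * kappa) * weight z) by field; rewrite gt_eqF.
rewrite ler_pM2l//; apply: (le_trans h).
by rewrite gerBl mulr_ge0 ?(ltW (weight_gt0 _))// divr_ge0// mulr_ge0// ltW.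
Qed.

Fixpoint picard_iter (a : R) (k : nat) : R -> R :=
  if k is k'.+1 then picard_map a (picard_iter a k') else fun=> a.

Let iter_continuous (a : R) k : continuous (picard_iter a k).
Proof.
elim: k => [|k IH]; last exact: picard_continuous.
by move=> x; exact: (is_derive_cvg (is_derive1_cst a x)).
Qed.

(** Size of the first Picard step, which is at most kappa |f a| z = gap a * (Lam * z) <= gap a *
    weight z. *)
Let gap (a : R) : R := `|f a| / (2 * L).

Let gap_ge0 a : 0 <= gap a.
Proof. by rewrite /gap divr_ge0// mulr_ge0// ltW. Qed.

Let iter_step (a z : R) k : 0 <= z ->
  `|picard_iter a k.+1 z - picard_iter a k z| <= gap a * 2^-1 ^+ k * weight z.
Proof.
have l0 := L0; have k0 := kappa0.
elim: k z => [|k IH] z z0.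
  rewrite expr0 mulr1 /= /picard_map.
  have cc : continuous (fun _ : R => f a) by move=> x; exact: (is_derive_cvg (is_derive1_cst (f a) x)).
  have c0 : continuous (fun _ : R => 0 : R) by move=> x; exact: (is_derive_cvg (is_derive1_cst 0 x)).
  have E0 x : flux (fun=> 0) x = 0.
    have avg0 : forall y, avg m (damp (fun=> 0)) y = 0 -> flux (fun=> 0) y = 0.
      by move=> y E; rewrite /flux E mulr0.
    apply: avg0; rewrite /avg /damp; case: ifP => _; first by rewrite mulr0 mul0r.
    rewrite (_ : (fun t : R => _) = (fun=> 0)); last by apply/funext => t; rewrite !mulr0.
    suff -> : antider (fun=> 0) x = 0 by rewrite mul0r.
    have := @antider_diff_le R (fun=> 0) (fun=> 0) (fun=> 0) (fun=> 0) `|x| c0 c0 (normr_ge0 _).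
    have D y := is_derive_antider y c0.
    have : antider (fun=> 0) x = antider (fun=> 0) (0 : R) by exact: (@is_derive_0_is_cst R _ _ _ (fun y => D y)).
    by move=> -> _; rewrite antider0.
  have Hf x : 0 < x < z -> `|flux (fun=> f a) x - 0| <= `|f a|.
    move=> /andP[x0 _]; rewrite -(E0 x); apply: flux_diff_le => //; first exact: ltW.
    by move=> s _; rewrite subr0.
  have D (x : R) : 0 <= x <= z -> is_derive x (1 : R) (fun t => `|f a| * t) `|f a|.
    by move=> _; apply: (is_derive_eq (is_derive1M (is_derive1_cst _ _) (is_derive1_id _))); rewrite mul0r add0r mulr1.
  have := antider_diff_le (@flux_continuous _ cc) c0 z0 D Hf.
  have -> : antider (fun=> 0) z = 0.
    have D0 y := is_derive_antider y c0.
    have : antider (fun=> 0) z = antider (fun=> 0) (0 : R) by exact: (@is_derive_0_is_cst R _ _ _ (fun y => D0 y)).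
    by move=> ->; rewrite antider0.
  rewrite mulr0 !subr0 => h.
  rewrite (_ : a - _ - a = - (kappa * antider (flux (fun=> f a)) z)); last by ring.
  rewrite normrN normrM gtr0_norm// /gap.
  have w1 : Lam * z <= weight z by apply: ltW; apply: (lt_le_trans _ (expR_ge1Dx _)); lra.
  apply: (@le_trans _ _ (`|f a| / (2 * L) * (Lam * z))).
    rewrite (_ : `|f a| / (2 * L) * (Lam * z) = kappa * (`|f a| * z)); last by rewrite /Lam; field; rewrite gt_eqF.
    by rewrite ler_pM2l.
  by rewrite ler_wpM2l// -/(gap a).
have D0 : 0 <= gap a * 2^-1 ^+ k by rewrite mulr_ge0// exprn_ge0// invr_ge0.
have := @picard_contract a a _ _ _ z (@iter_continuous a k.+1) (@iter_continuous a k) D0 z0 (fun s s0 => IH s s0).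
rewrite subrr normr0 add0r => /le_trans; apply.
by rewrite [in leRHS]exprS mulrCA [in leRHS](mulrC 2^-1).
Qed.

Let limit_ex (a z : R) : 0 <= z -> exists l, forall k,
  `|l - picard_iter a k z| <= 2 * (gap a * weight z) * 2^-1 ^+ k.
Proof.
move=> z0; apply: geometric_cauchy => k; apply: (le_trans (iter_step a k z0)).
by rewrite mulrAC.
Qed.

(** Clipping z at 0 makes the limit constant on the negative half-line, hence continuous on the
    whole line as the antiderivatives require. *)
Definition picard_limit (a z : R) : R :=
  xget 0 [set l | forall k,
    `|l - picard_iter a k (Num.max z 0)| <= 2 * (gap a * weight (Num.max z 0)) * 2^-1 ^+ k].

Let picard_limitP (a z : R) k : 0 <= z ->
  `|picard_limit a z - picard_iter a k z| <= 2 * (gap a * weight z) * 2^-1 ^+ k.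
Proof.
move=> z0; have [l Hl] := limit_ex a z0.
rewrite /picard_limit (max_idPl z0); case: xgetP => [y _ /(_ k)//|/(_ l)].
by move=> /(_ Hl).
Qed.

Let limit_continuous a : continuous (picard_limit a).
Proof.
move=> z; apply/continuous_atP => e e0.
pose B := 2 * (gap a * weight (`|z| + 1)).
have B0 : 0 <= B by rewrite /B mulr_ge0// mulr_ge0// ltW.
have [k Hk] : exists k, B * 2^-1 ^+ k < e / 3.
  have [//|nH] := pselect (exists k, B * 2^-1 ^+ k < e / 3).
  suff : e / 3 <= 0 by lra.
  apply: (@geometric_small R _ B) => k; rewrite leNgt; apply/negP => h.
  by apply: nH; exists k.
have cm : {for z, continuous (fun t : R => Num.max t 0)}.
  apply/continuous_atP => d d0; exists d => // y yz.
  by case: (leP y 0); case: (leP z 0); move: yz; rewrite !ltr_norml; lra.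
have := @continuous1_chain R (picard_iter a k) (fun t => Num.max t 0) z (@iter_continuous a k _) cm.
move=> /continuous_atP/(_ (e / 3)) [|d d0 dH]; first by lra.
exists (Num.min d 1); first by rewrite lt_min d0 ltr01.
move=> y; rewrite lt_min => /andP[yd y1].
have plE x : picard_limit a x = picard_limit a (Num.max x 0).
  have E : Num.max (Num.max x 0) 0 = Num.max x 0 by apply/max_idPl; rewrite le_max lexx orbT.
  by rewrite /picard_limit E.
rewrite (plE y) (plE z).
have zp : 0 <= Num.max z 0 by rewrite le_max lexx orbT.
have yp : 0 <= Num.max y 0 by rewrite le_max lexx orbT.
have zB : weight (Num.max z 0) <= weight (`|z| + 1).
  apply: weight_mono; rewrite ge_max; apply/andP; split; last by rewrite addr_ge0.
  by apply: (le_trans (ler_norm _)); rewrite lerDl.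
have yB : weight (Num.max y 0) <= weight (`|z| + 1).
  apply: weight_mono; rewrite ge_max; apply/andP; split; last by rewrite addr_ge0.
  by have := ler_norm z; move: y1; rewrite ltr_norml; lra.
have hz := picard_limitP a k zp; have hy := picard_limitP a k yp.
have p0 : (0 : R) <= 2^-1 ^+ k by rewrite exprn_ge0// invr_ge0.
have g0 := gap_ge0 a.
have hz2 : 2 * (gap a * weight (Num.max z 0)) * 2^-1 ^+ k <= B * 2^-1 ^+ k.
  by rewrite ler_wpM2r// ler_wpM2l// ler_wpM2l.
have hy2 : 2 * (gap a * weight (Num.max y 0)) * 2^-1 ^+ k <= B * 2^-1 ^+ k.
  by rewrite ler_wpM2r// ler_wpM2l// ler_wpM2l.
have := dH y yd; move: hz hy; rewrite ltr_norml !ler_norml ltr_norml; lra.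
Qed.

(** One more Picard step applied to the limit: the result is differentiable on the whole line by
    construction and coincides with the limit for z >= 0. *)
Definition volt (a : R) : R -> R := picard_map a (picard_limit a).
Definition dvolt (a z : R) : R := - kappa * flux (fun t => f (picard_limit a t)) z.

Lemma volt_limit a z : 0 <= z -> volt a z = picard_limit a z.
Proof.
move=> z0; apply/eqP; rewrite -subr_eq0 -normr_le0; apply/eqP/eqP.
have g0 := gap_ge0 a.
apply: (@geometric_small R _ (2 * (gap a * weight z))) => k.
have p0 : (0 : R) <= 2^-1 ^+ k by rewrite exprn_ge0// invr_ge0.
have D0 : 0 <= 2 * gap a * 2^-1 ^+ k by rewrite mulr_ge0// mulr_ge0.
have H s : 0 <= s -> `|picard_limit a s - picard_iter a k s| <= 2 * gap a * 2^-1 ^+ k * weight s.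
  move=> s0; apply: (le_trans (picard_limitP a k s0)).
  by rewrite le_eqVlt; apply/orP; left; apply/eqP; ring.
have := @picard_contract a a _ _ _ z (@limit_continuous a) (@iter_continuous a k) D0 z0 H.
rewrite subrr normr0 add0r -/(volt a z) -[picard_map a _ z]/(picard_iter a k.+1 z) => h1.
have := picard_limitP a k.+1 z0; rewrite exprS => h2.
rewrite -(subrKA (picard_iter a k.+1 z)) (le_trans (ler_normD _ _))//.
rewrite (distrC (picard_iter _ _ _)).
have -> : 2 * (gap a * weight z) * 2^-1 ^+ k = 2 * gap a * 2^-1 ^+ k / 2 * weight z
   + 2 * (gap a * weight z) * (2^-1 * 2^-1 ^+ k) by lra.
exact: lerD.
Qed.

Lemma volt0 a : volt a 0 = a.
Proof. exact: (@picard0 a _ (@limit_continuous a)). Qed.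

Lemma is_derive_volt (a z : R) : is_derive z (1 : R) (volt a) (dvolt a z).
Proof. exact: (@is_derive_picard a _ z (@limit_continuous a)). Qed.

Lemma dvolt_continuous (a : R) : continuous (dvolt a).
Proof.
move=> z; have h : {for z, continuous (flux (fun t => f (picard_limit a t)))}.
  exact: (@flux_continuous _ (@fw_continuous _ (@limit_continuous a))).
exact: (@continuous1M R (fun=> - kappa) _ z (is_derive_cvg (is_derive1_cst _ _)) h).
Qed.

Lemma is_derive_volt_flux (a z : R) : 0 < z ->
  is_derive z (1 : R) (fun t => (t / (1 + t)) ^+ m.+1 * dvolt a t)
   (- kappa * z ^+ m * (1 + z) ^- m.+3 * f (volt a z)).
Proof.
move=> z0.
have cl := @pow_mul_continuous R m _ (@damp_continuous _ (@fw_continuous _ (@limit_continuous a))).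
apply: (@is_derive1_near _ (fun t => - kappa * antider (fun s => s ^+ m * damp (fun s => f (picard_limit a s)) s) t) _ _ _ z) => //.
  move=> y; rewrite ltr_norml => yz; have y0 : 0 < y by lra.
  have yF : (y <= 0) = false by apply/negbTE; rewrite -ltNge.
  rewrite /dvolt /flux /avg yF (gtr0_norm y0).
  set A := antider _ _.
  rewrite expr_div_n.
  have : y ^+ m.+1 != 0 by rewrite expf_neq0// gt_eqF.
  have : (1 + y) ^+ m.+1 != 0 by rewrite expf_neq0// gt_eqF//; lra.
  move: (y ^+ m.+1) ((1 + y) ^+ m.+1) => P Q P0 Q0.
  by field; rewrite P0 Q0.
apply: (is_derive_eq (is_derive1M (is_derive1_cst _ _) (is_derive_antider z cl))).
by rewrite mul0r add0r /damp (gtr0_norm z0) volt_limit ?(ltW z0)// !mulrA.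
Qed.

(** The bound 2 |a - b| weight reproduces itself under the Picard map: it becomes |a - b| + |a - b|
    weight, and weight >= 1. *)
Lemma volt_diff (a b z : R) : 0 <= z ->
  `|volt a z - volt b z| <= 2 * `|a - b| * weight z /\
  `|dvolt a z - dvolt b z| <= kappa * (L * (2 * `|a - b|) * weight z).
Proof.
have l0 := L0; have k0 := kappa0.
have ab0 : 0 <= 2 * `|a - b| by rewrite mulr_ge0.
have it k s : 0 <= s -> `|picard_iter a k s - picard_iter b k s| <= 2 * `|a - b| * weight s.
  elim: k s => [|k IH] s s0 /=.
    have := weight_ge1 s0; have := normr_ge0 (a - b); nra.
  have := @picard_contract a b _ _ _ s (@iter_continuous a k) (@iter_continuous b k) ab0 s0 IH.
  move=> /le_trans; apply.
  by have := weight_ge1 s0; have := normr_ge0 (a - b); nra.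
have lim s : 0 <= s -> `|picard_limit a s - picard_limit b s| <= 2 * `|a - b| * weight s.
  move=> s0; rewrite -subr_le0.
  apply: (@geometric_small R _ (2 * (gap a * weight s) + 2 * (gap b * weight s))) => k.
  have := it k s s0; have := picard_limitP a k s0; have := picard_limitP b k s0.
  move=> h1 h2 h3.
  move: h1 h2 h3; rewrite lerBlDl !ler_norml. lra.
move=> z0; split; first by rewrite !volt_limit//; exact: lim.
rewrite /dvolt -mulrBr normrM normrN (gtr0_norm k0) ler_pM2l//.
apply: flux_lip => //; try exact: limit_continuous.
by move=> s /andP[s0 _]; exact: lim.
Qed.

Lemma volt_const (c z : R) : f c = 0 -> 0 <= z -> volt c z = c.
Proof.
move=> fc z0; rewrite volt_limit//; apply/eqP; rewrite -subr_eq0 -normr_le0.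
have := picard_limitP c 0 z0.
by rewrite /gap fc normr0 !mul0r mulr0 mul0r.
Qed.

End SingularVolterra.

(** * Profiles in the variable x and their dependence on the starting value *)

Section Profiles.
Variable R : realType.

(* With m + 1 = 2n, kappa = lambda/4 and x = sin^2 of the distance to p_0, the flux
   x^(m+1) y(x) = x^(2n) (1-x)^2 w'(x) puts the radial equation in divergence form. *)
Record profile (f : R -> R) (kappa : R) (m : nat) (a : R) (w y : R -> R) : Prop := Profile {
  profile_init : w 0 = a;
  profile_derive : forall x : R, x < 1 -> is_derive x (1 : R) w (y x / (1 - x) ^+ 2);
  profile_slope_cont : forall x : R, x < 1 -> {for x, continuous y};
  profile_flux : forall x : R, 0 <= x < 1 ->
    is_derive x (1 : R) (fun t => t ^+ m.+1 * y t) (- (kappa * x ^+ m * (1 - x) * f (w x))) }.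

Lemma shooting_family (f : R -> R) (L kappa : R) (m : nat) : 0 < L -> 0 < kappa -> (0 < m)%N ->
  (forall u w, `|f u - f w| <= L * `|u - w|) ->
  exists w y : R -> R -> R, (forall a, profile f kappa m a (w a) (y a)) /\
    (forall X e, X < 1 -> 0 < e -> exists2 d, 0 < d & forall a b x, `|a - b| < d -> 0 <= x <= X ->
      `|w a x - w b x| < e /\ `|y a x - y b x| < e) /\
    forall c x, f c = 0 -> 0 <= x < 1 -> w c x = c.
Proof.
move=> L0 k0 m0 fL.
pose w a x := volt f L kappa m a (x / (1 - x)).
pose y a x := dvolt f L kappa m a (x / (1 - x)).
have Dz (x : R) : x < 1 -> is_derive x (1 : R) (fun t : R => t * (1 - t)^-1) ((1 - x) ^- 2).
  move=> x1; have n0 : 1 - x != 0 by rewrite gt_eqF// subr_gt0.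
  apply: (is_derive_eq (is_derive1M (is_derive1_id x) (is_derive1V (is_derive1B (is_derive1_cst 1 x) (is_derive1_id x)) n0))).
  by field.
have yc (a x : R) : x < 1 -> {for x, continuous (y a)}.
  move=> x1; exact: (@continuous1_chain R _ _ x (@dvolt_continuous R f L kappa m L0 k0 fL a (x / (1 - x))) (is_derive_cvg (Dz x x1))).
have wconst c x : f c = 0 -> 0 <= x < 1 -> w c x = c.
  by move=> fc /andP[x0 x1]; rewrite /w volt_const// divr_ge0// subr_ge0 ltW.
exists w, y; split=> [a|]; last split=> [X e X1 e0|//].
  split.
  - by rewrite /w mul0r volt0.
  - move=> x x1.
    exact: (@is_derive1_chain R (volt f L kappa m a) (fun t => t * (1 - t)^-1) x _ _
      (is_derive_volt m L0 k0 fL a (x / (1 - x))) (Dz x x1)).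
  - by move=> x x1; exact: yc.
  - move=> x /andP[]; rewrite le_eqVlt => /predU1P[<-|x0] x1.
      (* At x = 0 the claimed derivative is 0 because m > 0. Near 0, on both sides, the function is
         O(t^2), since y is bounded there and m + 1 >= 2. *)
      rewrite expr0n (gtn_eqF m0) mulr0 !mul0r oppr0.
      apply/is_derive1P => e e0.
      have /continuous_atP/(_ 1 ltr01)[d d0 dH] := yc a 0 ltr01.
      pose B := `|y a 0| + 1; have B0 : 0 < B by rewrite ltr_wpDl.
      exists (Num.min (Num.min d 1) (e / B)); first by rewrite !lt_min d0 ltr01 divr_gt0.
      move=> t; rewrite !lt_min subr0 => /andP[/andP[td t1] te].
      rewrite expr0n /= mul0r mul0r !subr0 normrM normrX.
      have yB : `|y a t| <= B.
        rewrite -(subrK (y a 0) (y a t)) (le_trans (ler_normD _ _))// addrC lerD2l ltW//.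
        by apply: dH; rewrite subr0.
      have h1 : `|t| ^+ m.+1 <= `|t| * `|t|.
        by rewrite exprS ler_wpM2l// -[leRHS]expr1 ler_wiXn2l// ltW.
      apply: (@le_trans _ _ (`|t| * `|t| * B)); first by apply: ler_pM => //; exact: exprn_ge0.
      rewrite -mulrA mulrC ler_wpM2r//; move: te; rewrite ltr_pdivlMr//; exact: ltW.
    have z0 : 0 < x / (1 - x) by rewrite divr_gt0// subr_gt0.
    have n0 : 1 - x != 0 by rewrite gt_eqF// subr_gt0.
    have h := @is_derive1_chain R (fun t => (t / (1 + t)) ^+ m.+1 * dvolt f L kappa m a t)
      (fun t => t * (1 - t)^-1) x _ _ (is_derive_volt_flux m L0 k0 fL a z0) (Dz x x1).
    have E (t : R) : t < 1 -> t / (1 - t) / (1 + t / (1 - t)) = t.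
      move=> t1; have tn : 1 - t != 0 by rewrite gt_eqF// subr_gt0.
      have -> : 1 + t / (1 - t) = (1 - t)^-1 by field.
      by rewrite invrK mulfVK.
    have hE : - kappa * (x / (1 - x)) ^+ m / (1 + x / (1 - x)) ^+ m.+3 *
        f (volt f L kappa m a (x / (1 - x))) / (1 - x) ^+ 2 = - (kappa * x ^+ m * (1 - x) * f (w a x)).
      rewrite -/(w a x).
      have -> : 1 + x / (1 - x) = (1 - x)^-1 by field.
      rewrite expr_div_n exprVn invrK.
      have -> : (1 - x) ^+ m.+3 = (1 - x) ^+ m * (1 - x) ^+ 3 by rewrite -exprD addn3.
      have : (1 - x) ^+ m != 0 by rewrite expf_neq0.
      move: ((1 - x) ^+ m) (x ^+ m) (f _) => P Z F P0.
      by field; rewrite n0.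
    have x1' : 0 < 1 - x by rewrite subr_gt0.
    refine (is_derive1_near x1' _ (is_derive_eq h hE)).
    by move=> t; rewrite ltr_norml => tx /=; rewrite /y E//; lra.
(* The weight increases with z, so its value at the image of X controls the differences of w and y
   on all of [0, X]. *)
pose W := weight L kappa (X / (1 - X)).
have W0 : 0 < W by exact: expR_gt0.
pose C := Num.max (2 * W) (kappa * (L * 2 * W)).
have C0 : 0 < C by rewrite lt_max !mulr_gt0.
exists (e / C) => [|a b x]; first by rewrite divr_gt0.
rewrite ltr_pdivlMr// => ab /andP[x0 xX].
have z0 : 0 <= x / (1 - x) by rewrite divr_ge0// subr_ge0; lra.
have zW : weight L kappa (x / (1 - x)) <= W.
  rewrite /W /weight ler_expR ler_pM2l ?mulr_gt0//.
  have p1 : 0 < 1 - x by lra.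
  have p2 : 0 < 1 - X by lra.
  by rewrite (ler_pdivrMr _ _ p1) mulrAC (ler_pdivlMr _ _ p2); lra.
have [h1 h2] := volt_diff m L0 k0 fL a b z0.
have ab0 : 0 <= `|a - b| by [].
split.
  apply: le_lt_trans ab; apply: (le_trans h1).
  rewrite -mulrA mulrCA ler_wpM2l// (@le_trans _ _ (2 * W))// ?ler_pM2l//.
  by rewrite /C le_max lexx.
apply: le_lt_trans ab; apply: (le_trans h2).
rewrite [leLHS](_ : _ = `|a - b| * (kappa * (L * 2 * weight L kappa (x / (1 - x))))); last by ring.
rewrite ler_wpM2l// (@le_trans _ _ (kappa * (L * 2 * W)))//.
  by rewrite ler_pM2l// ler_pM2l// mulr_gt0.
by rewrite /C le_max lexx orbT.
Qed.

End Profiles.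

(** * Behaviour near the singular endpoint *)

Section ProfileQualitative.
Variable R : realType.
Implicit Types (w y f : R -> R) (a c s x X kappa L : R).

(** The product of D with exp (C x) is nondecreasing. *)
Lemma gronwall_backward (D dD : R -> R) (C a b : R) : a <= b ->
  (forall x : R, a <= x <= b -> is_derive x (1 : R) D (dD x)) ->
  (forall x : R, a <= x <= b -> 0 <= dD x + C * D x) -> D b = 0 -> D a <= 0.
Proof.
move=> ab DD HD Db.
have E x : a <= x <= b -> is_derive x (1 : R) (fun t => D t * expR (C * t)) ((dD x + C * D x) * expR (C * x)).
  move=> xab.
  apply: (is_derive_eq (is_derive1M (DD x xab) (is_derive1_chain (is_derive_expR _) (is_derive1M (is_derive1_cst C x) (is_derive1_id x))))).
  by ring.
have H := @nondecr_cc R _ _ a b ab (fun x xab => is_derive_cvg (E x xab))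
  (fun x xab => E x (ltac:(lra))).
have {H} := H (fun x xab => mulr_ge0 (HD x (ltac:(lra))) (expR_ge0 _)).
by rewrite Db mul0r pmulr_lle0// expR_gt0.
Qed.

(** With V = x^(m+1) y as second unknown, (w, V) solves a first-order system that is regular on
    compact subsets of (0, 1). *)
Lemma profile_deriveV f kappa m a w y x : profile f kappa m a w y -> 0 < x < 1 ->
  is_derive x (1 : R) w (x ^+ m.+1 * y x / (x ^+ m.+1 * (1 - x) ^+ 2)).
Proof.
move=> pr /andP[x0 x1]; apply: (is_derive_eq (profile_derive pr x1)).
have : x ^+ m.+1 != 0 by rewrite expf_neq0// gt_eqF.
have : 1 - x != 0 by rewrite gt_eqF// subr_gt0.
by move: (x ^+ m.+1) => P h1 h2; field; rewrite h1 h2.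
Qed.

Lemma profile_cont f kappa m a w y x : profile f kappa m a w y -> x < 1 ->
  {for x, continuous w}.
Proof. by move=> pr x1; exact: (is_derive_cvg (profile_derive pr x1)). Qed.

(** Backward uniqueness: Gronwall for (w - c)^2 + V^2 gives w = c on [d, x0] for every d > 0, and
    continuity at 0 gives a = c. Applied with c = 1 it says that zeros of w - 1 are simple. *)
Lemma profile_unique f kappa L m a w y c x0 : profile f kappa m a w y ->
  0 < kappa -> 0 < L ->
  (forall u v, `|f u - f v| <= L * `|u - v|) -> f c = 0 -> 0 < x0 < 1 ->
  w x0 = c -> y x0 = 0 -> a = c.
Proof.
move=> pr k0 L0 fL fc /andP[x00 x01] wx yx.
have key d : 0 < d <= x0 -> w d = c.
  move=> /andP[d0 dx].
  pose p := d ^+ m.+1 * (1 - x0) ^+ 2.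
  have p0 : 0 < p by rewrite mulr_gt0 ?exprn_gt0// subr_gt0.
  pose V t := t ^+ m.+1 * y t.
  pose D t := (w t - c) ^+ 2 + V t ^+ 2.
  (* On [d, x0] the coefficient 1 / (x^(m+1) (1 - x)^2) of V is at most 1 / p, and |f w| <= L |w -
     c| because f c = 0. *)
  pose C := p^-1 + kappa * L.
  have DD x : d <= x <= x0 -> is_derive x (1 : R) D
     (2 * (w x - c) * (V x / (x ^+ m.+1 * (1 - x) ^+ 2)) - 2 * V x * (kappa * x ^+ m * (1 - x) * f (w x))).
    move=> xd.
    have hw := @profile_deriveV _ _ _ _ _ _ x pr (ltac:(lra)).
    have hV := @profile_flux _ _ _ _ _ _ _ pr x (ltac:(lra)).
    apply: (is_derive_eq (is_derive1D (is_derive1X 2 (is_derive1B hw (is_derive1_cst c x))) (is_derive1X 2 hV))).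
    by rewrite !expr1 -/(V x); ring.
  suff : D d <= 0.
    rewrite /D => h; have := sqr_ge0 (w d - c); have := sqr_ge0 (V d) => h1 h2.
    have : (w d - c) ^+ 2 == 0 by apply/eqP; lra.
    by rewrite sqrf_eq0 subr_eq0 => /eqP.
  apply: (@gronwall_backward D _ C d x0 dx DD); last first.
    by rewrite /D /V wx yx subrr mulr0 expr0n /= addr0.
  move=> x /andP[dx' xx0].
  have q0 : 0 < x ^+ m.+1 * (1 - x) ^+ 2 by rewrite mulr_gt0// exprn_gt0//; lra.
  have pq : p <= x ^+ m.+1 * (1 - x) ^+ 2.
    by apply: ler_pM; [rewrite exprn_ge0//; lra|exact: sqr_ge0|
      apply: lerXn2r; rewrite ?nnegrE; lra|apply: lerXn2r; rewrite ?nnegrE; lra].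
  have iq : (x ^+ m.+1 * (1 - x) ^+ 2)^-1 <= p^-1 by rewrite lef_pV2.
  have iq0 : 0 <= (x ^+ m.+1 * (1 - x) ^+ 2)^-1 by rewrite invr_ge0 ltW.
  have ff : `|f (w x)| <= L * `|w x - c| by have := fL (w x) c; rewrite fc subr0.
  have r1 : 0 <= x ^+ m * (1 - x) <= 1.
    have h1 : 0 <= x ^+ m by rewrite exprn_ge0//; lra.
    have h2 : x ^+ m <= 1 by rewrite exprn_ile1//; lra.
    by nra.
  set v := w x - c in ff *; set U := V x; set I := (_ * _)^-1 in iq iq0 *.
  have t1 : `|2 * v * (U * I)| <= p^-1 * (v ^+ 2 + U ^+ 2).
    rewrite (_ : 2 * v * (U * I) = I * (2 * v * U)); last by ring.
    rewrite normrM ger0_norm// ler_pM// ler_norml.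
    by have := sqr_ge0 (v - U); have := sqr_ge0 (v + U); rewrite !expr2; lra.
  have t2 : `|2 * U * (kappa * x ^+ m * (1 - x) * f (w x))| <= kappa * L * (v ^+ 2 + U ^+ 2).
    rewrite (_ : 2 * U * _ = kappa * (x ^+ m * (1 - x)) * (2 * (U * f (w x)))); last by ring.
    have kr : 0 <= kappa * (x ^+ m * (1 - x)) by apply: mulr_ge0; [exact: ltW|case/andP: r1].
    rewrite normrM (ger0_norm kr) -[leLHS]mulrA -[leRHS]mulrA ler_pM2l//.
    apply: (@le_trans _ _ (1 * `|2 * (U * f (w x))|)).
      by rewrite ler_wpM2r//; lra.
    rewrite mul1r (normrM 2) (normrM U) normr_nat.
    have h : `|U| * `|f (w x)| <= `|U| * (L * `|v|) by rewrite ler_wpM2l.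
    have : 0 <= L * (`|U| - `|v|) ^+ 2 by rewrite mulr_ge0 ?sqr_ge0// ltW.
    by rewrite -(real_normK (num_real v)) -(real_normK (num_real U)) !expr2; lra.
  rewrite /D -/v -/U /C; move: t1 t2; rewrite !ler_norml; lra.
apply/eqP; rewrite -subr_eq0 -normr_le0 leNgt; apply/negP => ac.
have /continuous_atP/(_ _ ac)[d d0 dH] := profile_cont pr ltr01.
pose t := Num.min (d / 2) x0.
have t0 : 0 < t by rewrite lt_min x00 andbT; lra.
have td : t <= d / 2 by rewrite ge_min lexx.
have tx : t <= x0 by rewrite ge_min lexx orbT.
have : `|w t - w 0| < `|a - c| by apply: dH; rewrite subr0 gtr0_norm//; lra.
by rewrite (profile_init pr) (key t) ?t0// distrC ltxx.
Qed.

(** With the factor 2, the flux lost beyond X on account of the value w X - 1 is less than half of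
    the flux at X. *)
Definition trap_rate kappa L : R := 2 * kappa * L.

(** The bound X >= 1/2 gives x^(-m-1) <= 2^(m+1) beyond X; the last condition limits to one half of
    the maximal flux the loss caused by the growth of w - 1 beyond X. *)
Definition near_end kappa L m X := [&& 2^-1 <= X, X < 1 & kappa * L * 2 ^+ m.+1 * (1 - X) <= 2^-1].

(* The flux cannot change sign: near x = 1 the mass of the weight x^m (1-x) is too small to cancel it. *)
Lemma trapped_sign f kappa L m a w y s X : profile f kappa m a w y ->
  0 < kappa -> 0 < L -> (forall u v, `|f u - f v| <= L * `|u - v|) -> f 1 = 0 ->
  `|s| = 1 -> near_end kappa L m X -> 0 <= s * (w X - 1) ->
  trap_rate kappa L * (1 - X) ^+ 2 * (s * (w X - 1)) < s * (X ^+ m.+1 * y X) ->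
  forall x, X < x < 1 -> 0 < s * (w x - 1) /\ 0 < s * (x ^+ m.+1 * y x).
Proof.
move=> pr k0 L0 fL f1 s1 /and3P[X2 X1 XL] uX UX.
pose u t := s * (w t - 1); pose U t := s * (t ^+ m.+1 * y t).
have uD x : X <= x < 1 -> is_derive x (1 : R) u (U x / (x ^+ m.+1 * (1 - x) ^+ 2)).
  move=> xX; have hw := @profile_deriveV _ _ _ _ _ _ x pr (ltac:(lra)).
  apply: (is_derive_eq (is_derive1M (is_derive1_cst s x) (is_derive1B hw (is_derive1_cst 1 x)))).
  by rewrite /U; ring.
have UD x : X <= x < 1 -> is_derive x (1 : R) U (- (kappa * x ^+ m * (1 - x) * (s * f (w x)))).
  move=> xX; have hV := @profile_flux _ _ _ _ _ _ _ pr x (ltac:(lra)).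
  apply: (is_derive_eq (is_derive1M (is_derive1_cst s x) hV)).
  by ring.
have q0 x : X <= x < 1 -> 0 < x ^+ m.+1 * (1 - x) ^+ 2.
  by move=> xX; rewrite mulr_gt0// exprn_gt0//; lra.
have UX0 : 0 < U X.
  by apply: (le_lt_trans _ UX); rewrite mulr_ge0// mulr_ge0 ?sqr_ge0// /trap_rate !mulr_ge0// ltW.
have mono b : X <= b < 1 -> (forall x, X <= x < b -> 0 < U x) -> forall x, X <= x <= b -> u X <= u x.
  move=> bb Upos x xX; apply: (@nondecr_cc R u (fun x => U x / (x ^+ m.+1 * (1 - x) ^+ 2))); first by lra_from xX.
  - by move=> z zz; apply: (is_derive_cvg (uD z _)); lra_from zz xX bb.
  - by move=> z zz; apply: uD; lra_from zz xX bb.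
  - by move=> z zz; apply: divr_ge0; apply: ltW; [apply: Upos|apply: q0]; lra_from zz xX bb.
have Upos x : X <= x < 1 -> 0 < U x.
  move=> /andP[Xx x1]; rewrite ltNge; apply/negP => Ux.
  have Uc z : X <= z <= x -> {for z, continuous U}.
    by move=> zz; apply: (is_derive_cvg (UD z _)); lra.
  have [c [/andP[Xc cx] Uc0 Upos]] := first_zero Xx Uc UX0 Ux.
  have Uc' z : X <= z <= c -> {for z, continuous U} by move=> zz; apply: Uc; lra.
  (* Between x2 and c the flux would fall from its maximum M to 0; the bounds below cap this fall
     strictly below M. *)
  have [x2 x2c maxU] := max_cc (ltW Xc) Uc'.
  set M := U x2 in maxU.
  have MX : U X <= M by apply: maxU; lra.
  have M0 : 0 < M by exact: lt_le_trans MX.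
  have x2c' : x2 < c.
    rewrite lt_neqAle; apply/andP; split; last by lra.
    by apply/eqP => E; move: MX; rewrite /M E Uc0 => MX; lra_from MX UX0.
  have u_mono := mono c (ltac:(lra_from Xc cx x1)) Upos.
  pose C : R := 2 ^+ m.+1.
  have C0 : 0 < C by rewrite exprn_gt0.
  have iC z : X <= z -> (z ^+ m.+1)^-1 <= C.
    move=> Xz; have z0 : 0 < z by lra_from Xz X2.
    rewrite -[leRHS]invrK lef_pV2 ?posrE ?invr_gt0 ?exprn_gt0//.
    by rewrite /C -exprVn; apply: lerXn2r; rewrite ?nnegrE; lra_from Xz X2.
  (* Since U <= M, the slope of u is at most C M (1 - t)^-2. The resulting growth C M / (1 - z) is
     cancelled by the factor 1 - z in the flux equation. *)
  have ub z : X <= z <= c -> u z <= u X + C * M * (1 - z)^-1.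
    move=> zX.
    have GD t : X <= t <= z -> is_derive t (1 : R) (fun t : R => C * M * (1 - t)^-1 - u t)
       (C * M * (1 - t) ^- 2 - U t / (t ^+ m.+1 * (1 - t) ^+ 2)).
      move=> tX; have n0 : 1 - t != 0 by rewrite gt_eqF// subr_gt0; lra_from tX zX cx x1.
      have hu := uD t (ltac:(lra_from tX zX cx x1)).
      apply: (is_derive_eq (is_derive1B (is_derive1M (is_derive1_cst (C * M) t) (is_derive1V (is_derive1B (is_derive1_cst 1 t) (is_derive1_id t)) n0)) hu)).
      by rewrite mul0r add0r sub0r opprK mul1r.
    have GD0 t : X < t < z -> 0 <= C * M * (1 - t) ^- 2 - U t / (t ^+ m.+1 * (1 - t) ^+ 2).
      move=> tX; rewrite (invfM (t ^+ m.+1)) (mulrA (U t)) -mulrBl mulr_ge0//; last by rewrite invr_ge0 exprn_ge0//; lra_from tX zX cx x1 X2.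
      have Ut : U t <= M by apply: maxU; lra_from tX zX.
      have Ut0 : 0 < U t by apply: Upos; lra_from tX zX.
      have := iC t (ltac:(lra_from tX)) => h; rewrite subr_ge0 mulrC ler_pM//; try exact: ltW.
      by rewrite invr_ge0 exprn_ge0//; lra_from tX zX cx x1 X2.
    have := @nondecr_cc R _ _ X z (ltac:(lra_from zX)) (fun t tX => is_derive_cvg (GD t tX))
      (fun t tX => GD t (ltac:(lra_from tX))) GD0.
    have : 0 <= C * M * (1 - X)^-1.
      apply: mulr_ge0; first exact: ltW (mulr_gt0 C0 M0).
      by rewrite invr_ge0 subr_ge0 ltW.
    by rewrite /= => h1 h2; lra_from h1 h2.
  have [z zx Ez] := @MVT_cc R U _ x2 c x2c' (fun z zx => Uc' z (ltac:(lra_from zx x2c)))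
    (fun z zx => UD z (ltac:(lra_from zx x2c cx x1))).
  have Xzc : X <= z <= c by lra_from zx x2c x2c'.
  have uz := ub z Xzc; have uz0 := u_mono z Xzc.
  have z01 : 0 < 1 - z by lra_from Xzc cx x1.
  have sf : s * f (w z) <= L * u z.
    apply: (le_trans (ler_norm _)); rewrite normrM s1 mul1r.
    have := fL (w z) 1; rewrite f1 subr0 => /le_trans; apply.
    have <- : `|w z - 1| = u z by rewrite -[RHS](ger0_norm (le_trans uX uz0)) normrM s1 mul1r.
    by rewrite ler_pM2l.
  have zm : 0 <= z ^+ m <= 1.
    have [z0 z1] : 0 <= z /\ z <= 1 by lra_from Xzc z01 X2.
    by rewrite exprn_ge0//= exprn_ile1.
  have h1 : kappa * z ^+ m * (1 - z) * (s * f (w z)) <= kappa * L * ((1 - X) * u X + C * M).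
    apply: (@le_trans _ _ (kappa * z ^+ m * (1 - z) * (L * u z))).
      apply: ler_wpM2l => //; apply: mulr_ge0; last exact: ltW.
      by apply: mulr_ge0; [exact: ltW|case/andP: zm].
    rewrite [leLHS](_ : _ = kappa * L * (z ^+ m * ((1 - z) * u z))); last by ring.
    rewrite ler_pM2l ?mulr_gt0//.
    have uz1 : (1 - z) * u z <= (1 - z) * u X + C * M.
      have := uz; rewrite -(ler_pM2l z01) mulrDr (mulrC (1 - z) (C * M / _)) mulfVK//.
      by rewrite gt_eqF.
    have a1 : 0 <= (1 - z) * u z by apply: mulr_ge0; [exact: ltW|exact: (le_trans uX uz0)].
    have a2 : (1 - z) * u X <= (1 - X) * u X by rewrite ler_wpM2r//; lra_from Xzc.
    have [zm0 zm1] := andP zm.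
    apply: (@le_trans _ _ (1 * ((1 - z) * u z))); first exact: ler_wpM2r.
    by rewrite mul1r (le_trans uz1)// lerD2r.
  have h2 : kappa * L * ((1 - X) * u X + C * M) * (c - x2) < M.
    have pos : 0 <= kappa * L * ((1 - X) * u X + C * M).
      apply: mulr_ge0; first exact: ltW (mulr_gt0 k0 L0).
      apply: addr_ge0; last exact: ltW (mulr_gt0 C0 M0).
      by apply: mulr_ge0 => //; rewrite subr_ge0 ltW.
    apply: (@le_lt_trans _ _ (kappa * L * ((1 - X) * u X + C * M) * (1 - X))).
      by rewrite ler_wpM2l//; lra_from x2c cx x1.
    have e1 : kappa * L * C * (1 - X) * M <= 2^-1 * M by exact: ler_wpM2r (ltW M0) _ _ XL.
    move: UX; rewrite /trap_rate -/(u X) -/(U X) expr2 => UX1; lra_from UX1 e1 MX.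
  move: Ez; rewrite Uc0 -/M => Ez.
  have : kappa * z ^+ m * (1 - z) * (s * f (w z)) * (c - x2) <= kappa * L * ((1 - X) * u X + C * M) * (c - x2).
    by rewrite ler_wpM2r// subr_ge0 ltW.
  by move=> h3; lra_from Ez h2 h3.
move=> x xX; split; last by apply: Upos; lra_from xX.
have [z zx Ez] := @MVT_cc R u _ X x (ltac:(lra_from xX)) (fun z zx => is_derive_cvg (uD z (ltac:(lra_from zx xX))))
    (fun z zx => uD z (ltac:(lra_from zx xX))).
have : 0 < u x - u X.
  rewrite Ez mulr_gt0//; last by lra_from xX.
  by rewrite divr_gt0//; [apply: Upos|apply: q0]; lra_from zx xX.
by rewrite /u in uX * => h; lra_from uX h.
Qed.

End ProfileQualitative.

(** * Oscillation about the constant solution *)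

Section Alternation.
Variable R : realType.

Lemma pos_below3 (a b c : R) : 0 < a -> 0 < b -> 0 < c ->
  exists h, [/\ 0 < h, h <= a, h <= b & h <= c].
Proof.
move=> a0 b0 c0; exists (Num.min a (Num.min b c)).
by rewrite !lt_min a0 b0 c0 !ge_min !lexx !orbT.
Qed.

Implicit Types (w y : R -> R -> R) (a b X kappa L : R).

(** The j sign changes of v - 1 are recorded by j + 1 sample points instead of zeros, which makes
    the condition open in v. The first sign is negative because profiles start at a < 1. *)
Definition alternates (v : R -> R) (j : nat) : Prop := exists t : nat -> R,
  [/\ 0 <= t 0%N, t j < 1, forall i, (i < j)%N -> t i < t i.+1 &
      forall i, (i <= j)%N -> 0 < (-1) ^+ i.+1 * (v (t i) - 1)].

Lemma finite_lower_bound (g : nat -> R) j : (forall i, (i <= j)%N -> 0 < g i) ->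
  exists2 e, 0 < e & forall i, (i <= j)%N -> e <= g i.
Proof.
elim: j => [|j IH] H.
  by exists (g 0%N) => [|i]; [exact: H|rewrite leqn0 => /eqP ->].
have [e e0 eH] := IH (fun i ij => H i (leqW ij)).
exists (Num.min e (g j.+1)) => [|i]; first by rewrite lt_min e0 H.
rewrite leq_eqVlt => /predU1P[->|ij]; first by rewrite ge_min lexx orbT.
by rewrite ge_min eH.
Qed.

Lemma increasing_le (t : nat -> R) j : (forall i, (i < j)%N -> t i < t i.+1) ->
  forall i k, (i <= k)%N -> (k <= j)%N -> t i <= t k.
Proof.
move=> H i; elim=> [|k IH]; first by rewrite leqn0 => /eqP ->.
rewrite leq_eqVlt => /predU1P[->//|ik] kj.
by apply: (le_trans (IH ik (ltnW kj))); apply: ltW; exact: H.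
Qed.

Lemma alternatesS v j : alternates v j.+1 -> alternates v j.
Proof.
move=> [t [t0 tj ti ts]]; exists t; split => //.
- by apply: lt_trans tj; exact: ti.
- by move=> i ij; apply: ti; exact: leqW.
- by move=> i ij; apply: ts; exact: leqW.
Qed.

Lemma alternates_le v i j : (i <= j)%N -> alternates v j -> alternates v i.
Proof.
move=> /subnK <-; elim: (j - i)%N => [//|k IH]; rewrite addSn => /alternatesS; exact: IH.
Qed.

Lemma signed_zero (v : R -> R) (i : nat) (x1 x2 : R) : x1 < x2 ->
  (forall x, x1 <= x <= x2 -> {for x, continuous v}) ->
  0 < (-1) ^+ i.+1 * (v x1 - 1) -> 0 < (-1) ^+ i.+2 * (v x2 - 1) ->
  exists2 x, x1 < x < x2 & v x = 1.
Proof.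
move=> x12 cv; rewrite (exprS _ i.+1) mulN1r => s1 s2.
have sg : (-1) ^+ i.+1 = 1 :> R \/ (-1) ^+ i.+1 = -1 :> R.
  by rewrite -signr_odd; case: (odd _); rewrite ?expr1 ?expr0; [right|left].
have [x xx vx] : exists2 x, x1 <= x <= x2 & v x = 1.
  apply: (IVT_cc (ltW x12) cv); apply/orP.
  by case: sg => E; rewrite E in s1 s2; [right|left]; lra.
exists x => //; rewrite !lt_neqAle; case/andP: xx => -> ->; rewrite !andbT.
by apply/andP; split; apply/eqP => E; move: s1 s2; [rewrite E vx|rewrite -E vx]; rewrite subrr !mulr0 ltxx.
Qed.

Lemma alternates_zeros (v : R -> R) j : (forall x, x < 1 -> {for x, continuous v}) ->
  alternates v j -> exists z : nat -> R,
  (forall i, (i < j)%N -> 0 < z i < 1 /\ v (z i) = 1) /\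
  (forall i, (i.+1 < j)%N -> z i < z i.+1).
Proof.
move=> cv [t [t0 tj ti ts]]; have tle := increasing_le ti.
have /choice[z Hz] : forall i, exists x, (i < j)%N -> t i < x < t i.+1 /\ v x = 1.
  move=> i; case: (ltnP i j) => ij; last by exists 0.
  have [|x xt vx] := signed_zero (ti i ij) _ (ts i (ltnW ij)) (ts _ ij); last by exists x.
  move=> x /andP[_ xt]; apply: cv; apply: (le_lt_trans xt); apply: le_lt_trans tj.
  exact: tle.
exists z; split => [i ij|i ij].
  have [/andP[h1 h2] vz] := Hz i ij; split => //.
  have := tle 0%N i (leq0n _) (ltnW ij); have := tle i.+1 j ij (leqnn _); lra.
have [/andP[h1 h2] _] := Hz i (ltnW ij); have [/andP[h3 h4] _] := Hz _ ij.
by apply: lt_trans h3.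
Qed.

Definition uniform_dependence w := forall X e, X < 1 -> 0 < e ->
  exists2 d, 0 < d & forall a b x, `|a - b| < d -> 0 <= x <= X -> `|w a x - w b x| < e.

Lemma alternates_open w a j : uniform_dependence w -> alternates (w a) j ->
  exists2 d, 0 < d & forall b, `|a - b| < d -> alternates (w b) j.
Proof.
move=> dep [t [t0 tj ti ts]]; have tle := increasing_le ti.
have [e e0 eH] := finite_lower_bound ts.
have [d d0 dH] := dep (t j) e tj e0.
exists d => // b ab; exists t; split => // i ij.
have := dH a b (t i) ab; have := tle 0%N i (leq0n _) ij; have := tle i j ij (leqnn _).
move=> h1 h2 /(_ _)h3; have {}h3 : `|w a (t i) - w b (t i)| < e by apply: h3; lra.
have := eH i ij; have : `|(-1) ^+ i.+1 * (w a (t i) - w b (t i))| < e.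
  by rewrite normrM normrX normrN1 expr1n mul1r.
by rewrite ltr_norml; lra.
Qed.

(* Zeros of w_a - 1 are simple, so nearby profiles have at most one zero close to each of them. *)
Lemma zeros_upper_semicontinuous f kappa L m w y a X :
  (forall a, profile f kappa m a (w a) (y a)) -> uniform_dependence w -> uniform_dependence y ->
  0 < kappa -> 0 < L -> (forall u v, `|f u - f v| <= L * `|u - v|) -> f 1 = 0 ->
  a < 1 -> 0 <= X -> X < 1 ->
  exists2 d, 0 < d & forall b, `|a - b| < d -> forall j (z : nat -> R),
    (forall i, (i < j)%N -> 0 <= z i <= X /\ w b (z i) = 1) ->
    (forall i, (i.+1 < j)%N -> z i < z i.+1) -> alternates (w a) j.
Proof.
move=> pr depw depy k0 L0 fL f1 a1 X0 X1.
have [X' XX' X'1] : exists2 X', X < X' & X' < 1 by exists ((X + 1) / 2); lra.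
have wc c x : x < 1 -> {for x, continuous (w c)} by exact: profile_cont.
have yc c x : x < 1 -> {for x, continuous (y c)} by move=> x1; exact: (profile_slope_cont (pr c) x1).
(* By [profile_unique], and at 0 by a < 1, the functions w_a - 1 and y_a have no common zero on
   [0, X'], so N has a positive minimum there. *)
pose N x := (w a x - 1) * (w a x - 1) + y a x * y a x.
have X'0 : 0 <= X' by lra.
have [x0 x0X Nmin] : exists2 c, 0 <= c <= X' & forall x, 0 <= x <= X' -> N c <= N x.
  apply: min_cc => // x xX; have x1 : x < 1 by lra.
  have c1 := continuous1B (wc a x x1) (is_derive_cvg (is_derive1_cst 1 x)).
  exact: (continuous1D (continuous1M c1 c1) (continuous1M (yc a x x1) (yc a x x1))).
have N0 : 0 < N x0.
  rewrite lt_neqAle addr_ge0 -?expr2 ?sqr_ge0// andbT eq_sym; apply/eqP => E.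
  have w1 : w a x0 = 1.
    have h : (w a x0 - 1) ^+ 2 == 0.
      by rewrite eq_le sqr_ge0 andbT; have := sqr_ge0 (y a x0); move: E; rewrite /N !expr2; lra.
    by move: h; rewrite sqrf_eq0 subr_eq0 => /eqP.
  have y1 : y a x0 = 0.
    have h : y a x0 ^+ 2 == 0.
      by rewrite eq_le sqr_ge0 andbT; have := sqr_ge0 (w a x0 - 1); move: E; rewrite /N !expr2; lra.
    by move: h; rewrite sqrf_eq0 => /eqP.
  have x00 : 0 < x0.
    rewrite lt_neqAle; apply/andP; split; last by lra.
    by apply/eqP => E0; move: w1; rewrite -E0 (profile_init (pr a)); lra.
  have := profile_unique (pr a) k0 L0 fL f1 (ltac:(lra) : 0 < x0 < 1) w1 y1; lra.
(* A quantitative form of simplicity: as mm <= 1, mm^2 <= N x0 / 2, so |w_a - 1| and |y_a| are never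
   both below mm. *)
have [mm [mm0 mm1' mm2 _]] := pos_below3 ltr01 (ltac:(lra) : 0 < N x0 / 2) ltr01.
have mm1 : mm * mm <= N x0 / 2 by nra.
have slope x : 0 <= x <= X' -> `|w a x - 1| < mm -> mm <= `|y a x|.
  move=> xX wm; rewrite leNgt; apply/negP => ym.
  have := Nmin x xX; rewrite [N x]/N.
  have h1 : (w a x - 1) * (w a x - 1) < mm * mm.
    by rewrite -expr2 -(real_normK (num_real _)) expr2 ltr_pM.
  have h2 : y a x * y a x < mm * mm.
    by rewrite -expr2 -(real_normK (num_real _)) expr2 ltr_pM.
  by lra.
clear mm1 mm2 Nmin x0X N0 N mm1' x0.
have mm4 : 0 < mm / 4 by lra.
have [h1 h10 h1H] := unif_continuous_cc mm4 (fun x (xX : 0 <= x <= X') => yc a x (ltac:(lra))).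
have a2 : 0 < (1 - a) / 2 by lra.
have /continuous_atP/(_ _ a2)[h2 h20 h2H] := wc a 0 ltr01.
have [h [h0 hh1 hh2 hh3]] := pos_below3 (ltac:(lra) : 0 < h1 / 2) (ltac:(lra) : 0 < h2 / 2) (ltac:(lra) : 0 < X' - X).
have start x : 0 <= x <= h -> w a x - 1 < - ((1 - a) / 2).
  move=> xh; have : `|w a x - w a 0| < (1 - a) / 2 by apply: h2H; rewrite subr0 ger0_norm; lra.
  by rewrite (profile_init (pr a)) ltr_norml; lra.
have mmh : 0 < mm * h / 8 by rewrite divr_gt0// mulr_gt0.
have [e [e0 e1 e2 e3]] := pos_below3 mm4 mmh a2.
have [d1 d10 d1H] := depw X' e X'1 e0; have [d2 d20 d2H] := depy X' e X'1 e0.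
exists (Num.min d1 d2); first by rewrite lt_min d10.
move=> b; rewrite lt_min => /andP[ab1 ab2] j z zz zi.
have XXX' x : 0 <= x <= X -> 0 <= x <= X' by move=> xX; lra_from xX XX'.
have XX1 x : 0 <= x <= X -> x < 1 by move=> xX; lra_from xX X1.
have near_zero x : 0 <= x <= X -> w b x = 1 -> [/\ h < x, `|w a x - 1| < e & mm <= `|y a x|].
  move=> xX wx; have wax : `|w a x - 1| < e by rewrite -wx; apply: d1H => //; exact: XXX'.
  have hx : h < x.
    rewrite ltNge; apply/negP => xh; have := start x; case/andP: (xX) => -> _ /(_ xh).
    by move: wax; rewrite ltr_norml => wax wa; lra_from wax wa e3.
  split => //; apply: slope; first exact: XXX'.
  by lra_from wax e1 mm0.
(* Two zeros of w_b at distance at most h would enclose a zero of y_b by Rolle; but |y_a| is at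
   least mm at one of them, varies by less than mm / 4, and is within e <= mm / 4 of |y_b|. *)
have spacing x x' : 0 <= x <= X -> 0 <= x' <= X -> x < x' -> w b x = 1 -> w b x' = 1 -> h < x' - x.
  move=> xX xX' xx wx wx'; rewrite ltNge; apply/negP => xh.
  have lt1 t : x <= t <= x' -> t < 1 by move=> tx; lra_from tx xX' X1.
  have [c cx Ec] := @MVT_cc R (w b) _ x x' xx (fun t tx => wc b t (lt1 t tx))
    (fun t tx => profile_derive (pr b) (lt1 t (ltac:(lra_from tx)))).
  have [_ _ ym] := near_zero x xX wx.
  have c1 : 1 - c != 0 by apply/eqP => E; lra_from E cx xX' X1.
  have yb0 : y b c = 0.
    move: Ec; rewrite wx wx' subrr => /esym/eqP; rewrite mulf_eq0 subr_eq0 (gt_eqF xx) orbF.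
    by rewrite mulf_eq0 invr_eq0 sqrf_eq0 (negbTE c1) orbF => /eqP.
  have cX : 0 <= c <= X' by lra_from cx xX xX' XX'.
  have := d2H a b c ab2 cX; rewrite yb0 subr0 => h3.
  have h4 : `|y a c - y a x| < mm / 4.
    apply: h1H; first exact: XXX'.
    by rewrite ltr_norml; lra_from cx xh hh1 h0.
  have h5 : `|y a x| <= `|y a c - y a x| + `|y a c|.
    by rewrite -{1}(subKr (y a c) (y a x)) (le_trans (ler_normB _ _))// addrC.
  by lra_from h3 h4 h5 ym e1 mm0.
have mh : 0 < mm * h by rewrite mulr_gt0.
(* Near a zero of w_b the slope of w_a keeps its sign and has size at least 3 mm / 4. A move by h /
   2 changes w_a by at least 3 mm h / 8, more than |w_a - 1| < e <= mm h / 8 at the zero. *)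
have both x (s : R) : s = 1 \/ s = -1 -> 0 <= x <= X -> w b x = 1 ->
    exists2 t, x - h / 2 <= t <= x + h / 2 & 0 < s * (w a t - 1).
  move=> ss xX wx; have [hx wax yax] := near_zero x xX wx.
  have ynear t : x - h <= t <= x + h -> `|y a t - y a x| < mm / 4.
    move=> tx; apply: h1H; first exact: XXX'.
    by rewrite ltr_norml; lra_from tx hh1 h0.
  have lt1 t : t <= x + h -> t < 1 by move=> tx; lra_from tx xX X'1 hh3.
  have dinv (t : R) : 0 <= t < 1 -> 1 <= (1 - t) ^- 2.
    move=> /andP[t0 t1]; have p0 : 0 < 1 - t by rewrite subr_gt0.
    have p2 : 0 < (1 - t) ^+ 2 by exact: exprn_gt0.
    have p3 : (1 - t) ^+ 2 <= 1 by apply: exprn_ile1; [exact: ltW|rewrite lerBlDr lerDl].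
    by rewrite -[leLHS](mulVf (lt0r_neq0 p2)) ler_piMr ?invr_ge0 ?(ltW p2).
  have step t1 t2 : x - h <= t1 -> t2 <= x + h -> t2 - t1 = h / 2 ->
      exists2 c, x - h <= c <= x + h & 0 <= c < 1 /\ w a t2 - w a t1 = y a c * (1 - c) ^- 2 * (h / 2).
    move=> t1x t2x t12; have t12' : t1 < t2 by lra_from t12 h0.
    have lt1' t : t1 <= t <= t2 -> t < 1 by move=> tt; apply: lt1; lra_from tt t2x.
    have [c cx Ec] := @MVT_cc R (w a) _ t1 t2 t12' (fun t tx => wc a t (lt1' t tx))
      (fun t tx => profile_derive (pr a) (lt1' t (ltac:(lra_from tx)))).
    exists c; first by lra_from cx t1x t2x.
    split; last by rewrite Ec t12.
    by rewrite (lt1' c) ?andbT; lra_from cx t1x hx.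
  have growth c : x - h <= c <= x + h -> 0 <= c < 1 -> 0 < y a x -> mm * h * 3 / 8 <= y a c * (1 - c) ^- 2 * (h / 2).
    move=> cx c01 y0; have := ynear c cx; move: yax; rewrite gtr0_norm// ltr_norml => yax' hy.
    have hd := dinv c c01.
    have g1 : mm * 3 / 4 <= y a c by lra_from yax' hy.
    have g2 : mm * 3 / 4 <= y a c * (1 - c) ^- 2 by clear -g1 hd mm0; nra.
    by clear -g2 h0; nra.
  have decay c : x - h <= c <= x + h -> 0 <= c < 1 -> y a x < 0 -> y a c * (1 - c) ^- 2 * (h / 2) <= - (mm * h * 3 / 8).
    move=> cx c01 y0; have := ynear c cx; move: yax; rewrite ltr0_norm// ltr_norml => yax' hy.
    have hd := dinv c c01.
    have g1 : y a c <= - (mm * 3 / 4) by lra_from yax' hy.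
    have g2 : y a c * (1 - c) ^- 2 <= - (mm * 3 / 4) by clear -g1 hd mm0; nra.
    by clear -g2 h0; nra.
  have [cr crx [cr01 Er]] := step x (x + h / 2) (ltac:(lra_from h0)) (ltac:(lra_from h0)) (ltac:(lra_from h0)).
  have [cl clx [cl01 El]] := step (x - h / 2) x (ltac:(lra_from h0)) (ltac:(lra_from h0)) (ltac:(lra_from h0)).
  have y0 : y a x != 0 by rewrite -normr_gt0; exact: lt_le_trans yax.
  move: wax; rewrite ltr_norml => wax.
  case/orP: (lt_total y0) => ys.
    have g1 := decay cr crx cr01 ys; have g2 := decay cl clx cl01 ys.
    by case: ss => ->; [exists (x - h / 2)|exists (x + h / 2)]; lra_from g1 g2 Er El wax e2 mh h0.
  have g1 := growth cr crx cr01 ys; have g2 := growth cl clx cl01 ys.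
  by case: ss => ->; [exists (x + h / 2)|exists (x - h / 2)]; lra_from g1 g2 Er El wax e2 mh h0.
have sg i : (-1) ^+ i = 1 :> R \/ (-1) ^+ i = -1 :> R.
  by rewrite -signr_odd; case: (odd _); rewrite ?expr1 ?expr0; [right|left].
(* One sample of w_a near each zero of w_b, with alternating signs, after the initial sample at 0.
   Zeros are more than h apart and samples lie within h / 2 of them, so the order is strict. *)
have /choice[t tP] : forall i, exists t, (i < j)%N ->
    z i - h / 2 <= t <= z i + h / 2 /\ 0 < (-1) ^+ i.+2 * (w a t - 1).
  move=> i; case: (ltnP i j) => ij; last by exists 0.
  have [zX wz] := zz i ij.
  by have [t tz wt] := both (z i) _ (sg i.+2) zX wz; exists t.
exists (fun i => if i is i'.+1 then t i' else 0); split => //.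
- case: j {zi} zz tP => [//|j] zz tP; have [tz _] := tP j (ltnSn _); have [zX _] := zz j (ltnSn _).
  by lra_from tz zX hh3 X'1 h0.
- move=> [|i] ij.
    have [tz _] := tP _ ij; have [zX wz] := zz _ ij.
    by have [hz _ _] := near_zero _ zX wz; lra_from tz hz h0.
  have [tz _] := tP _ (ltnW ij); have [tz' _] := tP _ ij.
  have [zX wz] := zz _ (ltnW ij); have [zX' wz'] := zz _ ij.
  by have sp := spacing _ _ zX zX' (zi _ ij) wz wz'; lra_from sp tz tz'.
- move=> [|i] ij; first by rewrite expr1 (profile_init (pr a)); lra_from a1.
  by have [_] := tP i ij.
Qed.

End Alternation.

(** * Jacobi polynomials and their zeros *)

Section JacobiPolynomials.
Variable R : realType.
Local Open Scope ring_scope.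

Lemma rolle_zeros (g dg : R -> R) (k : nat) (p : nat -> R) :
  (forall i, (i < k)%N -> p i < p i.+1) ->
  (forall x, is_derive x (1 : R) g (dg x)) -> (forall i, (i <= k)%N -> g (p i) = 0) ->
  exists z : nat -> R, forall i, (i < k)%N -> p i < z i < p i.+1 /\ dg (z i) = 0.
Proof.
move=> pi gD g0.
suff /choice[z Hz] : forall i, exists x, (i < k)%N -> p i < x < p i.+1 /\ dg x = 0.
  by exists z.
move=> i; case: (ltnP i k) => ik; last by exists 0.
have [c cp Ec] := @MVT_cc R g dg (p i) (p i.+1) (pi i ik) (fun x _ => is_derive_cvg (gD x)) (fun x _ => gD x).
exists c => _; split => //; move: Ec; rewrite !g0//; last exact: ltnW.
rewrite subrr => /esym/eqP; rewrite mulf_eq0 subr_eq0 (gt_eqF (pi i ik)) orbF.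
by move/eqP.
Qed.

(* Differentiating the (k, A, B) Jacobi equation gives the (k-1, A+1, B+1) one, and
   x^A (1-x)^B U vanishes at the zeros of U and at 0 and 1, so Rolle adds one zero. *)
Lemma jacobi_polynomial (k A B : nat) : exists (P : {poly R}) (z : nat -> R),
  [/\ P != 0, (size P <= k.+1)%N,
      'X * (1 - 'X) * P^`()^`() + (A.+1%:R - (A.+1 + B.+1)%:R * 'X) * P^`() +
        (k * (k + A + B + 1))%:R * P = 0,
      forall i, (i < k)%N -> 0 < z i < 1 /\ P.[z i] = 0 &
      forall i, (i.+1 < k)%N -> z i < z i.+1].
Proof.
elim: k A B => [|k IH] A B.
  exists 1, (fun=> 0); split => //; first exact: oner_neq0.
    by rewrite size_poly1.
  by rewrite -[1]/(1%:P) !derivC !mulr0 mul0n mul0r !addr0.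
have [U [z [U0 sU eqU zU zi]]] := IH A.+1 B.+1.
(* Raising operator: x^A (1-x)^B P is minus the derivative of x^(A+1) (1-x)^(B+1) U. *)
pose P : {poly R} := - ('X * (1 - 'X) * U^`() + (A.+1%:R - (A.+1 + B.+1)%:R * 'X) * U).
have natrN (n : nat) : (n%:R : {poly R})^`() = 0 by rewrite -polyC_natr derivC.
(* Lowering relation, by the equation of U; inserted in the definition of P it yields the equation
   of P, and also P != 0. *)
have dP : P^`() = (k.+1 * (k.+1 + A + B + 1))%:R * U.
  rewrite /P derivN derivD !derivM !derivB derivX -[1%R]/(1%:P) !derivC natrN derivM natrN derivX.
  have -> : (k.+1 * (k.+1 + A + B + 1))%:R * U = 
    (k.+1 * (k.+1 + A + B + 1))%:R * U - ('X * (1 - 'X) * U^`()^`() + (A.+2%:R - (A.+2 + B.+2)%:R * 'X) * U^`() + (k * (k + A.+1 + B.+1 + 1))%:R * U).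
    by rewrite eqU subr0.
  rewrite !natrM !natrD -!natr1.
  by rewrite -polyC1; ring.
have NZ : (k.+1 * (k.+1 + A + B + 1))%:R != 0 :> {poly R}.
  by rewrite -polyC_natr polyC_eq0 pnatr_eq0 muln_eq0 addn1.
(* The k zeros of U framed by 0 and 1: k + 2 zeros of g, hence k + 1 zeros of its derivative. *)
pose p i : R := if i is i'.+1 then (if (i' < k)%N then z i' else 1) else 0.
pose g (x : R) := x ^+ A.+1 * (1 - x) ^+ B.+1 * U.[x].
have gD (x : R) : is_derive x (1 : R) g (- (x ^+ A * (1 - x) ^+ B * P.[x])).
  apply: (is_derive_eq (is_derive1M (is_derive1M (is_derive1X A.+1 (is_derive1_id x))
    (is_derive1X B.+1 (is_derive1B (is_derive1_cst 1 x) (is_derive1_id x)))) (is_derive_poly U x))).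
  rewrite /P -!polyC_natr -polyC1 !(hornerN, hornerD, hornerM, hornerX, hornerC) /= !exprS !natrD -!natr1.
  by ring.
have [||z' Hz'] := @rolle_zeros g _ k.+1 p _ gD.
- move=> [|i] /= ik.
    case: k zU {IH sU eqU zi dP NZ gD} p ik => [|k] zU p ik /=; first exact: ltr01.
    by have [/andP[]] := zU 0%N isT.
  rewrite ltnS in ik; rewrite ik; case: ltnP => ik'; first exact: zi.
  by have [/andP[]] := zU i ik.
- move=> [|i] /= ik; first by rewrite /g exprS !mul0r.
  case: ltnP => ik'; first by rewrite /g (zU i ik').2 mulr0.
  by rewrite /g subrr expr0n /= mulr0 mul0r.
have p01 i : (i <= k.+1)%N -> 0 <= p i <= 1.
  case: i => [|i] ik /=; first by rewrite lexx ler01.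
  case: ltnP => ik'; last by rewrite ler01 lexx.
  by have [/andP[h1 h2] _] := zU i ik'; rewrite !ltW.
have z'01 i : (i < k.+1)%N -> 0 < z' i < 1.
  move=> ik; have [/andP[h1 h2] _] := Hz' i ik.
  have /andP[h3 _] := p01 i (ltnW ik); have /andP[_ h4] := p01 i.+1 ik.
  by rewrite (le_lt_trans h3 h1) (lt_le_trans h2 h4).
exists P, z'; split.
- apply/eqP => P0; move: dP; rewrite P0 derivC => /esym/eqP.
  by rewrite mulf_eq0 (negbTE NZ) (negbTE U0).
- rewrite /P size_polyN (leq_trans (size_polyD _ _))// geq_max; apply/andP; split.
    have s1 : (size ('X * (1 - 'X) : {poly R})%R <= 3)%N.
      apply: (leq_trans (size_polyMleq _ _)); rewrite size_polyX.
      have : (size (1 - 'X : {poly R})%R <= 2)%N.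
        by rewrite (leq_trans (size_polyD _ _))// size_polyN size_polyX size_poly1.
      by case: (size _) => [|[|[|]]].
    apply: (leq_trans (size_polyMleq _ _)).
    have s2 : (size U^`() <= k)%N by rewrite -ltnS (leq_trans (lt_size_deriv U0)).
    by have := leq_add s1 s2; case: (_ + _)%N => [|n].
  have s1 : (size (A.+1%:R - (A.+1 + B.+1)%:R * 'X : {poly R})%R <= 2)%N.
    rewrite (leq_trans (size_polyD _ _))// size_polyN geq_max -!polyC_natr.
    rewrite (leq_trans (size_polyC_leq1 _))//=.
    by rewrite mul_polyC (leq_trans (size_scale_leq _ _))// size_polyX.
  apply: (leq_trans (size_polyMleq _ _)).
  have := leq_add s1 sU; by case: (_ + _)%N => [|n] //=.
- rewrite dP derivM natrN mul0r add0r.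
  rewrite /P; ring.
- move=> i ik; split; first exact: z'01.
  have [_ /eqP] := Hz' i ik; rewrite oppr_eq0 !mulf_eq0.
  have /andP[h1 h2] := z'01 i ik.
  by rewrite !expf_eq0 (gt_eqF h1) subr_eq0 (gt_eqF h2) !andbF => /eqP.
- move=> i ik; have [/andP[_ h1] _] := Hz' i (ltnW ik); have [/andP[h2 _] _] := Hz' i.+1 ik.
  exact: lt_trans h2.
Qed.

End JacobiPolynomials.

(** * Sturm comparison with a Jacobi polynomial *)

Section SturmComparison.
Variable R : realType.

Lemma is_derive1_unique (f : R -> R) (x a b : R) :
  is_derive x 1 f a -> is_derive x (1 : R) f b -> a = b.
Proof.
move=> fa fb.
by rewrite -(@derive_val _ _ _ _ _ _ _ fa) -(@derive_val _ _ _ _ _ _ _ fb).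
Qed.

Lemma slope_at_right_zero (f : R -> R) (a b d : R) : a < b -> is_derive b (1 : R) f d ->
  f b = 0 -> (forall x, a < x < b -> 0 < f x) -> d <= 0.
Proof.
move=> ab /is_derive1P fd fb fx; rewrite leNgt; apply/negP => d0.
have d2 : 0 < d / 2 by lra.
have [r r0 rH] := fd _ d2.
pose h := Num.min (r / 2) ((b - a) / 2).
have h0 : 0 < h by rewrite lt_min; apply/andP; split; lra.
have hr : h <= r / 2 by rewrite ge_min lexx.
have hb : h <= (b - a) / 2 by rewrite ge_min lexx orbT.
have := rH (b - h) (ltac:(rewrite ltr_norml; lra)).
have := fx (b - h) (ltac:(lra)).
rewrite fb (_ : b - h - b = - h); last by ring.
rewrite normrN (gtr0_norm h0) subr0 ler_norml; nra.
Qed.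

Lemma slope_at_left_zero (f : R -> R) (a b d : R) : a < b -> is_derive a (1 : R) f d ->
  f a = 0 -> (forall x, a < x < b -> 0 < f x) -> 0 <= d.
Proof.
move=> ab fd fa fx.
have fd' : is_derive (- a) (1 : R) (fun t => f (- t)) (d * -1).
  have fd2 : is_derive (- - a) (1 : R) f d by rewrite opprK.
  exact: (is_derive1_chain fd2 (is_derive1N (is_derive1_id (- a)))).
have := @slope_at_right_zero (fun t => f (- t)) (- b) (- a) _ (ltac:(lra)) fd'.
by rewrite opprK => /(_ fa (fun x xb => fx (- x) (ltac:(lra)))); lra.
Qed.

(** The Wronskian [Wr] of P and w - 1 has derivative x^m (1-x) P (kappa f(w) - Lam (w - 1)), of
    constant sign as long as w - 1 keeps the sign s. The signs at the two ends are opposite to this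
    monotonicity, so the Wronskian vanishes, and strictness leaves only w = 1. At al = 0 the weight
    x^(m+1) replaces the zero of P. *)
Lemma sturm_interval (f : R -> R) (kappa : R) (m k : nat) (a : R) (w y : R -> R)
    (P : {poly R}) (al be s : R) :
  profile f kappa m a w y -> 0 < kappa ->
  'X * (1 - 'X) * P^`()^`() + (m.+1%:R - (m.+1 + 2)%:R * 'X) * P^`() + (k * (k + m + 1 + 1))%:R * P = 0 ->
  0 <= al -> al < be -> be < 1 -> al = 0 \/ P.[al] = 0 -> P.[be] = 0 ->
  (forall x, al < x < be -> P.[x] != 0) ->
  (forall x, al <= x <= be -> 0 <= s * (w x - 1)) ->
  (forall x, al <= x <= be ->
    (k * (k + m + 1 + 1))%:R * (s * (w x - 1)) <= kappa * (s * f (w x))) ->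
  (forall x, al < x < be -> 0 < s * (w x - 1) ->
    (k * (k + m + 1 + 1))%:R * (s * (w x - 1)) < kappa * (s * f (w x))) ->
  forall x, al < x < be -> s * (w x - 1) = 0.
Proof.
move=> pr k0 ode al0 ab be1 Pal Pbe Pnz v0 vle vlt x xab.
set Lam := (k * _)%:R in vle vlt.
have odex t : t * (1 - t) * P^`()^`().[t] + (m.+1%:R - (m.+1 + 2)%:R * t) * P^`().[t] + Lam * P.[t] = 0.
  have := congr1 (fun p => p.[t]) ode; rewrite /Lam -!polyC_natr -polyC1.
  by rewrite !(hornerN, hornerD, hornerM, hornerX, hornerC).
have [r r1 rP] : exists2 r, r = 1 \/ r = -1 & forall t, al < t < be -> 0 < r * P.[t].
  pose mid := (al + be) / 2; have midab : al < mid < be by rewrite /mid; lra.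
  have Pc t : {for t, continuous (horner P)} by exact: (is_derive_cvg (is_derive_poly P t)).
  have sgn t : al < t < be -> 0 < P.[mid] * P.[t].
    move=> tab; rewrite ltNge; apply/negP => h.
    have [z zab Pz] : exists2 z, al < z < be & P.[z] = 0.
      case: (leP mid t) => mt.
        have [|z zz Pz] := @IVT_cc R (horner P) mid t 0 mt (fun z _ => Pc z); [|by exists z; [lra_from zz midab tab|]].
        by case: (leP P.[mid] 0) => h1; apply/orP; [left|right]; clear -h h1 midab Pnz; have := Pnz _ midab; rewrite neq_lt; nra.
      have [|z zz Pz] := @IVT_cc R (horner P) t mid 0 (ltW mt) (fun z _ => Pc z); [|by exists z; [lra_from zz midab tab|]].
      by case: (leP P.[mid] 0) => h1; apply/orP; [right|left]; clear -h h1 midab Pnz; have := Pnz _ midab; rewrite neq_lt; nra.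
    by have := Pnz z zab; rewrite Pz eqxx.
  have := Pnz _ midab; rewrite neq_lt => /orP[mn|mp].
    by exists (-1); [right|move=> t /sgn; clear -mn; nra].
  by exists 1; [left|move=> t /sgn; clear -mp; nra].
pose Wr t := t ^+ m.+1 * (1 - t) ^+ 2 * P^`().[t] * (w t - 1) - P.[t] * (t ^+ m.+1 * y t).
have WD t : al <= t <= be -> is_derive t (1 : R) (fun t => r * s * Wr t)
    (t ^+ m * (1 - t) * (r * P.[t]) * (kappa * (s * f (w t)) - Lam * (s * (w t - 1)))).
  move=> tab; have t1 : t < 1 by lra_from tab be1.
  have n0 : 1 - t != 0 by rewrite subr_eq0 gt_eqF.
  have D1 := is_derive1M (is_derive1M (is_derive1M (is_derive1X m.+1 (is_derive1_id t))
     (is_derive1X 2 (is_derive1B (is_derive1_cst 1 t) (is_derive1_id t)))) (is_derive_poly P^`() t))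
     (is_derive1B (profile_derive pr t1) (is_derive1_cst 1 t)).
  have D2 := is_derive1M (is_derive_poly P t) (profile_flux pr (ltac:(lra_from tab al0 t1) : 0 <= t < 1)).
  apply: (is_derive_eq (is_derive1M (is_derive1_cst (r * s) t) (is_derive1B D1 D2))).
  have := odex t; rewrite /= !natrD expr1 exprS -natr1 => E.
  move: (P.[t]) (P^`().[t]) (P^`()^`().[t]) (t ^+ m) (w t) (y t) (f (w t)) E => p0 p1 p2 T W Y F E.
  have E2 : t * (1 - t) * p2 = - ((m%:R + 1 - (m%:R + 1 + 2) * t) * p1) - Lam * p0 by lra_from E.
  transitivity (r * s * (T * (1 - t) * (t * (1 - t) * p2 + (m%:R + 1 - (m%:R + 1 + 2) * t) * p1) * (W - 1) + p0 * (kappa * T * (1 - t) * F))).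
    by field.
  by rewrite E2; ring.
have W0 : forall t, al <= t <= be -> r * s * Wr t = 0.
  have mono u t : al <= u -> u <= t -> t <= be -> r * s * Wr u <= r * s * Wr t.
    move=> au ut tb.
    have ab' z : u <= z <= t -> al <= z <= be by move=> zz; lra_from zz au tb.
    have ab'' z : u < z < t -> al < z < be by move=> zz; lra_from zz au tb.
    apply: (@nondecr_cc R (fun t => r * s * Wr t) _ u t ut (fun z zz => is_derive_cvg (WD z (ab' z zz))) (fun z zz => WD z (ab' z (ltac:(lra_from zz))))).
    move=> z zz; have zab := ab'' z zz.
    apply: mulr_ge0; last by rewrite subr_ge0; apply: vle; lra_from zab.
    apply: mulr_ge0; last exact: ltW (rP z zab).
    by apply: mulr_ge0; [apply: exprn_ge0|]; lra_from zab al0 be1.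
  have Wal : 0 <= r * s * Wr al.
    case: Pal => [->|Pal].
      by rewrite /Wr !expr0n /= !mul0r !mulr0 subrr mulr0.
    have Dr := is_derive1M (is_derive1_cst r al) (is_derive_poly P al).
    have := slope_at_left_zero ab Dr _ rP; rewrite mul0r add0r Pal mulr0 => /(_ erefl) h.
    rewrite /Wr Pal mul0r subr0 (_ : _ * _ = al ^+ m.+1 * (1 - al) ^+ 2 * ((r * P^`().[al]) * (s * (w al - 1)))); last by ring.
    apply: mulr_ge0; first by apply: mulr_ge0; [exact: exprn_ge0|exact: sqr_ge0].
    by rewrite mulr_ge0// v0// lexx ltW.
  have Wbe : r * s * Wr be <= 0.
    have Dr := is_derive1M (is_derive1_cst r be) (is_derive_poly P be).
    have := slope_at_right_zero ab Dr _ rP; rewrite mul0r add0r Pbe mulr0 => /(_ erefl) h.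
    rewrite /Wr Pbe mul0r subr0 (_ : _ * _ = be ^+ m.+1 * (1 - be) ^+ 2 * ((r * P^`().[be]) * (s * (w be - 1)))); last by ring.
    apply: mulr_ge0_le0; first by apply: mulr_ge0; [apply: exprn_ge0; lra_from al0 ab|exact: sqr_ge0].
    by rewrite mulr_le0_ge0// v0// lexx ltW.
  move=> t /andP[at_ tb]; apply/eqP; rewrite eq_le.
  by rewrite (le_trans (mono _ _ at_ tb (lexx _)) Wbe) (le_trans Wal (mono _ _ (lexx _) at_ tb)).
apply/eqP; rewrite eq_le v0 ?andbT; last by lra_from xab.
(* Were s (w - 1) positive at x, the identically vanishing Wronskian would have a positive
   derivative there. *)
rewrite leNgt; apply/negP => vx.
pose d := Num.min (x - al) (be - x).
have d0 : 0 < d by rewrite lt_min; apply/andP; split; lra_from xab.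
have Z : is_derive x (1 : R) (fun t => r * s * Wr t) 0.
  refine (is_derive1_near d0 _ (is_derive1_cst 0 x)) => t.
  rewrite lt_min !ltr_norml => td; rewrite W0//; lra_from td.
have xab' : al <= x <= be by lra_from xab.
have /esym/eqP := is_derive1_unique (WD x xab') Z.
have x0 : 0 < x by lra_from xab al0.
have x1 : 0 < 1 - x by lra_from xab be1.
by rewrite eq_sym gt_eqF// mulr_gt0 ?subr_gt0 ?vlt// mulr_gt0 ?rP// mulr_gt0// exprn_gt0.
Qed.

End SturmComparison.

(** * Starting values with a prescribed number of sign changes *)

Section BranchValues.
Variable R : realType.

Record shooting (f : R -> R) (kappa L : R) (m : nat) (w y : R -> R -> R) : Prop := Shooting {
  shooting_profile : forall a, profile f kappa m a (w a) (y a);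
  shooting_dep : uniform_dependence w;
  shooting_slope_dep : uniform_dependence y;
  shooting_kappa : 0 < kappa;
  shooting_L : 0 < L;
  shooting_lipschitz : forall u v, `|f u - f v| <= L * `|u - v|;
  shooting_eq0 : f 0 = 0;
  shooting_eq1 : f 1 = 0;
  shooting_const : forall c x, f c = 0 -> 0 <= x < 1 -> w c x = c }.

Lemma near_end_mono (kappa L : R) (m : nat) (X X' : R) : 0 < kappa -> 0 < L ->
  near_end kappa L m X -> X <= X' -> X' < 1 -> near_end kappa L m X'.
Proof.
move=> kk LL /and3P[h1 h2 h3] XX X1; apply/and3P; split => //.
  exact: le_trans XX.
apply: le_trans h3; rewrite ler_wpM2l//; last by lra_from XX.
by rewrite mulr_ge0 ?exprn_ge0// mulr_ge0// ltW.
Qed.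

Lemma near_end_ex (kappa L : R) (m : nat) : 0 < kappa -> 0 < L -> exists X, near_end kappa L m X.
Proof.
move=> kk LL.
pose C := kappa * L * 2 ^+ m.+1; have C0 : 0 < C by rewrite !mulr_gt0// exprn_gt0.
have p1 : 0 < (2 * C)^-1 by rewrite invr_gt0 mulr_gt0.
have h2 : 0 < 2^-1 :> R by rewrite invr_gt0.
have [h [h0 hC hh _]] := pos_below3 p1 h2 h2.
exists (1 - h); apply/and3P; split; [lra_from hh|lra_from h0|].
rewrite -/C (_ : 1 - (1 - h) = h); last by ring.
by rewrite -(ler_pM2l C0) invfM mulrCA mulfV ?gt_eqF// mulr1 in hC.
Qed.

(** For a close to 1, f(w) stays within e |w - 1| of gam (w - 1) up to the last zero of the Jacobi
    polynomial, and kappa (gam - e) still exceeds its eigenvalue. On each interval between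
    consecutive points among 0 and these zeros, w - 1 must then take both signs. *)
Lemma alternates_near_one (f : R -> R) (kappa L : R) (m : nat) (w y : R -> R -> R) (gam : R) (k : nat) :
  shooting f kappa L m w y -> is_derive (1 : R) (1 : R) f gam ->
  (k * (k + m + 1 + 1))%:R < kappa * gam ->
  exists2 d, 0 < d & forall a, 1 - d < a < 1 -> alternates (w a) k.
Proof.
move=> [pr depw depy k0 L0 fL f0 f1 wconst].
move=> fD Lg; case: k Lg => [|k] Lg.
  exists 1 => // a a1; exists (fun=> 0); split => //.
  move=> i; rewrite leqn0 => /eqP ->.
  by rewrite expr1 (profile_init (pr a)); lra_from a1.
have [P [z [P0 sP ode zP zi]]] := jacobi_polynomial R k.+1 m 1.
set Lam := (_ * _)%:R in Lg ode.
(* This choice keeps half of the spectral gap. *)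
pose e := (kappa * gam - Lam) / (2 * kappa).
have e0 : 0 < e by rewrite divr_gt0 ?mulr_gt0// subr_gt0.
have eE : kappa * (gam - e) - Lam = (kappa * gam - Lam) / 2.
  by rewrite /e; field; rewrite gt_eqF.
have [r r0 rH] := (is_derive1P f 1 gam).1 fD e e0.
have zk1 : z k < 1 by have [/andP[]] := zP k (ltnSn k).
have [d d0 dH] := depw _ _ zk1 r0.
exists d => // a /andP[ad a1].
have zinc := @increasing_le R z k (fun i ik => zi i ik).
pose p i : R := if i is i'.+1 then z i' else 0.
have pinc i : (i < k.+1)%N -> p i < p i.+1.
  case: i => [|i] ik /=; last exact: zi.
  by have [/andP[]] := zP 0%N isT.
have p01 i : (i <= k.+1)%N -> 0 <= p i <= z k.
  case: i => [|i] ik /=.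
    by rewrite lexx ltW//; have [/andP[]] := zP k (ltnSn k).
  by rewrite zinc// ltW//; have [/andP[]] := zP i ik.
(* By the degree bound, the k + 1 points z are all the roots of P. *)
have root_free i x : (i < k.+1)%N -> p i < x < p i.+1 -> P.[x] != 0.
  move=> ik /andP[xi1 xi2]; apply/eqP => Px.
  have zneq n : (n < k.+1)%N -> z n != x.
    move=> nk; rewrite neq_lt; case: (ltnP n i) => ni.
      apply/orP; left; apply: le_lt_trans xi1.
      by case: i ni ik {xi2} => [//|i] ni ik /=; apply: zinc; rewrite -ltnS// ltnW.
    apply/orP; right; apply: (lt_le_trans xi2) => /=; exact: zinc.
  have sorted_z : uniq (mkseq z k.+1).
    apply/mkseq_uniqP => u v; rewrite !inE => uk vk E.
    have strict i1 i2 : (i1 < i2)%N -> (i2 < k.+1)%N -> z i1 < z i2.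
      move=> i12 i2k; apply: (@lt_le_trans _ _ (z i1.+1)); last exact: zinc.
      by apply: zi; exact: leq_ltn_trans i2k.
    by case: (ltngtP u v) => // uv; have := strict _ _ uv; rewrite E ltxx => /(_ ltac:(done)).
  have rt : all (root P) (x :: mkseq z k.+1).
    apply/allP => t; rewrite inE => /orP[/eqP ->|/mapP[n]]; first by rewrite /root Px.
    by rewrite mem_iota add0n => /andP[_ nk] ->; rewrite /root (zP n nk).2.
  have uq : uniq (x :: mkseq z k.+1).
    rewrite cons_uniq sorted_z andbT; apply/negP => /mapP[n].
    by rewrite mem_iota add0n => /andP[_ nk] E; have := zneq n nk; rewrite E eqxx.
  have := max_poly_roots P0 rt uq; rewrite -cat1s size_cat size_mkseq.
  by rewrite ltnNge sP.
have close x : 0 <= x <= z k -> `|f (w a x) - gam * (w a x - 1)| <= e * `|w a x - 1|.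
  move=> xk; have := rH (w a x); rewrite f1 subr0; apply.
  have w1 : w 1 x = 1 by apply: wconst => //; case/andP: xk => -> xk; exact: le_lt_trans zk1.
  by rewrite distrC -{1}w1; apply: dH => //; rewrite ltr_norml; lra_from ad a1 d0.
(* If w - 1 kept one sign on the interval, Sturm comparison would give w = 1 there, hence y = 0, and
   [profile_unique] would give a = 1. *)
have no_sign (s : R) i : s = 1 \/ s = -1 -> (i < k.+1)%N ->
    exists2 x, p i <= x <= p i.+1 & s * (w a x - 1) < 0.
  move=> ss ik.
  have [//|nex] := pselect (exists2 x, p i <= x <= p i.+1 & s * (w a x - 1) < 0).
  have v0 x : p i <= x <= p i.+1 -> 0 <= s * (w a x - 1).
    by move=> xi; rewrite leNgt; apply/negP => sx; apply: nex; exists x.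
  have /andP[pi0 _] := p01 i (ltnW ik); have /andP[_ pi1] := p01 i.+1 ik.
  have xk x : p i <= x <= p i.+1 -> 0 <= x <= z k by move=> xi; lra_from xi pi0 pi1.
  have lower x : p i <= x <= p i.+1 -> (gam - e) * (s * (w a x - 1)) <= s * f (w a x).
    move=> xi; have := close x (xk x xi); have := v0 x xi.
    have -> : `|w a x - 1| = `|s * (w a x - 1)|.
      by rewrite normrM; case: ss => ->; rewrite ?normrN1 ?normr1 mul1r.
    move=> h; rewrite (ger0_norm h) ler_norml.
    by case: ss h => -> h h2; lra_from h h2.
  have vle x : p i <= x <= p i.+1 -> Lam * (s * (w a x - 1)) <= kappa * (s * f (w a x)).
    move=> xi; apply: (@le_trans _ _ (kappa * ((gam - e) * (s * (w a x - 1))))).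
      rewrite mulrA ler_wpM2r ?v0// -subr_ge0 eE.
      by lra_from Lg.
    by rewrite ler_pM2l// lower.
  have vlt x : p i < x < p i.+1 -> 0 < s * (w a x - 1) -> Lam * (s * (w a x - 1)) < kappa * (s * f (w a x)).
    move=> xi sx; apply: (@lt_le_trans _ _ (kappa * ((gam - e) * (s * (w a x - 1))))).
      rewrite mulrA ltr_pM2r// -subr_gt0 eE.
      by lra_from Lg.
    by rewrite ler_pM2l// lower//; lra_from xi.
  have Pal : p i = 0 \/ P.[p i] = 0.
    by case: (i) ik => [|i'] ik; [left|right; have [] := zP i' (ltnW ik)].
  have Pbe : P.[p i.+1] = 0 by have [] := zP i ik.
  have Z := sturm_interval (pr a) k0 ode pi0 (pinc i ik) (le_lt_trans pi1 zk1) Pal Pbe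
    (fun x xi => root_free i x ik xi) v0 vle vlt.
  have s0 : s != 0 by case: ss => ->; rewrite ?oppr_eq0 oner_eq0.
  have w1 x : p i < x < p i.+1 -> w a x = 1.
    by move=> /Z /eqP; rewrite mulf_eq0 (negbTE s0) subr_eq0 => /eqP.
  have := pinc i ik => pii.
  pose x0 := (p i + p i.+1) / 2.
  have x0i : p i < x0 < p i.+1 by rewrite /x0; lra_from pii.
  have x01 : 0 < x0 < 1 by lra_from x0i pi0 pi1 zk1.
  have D0 : is_derive x0 (1 : R) (w a) 0.
    pose r' := (p i.+1 - p i) / 2; have r'0 : 0 < r' by rewrite /r'; lra_from pii.
    refine (is_derive1_near r'0 _ (is_derive1_cst 1 x0)) => t.
    by rewrite ltr_norml => tx; rewrite w1//; move: tx; rewrite /x0 /r' => tx; lra_from tx.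
  have x02 : x0 < 1 by case/andP: x01.
  have y0 : y a x0 = 0.
    have /eqP := is_derive1_unique (profile_derive (pr a) x02) D0.
    by rewrite mulf_eq0 invr_eq0 sqrf_eq0 subr_eq0 (gt_eqF x02) orbF => /eqP.
  have := profile_unique (pr a) k0 L0 fL f1 x01 (w1 x0 x0i) y0.
  by move=> E; move: a1; rewrite E ltxx.
have sg i : (-1) ^+ i = 1 :> R \/ (-1) ^+ i = -1 :> R.
  by rewrite -signr_odd; case: (odd _); rewrite ?expr1 ?expr0; [right|left].
(* One sample in each of the k + 1 intervals, together with the sample at 0, gives k + 1 sign
   changes. Neighbouring samples have opposite signs, so they cannot coincide at a common
   endpoint. *)
have /choice[t tP] : forall i, exists t, (i < k.+1)%N ->
    p i <= t <= p i.+1 /\ 0 < (-1) ^+ i.+2 * (w a t - 1).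
  move=> i; case: (ltnP i k.+1) => ik; last by exists 0.
  have [t ti wt] := no_sign ((-1) ^+ i.+3) i (sg _) ik; exists t => _; split => //.
  by move: wt; rewrite exprS mulN1r => wt; lra_from wt.
have t0s : 0 < (-1) ^+ 1 * (w a 0 - 1) :> R.
  by rewrite expr1 (profile_init (pr a)); lra_from a1.
exists (fun i => if i is i'.+1 then t i' else 0); split => //.
- have [tk _] := tP k (ltnSn k); have /andP[_ h] := p01 k.+1 (leqnn _).
  by lra_from tk h zk1.
- move=> [|i] ik.
    have [ti st] := tP 0%N isT; rewrite lt_neqAle; apply/andP; split; last by case/andP: ti.
    by apply/eqP => E; move: st t0s; rewrite -E exprS mulN1r => h1 h2; lra_from h1 h2.
  have [ti st] := tP i (ltnW ik); have [ti' st'] := tP i.+1 ik.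
  rewrite lt_neqAle; apply/andP; split; last by lra_from ti ti'.
  by apply/eqP => E; move: st st'; rewrite -E (exprS _ i.+2) mulN1r => h1 h2; lra_from h1 h2.
- by move=> [|i] ik //; have [] := tP i ik.
Qed.

(** At a zero of w - 1 the flux is nonzero because zeros are simple, and the hypothesis of
    [trapped_sign] then holds with w - 1 = 0. *)
Lemma last_zero_unique (f : R -> R) (kappa L : R) (m : nat) (w y : R -> R -> R) (a z1 z2 : R) :
  shooting f kappa L m w y -> a != 1 -> near_end kappa L m z1 -> z1 < z2 -> z2 < 1 ->
  w a z1 = 1 -> w a z2 = 1 -> False.
Proof.
move=> [pr depw depy k0 L0 fL f0 f1 wconst].
move=> a1 ne z12 z21 w1 w2; have /and3P[zh zl _] := ne.
have z10 : 0 < z1 by apply: lt_le_trans zh; rewrite invr_gt0.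
have yn : y a z1 != 0.
  apply/eqP => y0; move/eqP: a1; apply.
  by apply: (profile_unique (pr a) k0 L0 fL f1 _ w1 y0); rewrite z10.
pose V := z1 ^+ m.+1 * y a z1.
have V0 : V != 0 by rewrite mulf_neq0// expf_neq0// gt_eqF.
pose s := Num.sg V.
have s1 : `|s| = 1 by rewrite normr_sg V0.
have sV : 0 < s * V by rewrite /s -normrEsg normr_gt0.
have h1 : 0 <= s * (w a z1 - 1) by rewrite w1 subrr mulr0.
have h2 : trap_rate kappa L * (1 - z1) ^+ 2 * (s * (w a z1 - 1)) < s * (z1 ^+ m.+1 * y a z1).
  by rewrite w1 subrr !mulr0.
have z12' : z1 < z2 < 1 by rewrite z12.
have [] := trapped_sign (pr a) k0 L0 fL f1 s1 ne h1 h2 z12'.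
by rewrite w2 subrr mulr0 ltxx.
Qed.

(** By comparison with the zero profile, w_a stays below 1 on [0, X0] for small a. All zeros of w_a
    - 1 lie beyond X0, where there is room for one only. *)
Lemma no_alternation_near_zero (f : R -> R) (kappa L : R) (m : nat) (w y : R -> R -> R) :
  shooting f kappa L m w y -> exists2 d, 0 < d & forall a, 0 < a < d -> ~ alternates (w a) 2.
Proof.
move=> sh; case: (sh) => [pr depw depy k0 L0 fL f0 f1 wconst].
have [X0 ne] := near_end_ex m k0 L0; have /and3P[Xh X1 _] := ne.
have [d d0 dH] := depw _ _ X1 ltr01.
exists (Num.min d 1); first by rewrite lt_min d0 ltr01.
move=> a; rewrite lt_min => /and3P[a0 ad a1] alt.
have wcont x : x < 1 -> {for x, continuous (w a)} by exact: (profile_cont (pr a)).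
have [z [zP zi]] := alternates_zeros wcont alt.
have [/andP[z00 z01] w0] := zP 0%N isT; have [/andP[z10 z11] w1] := zP 1%N isT.
have zX : X0 < z 0%N.
  rewrite ltNge; apply/negP => zX.
  have zX' : 0 <= z 0%N <= X0 by rewrite ltW.
  have ad' : `|a - 0| < d by rewrite subr0 gtr0_norm.
  have := dH a 0 (z 0%N) ad' zX'.
  by rewrite w0 (wconst 0 _ f0) ?(ltW z00) ?z01// subr0 normr1 ltxx.
apply: (last_zero_unique (z1 := z 0%N) (z2 := z 1%N) (a := a) sh) => //.
- by rewrite lt_eqF.
- by apply: near_end_mono k0 L0 ne (ltW zX) z01.
- exact: zi.
Qed.

(* An open condition under which w - 1 has no zero beyond X; if it fails at all X near 1, then
   ((w - 1)^2)' <= C (w - 1)^2 there and w stays bounded. *)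
Definition trapped (kappa L : R) (m : nat) (w y : R -> R -> R) (a X : R) : Prop :=
  trap_rate kappa L * (1 - X) ^+ 2 * (w a X - 1) ^+ 2 < (w a X - 1) * (X ^+ m.+1 * y a X).

Lemma trapped_open (f : R -> R) (kappa L : R) (m : nat) (w y : R -> R -> R) (a X : R) :
  shooting f kappa L m w y -> 0 <= X < 1 -> trapped kappa L m w y a X ->
  exists2 d, 0 < d & forall b, `|a - b| < d -> trapped kappa L m w y b X.
Proof.
move=> [pr depw depy k0 L0 fL f0 f1 wconst].
move=> /andP[X0 X1] tr.
have cw : {for a, continuous (fun a => w a X)}.
  apply/continuous_atP => e e0; have [d d0 dH] := depw _ _ X1 e0.
  by exists d => // b ab; apply: dH => //; rewrite X0 lexx.
have cy : {for a, continuous (fun a => y a X)}.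
  apply/continuous_atP => e e0; have [d d0 dH] := depy _ _ X1 e0.
  by exists d => // b ab; apply: dH => //; rewrite X0 lexx.
have cc c : {for a, continuous (fun=> c : R)} by exact: (is_derive_cvg (is_derive1_cst c a)).
have cv := continuous1B cw (cc 1).
have := continuous1B (continuous1M cv (continuous1M (cc (X ^+ m.+1)) cy))
   (continuous1M (cc (trap_rate kappa L * (1 - X) ^+ 2)) (continuous1M cv cv)).
rewrite /trapped -subr_gt0 (expr2 (w a X - 1)) in tr.
move=> /continuous_atP/(_ _ tr)[d d0 dH]; exists d => // b.
rewrite distrC => /dH; rewrite ltr_norml => /andP[h _].
by rewrite /trapped -subr_gt0 (expr2 (w b X - 1)); lra_from h.
Qed.

(** Dividing the quadratic trapping inequality by |w X - 1| gives the signed one of [trapped_sign],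
    with s the sign of w X - 1. *)
Lemma trapped_no_zero (f : R -> R) (kappa L : R) (m : nat) (w y : R -> R -> R) (a X x : R) :
  shooting f kappa L m w y -> near_end kappa L m X -> trapped kappa L m w y a X -> X <= x < 1 -> w a x != 1.
Proof.
move=> [pr depw depy k0 L0 fL f0 f1 wconst].
move=> ne tr /andP[]; rewrite le_eqVlt => /predU1P[<-|Xx] x1.
  by apply/eqP => wX; move: tr; rewrite /trapped wX subrr expr0n /= mulr0 mul0r ltxx.
pose v := w a X - 1; pose V := X ^+ m.+1 * y a X.
have tr' : trap_rate kappa L * (1 - X) ^+ 2 * v ^+ 2 < v * V by [].
have v0 : v != 0 by apply/eqP => v0; move: tr'; rewrite v0 expr0n /= mulr0 mul0r ltxx.
pose s := Num.sg v.
have s1 : `|s| = 1 by rewrite normr_sg v0.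
have sv : s * v = `|v| by rewrite -normrEsg.
have h1 : 0 <= s * (w a X - 1) by rewrite -/v sv.
have nv : 0 < `|v| by rewrite normr_gt0.
have h2 : trap_rate kappa L * (1 - X) ^+ 2 * (s * (w a X - 1)) < s * (X ^+ m.+1 * y a X).
  have e1 : `|v| * (trap_rate kappa L * (1 - X) ^+ 2 * `|v|) = trap_rate kappa L * (1 - X) ^+ 2 * v ^+ 2.
    by rewrite mulrCA -expr2 real_normK ?num_real.
  have e2 : `|v| * (s * V) = v * V.
    by rewrite -sv mulrACA -expr2 sqr_sg v0 mul1r.
  by rewrite -/v -/V sv -(ltr_pM2l nv) e1 e2.
have Xx' : X < x < 1 by rewrite Xx.
have [h _] := trapped_sign (pr a) k0 L0 fL f1 s1 ne h1 h2 Xx'.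
by apply/eqP => wx; move: h; rewrite wx subrr mulr0 ltxx.
Qed.

(** Nearby profiles have j + 1 zeros, of which at most the last lies beyond X0; the j others stay in
    a compact set and pass to c by upper semicontinuity. If c were trapped at X, so would be its
    neighbours, all j + 1 zeros would stay in [0, X], and c would have j + 1 sign changes. *)
Lemma boundary_value (f : R -> R) (kappa L : R) (m : nat) (w y : R -> R -> R) (c : R) (j : nat) :
  shooting f kappa L m w y -> 0 < c < 1 -> (0 < j)%N -> ~ alternates (w c) j.+1 ->
  (forall d, 0 < d -> exists2 b, `|c - b| < d & alternates (w b) j.+1) ->
  alternates (w c) j /\ forall X, near_end kappa L m X -> ~ trapped kappa L m w y c X.
Proof.
move=> sh; case: (sh) => [pr depw depy k0 L0 fL f0 f1 wconst].
move=> /andP[c0 c1] j0 nalt acc.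
have wcont b x : x < 1 -> {for x, continuous (w b)} by exact: (profile_cont (pr b)).
have semi := zeros_upper_semicontinuous pr depw depy k0 L0 fL f1 c1.
split.
  have [X0 ne] := near_end_ex m k0 L0; have /and3P[Xh X1 _] := ne.
  have X00 : 0 <= X0 by apply: le_trans Xh; rewrite invr_ge0.
  have [d d0 dH] := semi X0 X00 X1.
  have c1' : 0 < 1 - c by rewrite subr_gt0.
  have [b bc altb] := acc (Num.min d (1 - c)) (ltac:(by rewrite lt_min d0 c1')).
  move: bc; rewrite lt_min => /andP[bd bc].
  have b1 : b != 1 by rewrite lt_eqF//; move: bc; rewrite ltr_norml => bc; lra_from bc.
  have [z [zP zi]] := alternates_zeros (wcont b) altb.
  apply: (dH b bd j z) => [i ij|i ij]; last by apply: zi; exact: ltnW.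
  have [/andP[zi0 zi1] wz] := zP i (leqW ij); split => //.
  rewrite ltW//= leNgt; apply/negP => Xz.
  have [/andP[_ zj1] wzj] := zP i.+1 (ltac:(by [])).
  apply: (last_zero_unique (z1 := z i) (z2 := z i.+1) (a := b) sh) => //; last exact: zi.
  exact: near_end_mono k0 L0 ne (ltW Xz) zi1.
move=> X ne tr; apply: nalt; have /and3P[Xh X1 _] := ne.
have X00 : 0 <= X by apply: le_trans Xh; rewrite invr_ge0.
have [d1 d10 d1H] := semi X X00 X1.
have [d2 d20 d2H] := trapped_open sh (ltac:(by rewrite X00) : 0 <= X < 1) tr.
have [b bc altb] := acc (Num.min d1 d2) (ltac:(by rewrite lt_min d10)).
move: bc; rewrite lt_min => /andP[bd1 bd2].
have [z [zP zi]] := alternates_zeros (wcont b) altb.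
apply: (d1H b bd1 j.+1 z) => // i ij.
have [/andP[zi0 zi1] wz] := zP i ij; split => //.
rewrite ltW//= leNgt; apply/negP => Xz.
have := trapped_no_zero (x := z i) sh ne (d2H b bd2); rewrite (ltW Xz) zi1 => /(_ isT).
by rewrite wz eqxx.
Qed.

(** The set S is nonempty by the behaviour near 0 and bounded away from 1 by the behaviour near 1.
    As alternation is open, its supremum c does not alternate j + 1 times, whereas every point of
    (c, 1) does. *)
Lemma branch_value (f : R -> R) (kappa L : R) (m : nat) (w y : R -> R -> R) (gam : R) (k j : nat) :
  shooting f kappa L m w y -> is_derive (1 : R) (1 : R) f gam ->
  (k * (k + m + 1 + 1))%:R < kappa * gam -> (0 < j < k)%N ->
  exists c, [/\ 0 < c < 1, alternates (w c) j, ~ alternates (w c) j.+1 &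
    forall X, near_end kappa L m X -> ~ trapped kappa L m w y c X].
Proof.
move=> sh fD Lg /andP[j0 jk]; have depw := shooting_dep sh.
have [d1 d10 near1] := alternates_near_one sh fD Lg.
have [d0 d00 near0] := no_alternation_near_zero sh.
pose S := [set a | 0 < a < 1 /\ ~ alternates (w a) j.+1].
have [a0 [a0p a0d a0h _]] := pos_below3 (ltac:(lra_from d00) : 0 < d0 / 2) (ltac:(by rewrite invr_gt0) : 0 < 2^-1 :> R) ltr01.
have Sa0 : S a0.
  split; first by lra_from a0p a0h.
  move=> /(alternates_le (ltac:(by []) : (2 <= j.+1)%N)).
  by apply: near0; lra_from a0p a0d d00.
have Sub : ubound S (1 - d1).
  move=> a [a01 na]; rewrite leNgt; apply/negP => ad; apply: na.
  by apply: (alternates_le jk); apply: near1; lra_from ad a01.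
have hS : has_sup S by split; [exists a0|exists (1 - d1)].
have [c cE] : exists c, c = sup S by exists (sup S).
have c0 : a0 <= c by rewrite cE; apply: ub_le_sup => //; exists (1 - d1).
have c1 : c <= 1 - d1 by rewrite cE; apply: ge_sup => //; exists a0.
have c01 : 0 < c < 1 by lra_from c0 a0p c1 d10.
have nc : ~ alternates (w c) j.+1.
  move=> /(alternates_open depw)[d dp dH].
  have [a Sa ca] := sup_adherent dp hS.
  have ac : a <= c by rewrite cE; apply: ub_le_sup => //; exists (1 - d1).
  case: (Sa) => _; apply; apply: dH; rewrite ger0_norm ?subr_ge0//.
  by move: ca; rewrite -cE => ca; lra_from ca.
have acc d : 0 < d -> exists2 b, `|c - b| < d & alternates (w b) j.+1.
  move=> dp; pose h := Num.min (d / 2) ((1 - c) / 2).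
  have h0 : 0 < h by rewrite lt_min; apply/andP; split; lra_from dp c01.
  have hd : h <= d / 2 by rewrite ge_min lexx.
  have hc : h <= (1 - c) / 2 by rewrite ge_min lexx orbT.
  exists (c + h); first by rewrite ltr_norml; lra_from h0 hd dp.
  have [//|na] := pselect (alternates (w (c + h)) j.+1).
  have : S (c + h) by split => //; lra_from h0 hc c01.
  move/(ub_le_sup (ex_intro _ _ Sub)); rewrite -cE => h1.
  by exfalso; lra_from h1 h0.
have [h1 h2] := boundary_value sh c01 j0 nc acc.
by exists c.
Qed.

End BranchValues.

(** * Regularity of untrapped profiles *)

Section RegularEnd.
Variable R : realType.

(** The passage to the limit x -> 1 in an inequality, without naming a limit. *)
Lemma end_limit (P Q C x0 : R) : x0 < 1 -> 0 <= C ->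
  (forall x, x0 < x < 1 -> P <= Q + C * (1 - x)) -> P <= Q.
Proof.
move=> x01 C0 H; rewrite leNgt; apply/negP => QP.
have e0 : 0 < (P - Q) / (2 * (C + 1)) by rewrite divr_gt0 ?subr_gt0// mulr_gt0// ltr_wpDl.
have d0 : 0 < 1 - x0 by rewrite subr_gt0.
have d2 : 0 < (1 - x0) / 2 by lra_from d0.
have [h [h0 he hx _]] := pos_below3 e0 d2 ltr01.
have xh : x0 < 1 - h < 1 by lra_from h0 hx d0.
have := H (1 - h) xh; rewrite (_ : 1 - (1 - h) = h); last by ring.
move=> h1; move: he; rewrite ler_pdivlMr; last by rewrite mulr_gt0// ltr_wpDl.
move=> h2; have : 0 <= C * h by rewrite mulr_ge0// ltW.
by move=> h3; lra_from h1 h2 h3 h0 QP.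
Qed.

(** As w' = y / (1 - x)^2, the second bound says that w' is bounded; b is the value on the orbit x =
    1. *)
Definition regular (w y : R -> R) (b C : R) : Prop :=
  forall x, 0 <= x < 1 -> `|w x - b| <= C * (1 - x) /\ `|y x| <= C * (1 - x) ^+ 2.

Lemma untrapped_bounded (f : R -> R) (kappa L : R) (m : nat) (a : R) (w y : R -> R) (X0 : R) :
  profile f kappa m a w y -> 0 < kappa -> 0 < L -> near_end kappa L m X0 ->
  (forall X, X0 <= X < 1 -> (w X - 1) * (X ^+ m.+1 * y X) <= trap_rate kappa L * (1 - X) ^+ 2 * (w X - 1) ^+ 2) ->
  exists2 B, 0 < B & forall x, 0 <= x < 1 -> `|w x| <= B.
Proof.
move=> pr k0 L0 /and3P[Xh X1 _] un.
have X00 : 0 < X0 by apply: lt_le_trans Xh; rewrite invr_gt0.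
pose A := trap_rate kappa L; have A0 : 0 < A by rewrite /A /trap_rate !mulr_gt0.
pose T : R := 2 ^+ m.+1; have T0 : 0 < T by rewrite exprn_gt0.
(* Growth rate of (w - 1)^2: the factor 2 comes from the square, A from the failure of trapping, and
   T bounds x^(-m-1) for x >= 1/2. *)
pose C := 2 * A * T; have C0 : 0 < C by rewrite !mulr_gt0.
have DD (x : R) : X0 <= x < 1 -> is_derive x (1 : R) (fun t => (w t - 1) ^+ 2 * expR (- C * t))
    ((2 * (w x - 1) * (x ^+ m.+1 * y x / (x ^+ m.+1 * (1 - x) ^+ 2)) - C * (w x - 1) ^+ 2) * expR (- C * x)).
  move=> /andP[xX x1]; have x0 : 0 < x by apply: lt_le_trans xX.
  have hw := @profile_deriveV _ _ _ _ _ _ _ x pr (ltac:(by rewrite x0)).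
  apply: (is_derive_eq (is_derive1M (is_derive1X 2 (is_derive1B hw (is_derive1_cst 1 x)))
    (is_derive1_chain (is_derive_expR _) (is_derive1M (is_derive1_cst (- C) x) (is_derive1_id x))))).
  by rewrite expr1; ring.
have bound (x : R) : X0 <= x < 1 -> (w x - 1) ^+ 2 <= (w X0 - 1) ^+ 2 * expR C.
  move=> /andP[xX x1].
  have sub t : X0 <= t <= x -> X0 <= t < 1 by move=> tx; lra_from tx x1.
  have := @nonincr_cc R _ _ X0 x xX (fun t tx => is_derive_cvg (DD t (sub t tx)))
    (fun t tx => DD t (sub t (ltac:(lra_from tx)))).
  move=> H; have {}H : (w x - 1) ^+ 2 * expR (- C * x) <= (w X0 - 1) ^+ 2 * expR (- C * X0).
    apply: H => t /andP[tX tx]; apply: mulr_le0_ge0 (expR_ge0 _).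
    have tX1 : X0 <= t < 1 by rewrite ltW//= (lt_trans tx).
    have t0 : 0 < t by apply: lt_trans tX.
    have tp : 0 < t ^+ m.+1 by rewrite exprn_gt0.
    have t1 : 0 < 1 - t by lra_from tX1.
    have := un t tX1; rewrite -/A => un1.
    have iT : (t ^+ m.+1)^-1 <= T.
      rewrite -[leRHS]invrK lef_pV2 ?posrE ?invr_gt0 ?exprn_gt0// /T -exprVn.
      by apply: lerXn2r; rewrite ?nnegrE; [rewrite invr_ge0|exact: ltW|rewrite (le_trans Xh)// ltW].
    have E : 2 * (w t - 1) * (t ^+ m.+1 * y t / (t ^+ m.+1 * (1 - t) ^+ 2)) =
       2 * ((w t - 1) * (t ^+ m.+1 * y t)) / (t ^+ m.+1 * (1 - t) ^+ 2) by ring.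
    rewrite E subr_le0 ler_pdivrMr ?mulr_gt0 ?exprn_gt0//.
    apply: (@le_trans _ _ (2 * (A * (1 - t) ^+ 2 * (w t - 1) ^+ 2))).
      by rewrite ler_pM2l.
    have E2 : C * (w t - 1) ^+ 2 * (t ^+ m.+1 * (1 - t) ^+ 2) = 2 * (A * (1 - t) ^+ 2 * (w t - 1) ^+ 2) * (T * t ^+ m.+1).
      by rewrite /C; ring.
    rewrite E2 ler_peMr//.
      by apply: mulr_ge0 => //; apply: mulr_ge0 (sqr_ge0 _); apply: mulr_ge0 (sqr_ge0 _); exact: ltW.
    by rewrite -ler_pdivrMr ?mul1r//.
  have e1 : expR (- C * x) * expR C >= 1.
    by rewrite -expRD -expR0 ler_expR; clear -C0 x1; nra.
  have e2 : expR (- C * X0) <= 1.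
    by rewrite -expR0 ler_expR; clear -C0 X00; nra.
  have s1 := sqr_ge0 (w x - 1); have s2 := sqr_ge0 (w X0 - 1).
  apply: (@le_trans _ _ ((w x - 1) ^+ 2 * (expR (- C * x) * expR C))); first by rewrite ler_peMr.
  rewrite mulrA ler_pM2r ?expR_gt0//; apply: (le_trans H).
  by rewrite ler_piMr.
have wc x : 0 <= x <= X0 -> {for x, continuous w}.
  by move=> /andP[_ xX]; apply: (profile_cont pr); exact: le_lt_trans X1.
have [c1 _ Hmax] := max_cc (ltW X00) wc.
have [c2 _ Hmin] := min_cc (ltW X00) wc.
pose D := (w X0 - 1) ^+ 2 * expR C.
have D0 : 0 <= D by rewrite mulr_ge0 ?sqr_ge0 ?expR_ge0.
exists (`|w c1| + `|w c2| + D + 3) => [|x /andP[x0 x1]].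
  have := normr_ge0 (w c1); have := normr_ge0 (w c2) => h1 h2; lra_from h1 h2 D0.
have n1 := ler_norm (w c1); have n2 := ler_norm (- w c2); rewrite normrN in n2.
have m1 := normr_ge0 (w c1); have m2 := normr_ge0 (w c2).
case: (leP x X0) => xX.
  have h1 := Hmax x; have h2 := Hmin x; rewrite x0 xX in h1 h2.
  have {}h1 := h1 isT; have {}h2 := h2 isT.
  by rewrite ler_norml; apply/andP; split; lra_from h1 h2 n1 n2 m1 m2 D0.
have := bound x; rewrite (ltW xX) x1 => /(_ isT); rewrite -/D => h.
have s1 := sqr_ge0 (w x); have s2 := sqr_ge0 (w x - 2); rewrite !expr2 in h s1 s2.
by rewrite ler_norml; apply/andP; split; lra_from h m1 m2 D0 s1 s2.
Qed.

(** For bounded w the flux has derivative O(1 - x), so it has a limit at 1. If this limit were not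
    0, w' would be comparable to (1 - x)^-2 and w unbounded. Hence the flux is O((1 - x)^2), w is
    Lipschitz, and b is obtained as the supremum of w x - C1 (1 - x). *)
Lemma bounded_regular (f : R -> R) (kappa L : R) (m : nat) (a : R) (w y : R -> R) (B : R) : profile f kappa m a w y -> 0 < kappa -> 0 < L ->
  (forall u v, `|f u - f v| <= L * `|u - v|) -> f 0 = 0 -> 0 < B ->
  (forall x, 0 <= x < 1 -> `|w x| <= B) -> exists b, exists2 C, 0 < C & regular w y b C.
Proof.
move=> pr k0 L0 fL f0 B0 wB.
pose K := kappa * (L * B); have K0 : 0 < K by rewrite !mulr_gt0.
have fB x : 0 <= x < 1 -> `|f (w x)| <= L * B.
  move=> x01; have := fL (w x) 0; rewrite f0 !subr0 => /le_trans; apply.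
  by rewrite ler_pM2l// wB.
pose V x := x ^+ m.+1 * y x.
have VD (x : R) : 0 <= x < 1 -> is_derive x (1 : R) V (- (kappa * x ^+ m * (1 - x) * f (w x))) by move=> x01; exact: (profile_flux pr x01).
have dV (x : R) : 0 <= x < 1 -> `|kappa * x ^+ m * (1 - x) * f (w x)| <= K * (1 - x).
  move=> x01; have /andP[x0 x1] := x01; have d0 : 0 < 1 - x by rewrite subr_gt0.
  rewrite !normrM (gtr0_norm k0) (gtr0_norm d0) (ger0_norm (exprn_ge0 _ x0)).
  have xm : x ^+ m <= 1 by rewrite exprn_ile1// ltW.
  rewrite [leLHS](_ : _ = (kappa * (1 - x)) * (x ^+ m * `|f (w x)|)); last by ring.
  rewrite [leRHS](_ : _ = (kappa * (1 - x)) * (1 * (L * B))); last by rewrite /K; ring.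
  rewrite ler_pM2l ?mulr_gt0//; apply: ler_pM => //; first exact: exprn_ge0.
  exact: fB.
have Vb (x : R) : 0 <= x < 1 -> `|V x| <= K * (1 - x) ^+ 2.
  move=> /andP[x0 x1]; rewrite leNgt; apply/negP => Vx.
  have d0 : 0 < 1 - x by rewrite subr_gt0.
  have K2 : 0 <= K * (1 - x) ^+ 2 by rewrite mulr_ge0 ?sqr_ge0// ltW.
  pose s := Num.sg (V x).
  have V0 : V x != 0 by rewrite -normr_gt0; exact: le_lt_trans Vx.
  have sV : s * V x = `|V x| by rewrite -normrEsg.
  have s1 : `|s| = 1 by rewrite normr_sg V0.
  pose dl := `|V x| - K * (1 - x) ^+ 2; have dl0 : 0 < dl by rewrite subr_gt0.
  have low (t : R) : x <= t < 1 -> dl <= s * V t.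
    move=> /andP[xt t1]; move: xt; rewrite le_eqVlt => /predU1P[<-|xt].
      by rewrite sV /dl gerBl.
    have sub u : x <= u <= t -> 0 <= u < 1 by move=> ut; lra_from ut x0 t1.
    have [c cx Ec] := @MVT_cc R V _ x t xt (fun u ut => is_derive_cvg (VD u (sub u ut)))
      (fun u ut => VD u (sub u (ltac:(lra_from ut)))).
    have hc := dV c (sub c (ltac:(lra_from cx))).
    have : `|s * (V t - V x)| <= K * (1 - x) ^+ 2.
      rewrite normrM s1 mul1r Ec normrM normrN expr2 mulrA.
      apply: ler_pM => //.
        by apply: (le_trans hc); rewrite ler_pM2l//; lra_from cx.
      by rewrite ger0_norm; lra_from xt t1.
    rewrite ler_norml mulrBr sV => /andP[h _]; rewrite /dl.
    by lra_from h.
  have grow (t : R) : x <= t < 1 -> dl * ((1 - t)^-1 - (1 - x)^-1) <= s * w t - s * w x.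
    move=> /andP[xt t1].
    have sub u : x <= u <= t -> u < 1 by move=> ut; lra_from ut t1.
    have GD (u : R) : x <= u <= t -> is_derive u (1 : R) (fun u => s * w u - dl * (1 - u)^-1) (s * (y u / (1 - u) ^+ 2) - dl / (1 - u) ^+ 2).
      move=> ut; have u1 := sub u ut.
      have n0 : 1 - u != 0 by rewrite subr_eq0 gt_eqF.
      apply: (is_derive_eq (is_derive1B (is_derive1M (is_derive1_cst s u) (profile_derive pr u1))
        (is_derive1M (is_derive1_cst dl u) (is_derive1V (is_derive1B (is_derive1_cst 1 u) (is_derive1_id u)) n0)))).
      by ring.
    have := @nondecr_cc R _ _ x t xt (fun u ut => is_derive_cvg (GD u ut)) (fun u ut => GD u (ltac:(lra_from ut))).
    move=> H; have {}H : s * w x - dl * (1 - x)^-1 <= s * w t - dl * (1 - t)^-1.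
      apply: H => u ut; rewrite mulrA -mulrBl mulr_ge0 ?invr_ge0 ?sqr_ge0//.
      have u01 : 0 < u < 1 by lra_from ut x0 t1.
      have := low u (ltac:(lra_from ut t1)); rewrite /V => hu.
      have um : 0 < u ^+ m.+1 <= 1 by rewrite exprn_gt0 ?exprn_ile1; lra_from u01.
      have sy : 0 < s * y u.
        have /andP[u0 _] := um; rewrite -(pmulr_rgt0 _ u0) mulrCA; exact: lt_le_trans hu.
      rewrite subr_ge0; apply: (le_trans hu); rewrite mulrCA ler_piMl//; first exact: ltW.
      by case/andP: um.
    by lra_from H.
  (* At 1 - 1/Y the lower bound [grow] amounts to 2 B + 1, more than |w| <= B permits. *)
  pose Y := (1 - x)^-1 + (2 * B + 1) / dl.
  have Y0 : (1 - x)^-1 < Y by rewrite /Y ltrDl divr_gt0// ltr_wpDl// mulr_ge0// ltW.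
  have Yp : 0 < Y by apply: lt_trans Y0; rewrite invr_gt0.
  have iY : Y^-1 < 1 - x by rewrite -[ltRHS]invrK ltf_pV2// posrE invr_gt0.
  have iY0 : 0 < Y^-1 by rewrite invr_gt0.
  have t01 : x <= 1 - Y^-1 < 1 by lra_from iY iY0.
  have := grow _ t01; rewrite (_ : 1 - (1 - Y^-1) = Y^-1); last by ring.
  rewrite invrK /Y addrC addKr mulrCA mulfV ?gt_eqF// mulr1 => h.
  have h1 : `|s * w (1 - Y^-1)| <= B by rewrite normrM s1 mul1r wB//; lra_from t01 x0.
  have h2 : `|s * w x| <= B by rewrite normrM s1 mul1r wB// x0.
  move: h1 h2; rewrite !ler_norml => h1 h2; lra_from h h1 h2.
pose T : R := 2 ^+ m.+1; have T0 : 0 < T by rewrite exprn_gt0.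
have h2 : 0 < 2^-1 :> R by rewrite invr_gt0.
have yc (x : R) : 0 <= x <= 2^-1 -> {for x, continuous (fun x => `|y x|)}.
  move=> xh; apply: (@continuous1_chain R (fun t => `|t|) y); first exact: norm_continuous.
  by apply: (profile_slope_cont pr); lra_from xh.
have [c0 _ Hy] := max_cc (ltW h2) yc.
(* The first term serves on [0, 1/2], where (1 - x)^2 >= 1/4, the second beyond 1/2, where T bounds
   x^(-m-1). *)
pose C1 := 4 * `|y c0| + K * T.
have C10 : 0 < C1 by rewrite ltr_wpDl// ?mulr_gt0// mulr_ge0.
have yb (x : R) : 0 <= x < 1 -> `|y x| <= C1 * (1 - x) ^+ 2.
  move=> /andP[x0 x1]; case: (leP x 2^-1) => xh.
    have := Hy x; rewrite x0 xh => /(_ isT) h; apply: (le_trans h).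
    apply: (@le_trans _ _ (4 * `|y c0| * (1 - x) ^+ 2)); last first.
      by rewrite ler_wpM2r ?sqr_ge0// lerDl ltW// mulr_gt0.
    have : 1 <= 4 * (1 - x) ^+ 2 by rewrite expr2; clear -xh; nra.
    by move=> h4; have := normr_ge0 (y c0); clear -h4; nra.
  have xp : 0 < x by exact: lt_trans xh.
  have xm : 0 < x ^+ m.+1 by rewrite exprn_gt0.
  have := Vb x; rewrite x0 x1 => /(_ isT); rewrite /V normrM (gtr0_norm xm) mulrC -ler_pdivlMr// => /le_trans; apply.
  have iT : (x ^+ m.+1)^-1 <= T.
    rewrite -[leRHS]invrK lef_pV2 ?posrE ?invr_gt0 ?exprn_gt0// /T -exprVn.
    by apply: lerXn2r; rewrite ?nnegrE ?ltW.
  rewrite mulrAC ler_wpM2r ?sqr_ge0//; apply: (@le_trans _ _ (K * T)); first by rewrite ler_pM2l.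
  by rewrite lerDr mulr_ge0.
have lip (x x' : R) : 0 <= x -> x <= x' -> x' < 1 -> `|w x' - w x| <= C1 * (x' - x).
  move=> x0; rewrite le_eqVlt => /predU1P[->|xx] x1; first by rewrite !subrr normr0 mulr0.
  have sub u : x <= u <= x' -> u < 1 by move=> ut; lra_from ut x1.
  have [c cx ->] := @MVT_cc R w _ x x' xx (fun u ut => profile_cont pr (sub u ut))
    (fun u ut => profile_derive pr (sub u (ltac:(lra_from ut)))).
  have d0 : 0 <= x' - x by rewrite subr_ge0 ltW.
  rewrite normrM (ger0_norm d0) ler_wpM2r//.
  have c1 : 0 < (1 - c) ^+ 2 by rewrite exprn_gt0//; lra_from cx x1.
  rewrite normrM normfV (gtr0_norm c1) ler_pdivrMr//; apply: yb; lra_from cx x0 x1.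
pose S := [set r | exists2 x, 0 <= x < 1 & r = w x - C1 * (1 - x)].
have upper x x' : 0 <= x < 1 -> 0 <= x' < 1 -> w x' - C1 * (1 - x') <= w x + C1 * (1 - x).
  move=> /andP[x0 x1] /andP[x'0 x'1]; case: (leP x x') => xx.
    have := lip x x' x0 xx x'1; rewrite ler_norml => /andP[_ h].
    have h3 : 0 <= C1 * (1 - x') by rewrite mulr_ge0 ?subr_ge0 ?ltW.
    by lra_from h h3.
  have := lip x' x x'0 (ltW xx) x1; rewrite ler_norml => /andP[h _].
  have h3 : 0 <= C1 * (1 - x) by rewrite mulr_ge0 ?subr_ge0 ?ltW.
  by lra_from h h3.
have S0 : S !=set0 by exists (w 0 - C1 * (1 - 0)), 0; rewrite // lexx ltr01.
have Sub x : 0 <= x < 1 -> ubound S (w x + C1 * (1 - x)).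
  by move=> x01 r [x' x'01 ->]; exact: upper.
exists (sup S), C1 => // x x01; split; last exact: yb.
have u1 : sup S <= w x + C1 * (1 - x) by apply: ge_sup => //; exact: Sub.
have u2 : w x - C1 * (1 - x) <= sup S.
  by apply: ub_le_sup; [exists (w x + C1 * (1 - x)); exact: Sub|exists x].
by rewrite ler_norml; lra_from u1 u2.
Qed.

End RegularEnd.

(** * Positivity of regular profiles *)

Section Positivity.
Variable R : realType.

(** At a first zero of w the flux is negative by uniqueness; it cannot recover while w <= 0, since f
    >= 0 there, and so it stays away from 0, against regularity. If b were 0, then near 1 the flux
    would be negative or zero and of size at most kappa L w (1 - x)^2, so w' >= - D w and w could
    not reach 0 at x = 1. *)
Lemma regular_positive (f : R -> R) (kappa L : R) (m : nat) (a : R) (w y : R -> R) (b C : R) :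
  profile f kappa m a w y -> 0 < kappa -> 0 < L ->
  (forall u v, `|f u - f v| <= L * `|u - v|) -> f 0 = 0 ->
  (forall u, u <= 0 -> 0 <= f u) -> (forall u, 0 < u < 1 -> f u < 0) ->
  0 < a -> 0 < C -> regular w y b C -> (forall x, 0 <= x < 1 -> 0 < w x) /\ 0 < b.
Proof.
move=> pr k0 L0 fL f0 fneg fmid a0 C0 reg.
pose V x := x ^+ m.+1 * y x.
have VD (x : R) : 0 <= x < 1 -> is_derive x (1 : R) V (- (kappa * x ^+ m * (1 - x) * f (w x))).
  by move=> x01; exact: (profile_flux pr x01).
have Vend (x : R) : 0 <= x < 1 -> `|V x| <= C * (1 - x).
  move=> /andP[x0 x1]; have [_ hy] := reg x (ltac:(by rewrite x0)).
  rewrite /V normrM; apply: (@le_trans _ _ (1 * (C * (1 - x) ^+ 2))).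
    apply: ler_pM => //; rewrite ger0_norm ?exprn_ge0// exprn_ile1// ltW//.
  rewrite mul1r ler_pM2l// expr2 ler_piMr//; first by rewrite subr_ge0 ltW.
  by rewrite gerBl.
have wpos x : 0 <= x < 1 -> 0 < w x.
  move=> /andP[x0' x1]; rewrite ltNge; apply/negP => wx.
  have wc t : 0 <= t <= x -> {for t, continuous w}.
    by move=> tx; apply: (profile_cont pr); lra_from tx x1.
  have w0 : 0 < w 0 by rewrite (profile_init pr).
  have [x0 [/andP[x00 x0x] wx0 below]] := first_zero x0' wc w0 wx.
  have x01 : x0 < 1 by exact: le_lt_trans x1.
  have x001 : 0 < x0 < 1 by rewrite x00.
  have yn : y x0 != 0.
    by apply/eqP => y0; move: a0; rewrite (profile_unique pr k0 L0 fL f0 x001 wx0 y0) ltxx.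
  have xm : 0 < x0 ^+ m.+1 by rewrite exprn_gt0.
  have yle : y x0 <= 0.
    have := slope_at_right_zero x00 (profile_derive pr x01) wx0 (fun t tx => below t (ltac:(lra_from tx))).
    by rewrite pmulr_lle0// invr_gt0 exprn_gt0// subr_gt0.
  have V0 : V x0 < 0 by rewrite /V pmulr_rlt0// lt_neqAle yn.
  have stay t : x0 <= t < 1 -> V t < V x0 / 2.
    move=> /andP[xt t1]; rewrite ltNge; apply/negP => Vt.
    have sub u : x0 <= u <= t -> 0 <= u < 1 by move=> ut; lra_from ut x00 t1.
    have gc u : x0 <= u <= t -> {for u, continuous (fun u => V x0 / 2 - V u)}.
      move=> ut; exact: (is_derive_cvg (is_derive1B (is_derive1_cst _ _) (VD u (sub u ut)))).
    have g0 : 0 < V x0 / 2 - V x0 by lra_from V0.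
    have gt : V x0 / 2 - V t <= 0 by lra_from Vt.
    have [c [/andP[xc ct] gc0 gpos]] := first_zero xt gc g0 gt.
    have sub' u : x0 <= u <= c -> 0 <= u < 1 by move=> uc; apply: sub; lra_from uc ct.
    have wneg u : x0 <= u <= c -> w u <= 0.
      move=> /andP[xu uc]; rewrite -wx0.
      have lt1 v : x0 <= v <= u -> v < 1.
        by move=> vu; have /andP[] := sub' v (ltac:(lra_from vu uc)).
      apply: (nonincr_cc xu (fun v vu => profile_cont pr (lt1 v vu)) (fun v vu => profile_derive pr (lt1 v (ltac:(lra_from vu))))).
      move=> v vu; have := gpos v (ltac:(lra_from vu uc)).
      have v0 : 0 < v ^+ m.+1 by rewrite exprn_gt0//; lra_from vu x00.
      have v1 : 0 < 1 - v by have := sub' v (ltac:(lra_from vu uc)) => v1; lra_from v1.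
      move=> hV; have : V v <= 0 by lra_from hV V0.
      rewrite /V pmulr_rle0// => yv.
      by rewrite mulr_le0_ge0// invr_ge0 exprn_ge0// ltW.
    have : V c <= V x0.
      apply: (nonincr_cc (ltW xc) (fun v vu => is_derive_cvg (VD v (sub' v vu))) (fun v vu => VD v (sub' v (ltac:(lra_from vu))))).
      move=> v vu; have v01 := sub' v (ltac:(lra_from vu)).
      rewrite oppr_le0 mulr_ge0//.
        by apply: mulr_ge0; [apply: mulr_ge0; [exact: ltW|apply: exprn_ge0]|]; lra_from v01.
      by apply: fneg; apply: wneg; lra_from vu.
    by lra_from gc0 V0.
  pose dl := - (V x0 / 2); have dl0 : 0 < dl by rewrite /dl; lra_from V0.
  have : dl <= 0.
    apply: (end_limit (C := C) x01 (ltW C0)) => t tx.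
    have := stay t (ltac:(lra_from tx)); have := Vend t (ltac:(lra_from tx x00)).
    by rewrite ler_norml /dl => h1 h2; lra_from h1 h2.
  by move=> h; lra_from h dl0.
split=> //.
have b0 : 0 <= b.
  rewrite leNgt; apply/negP => bn.
  have : - b <= 0.
    apply: (end_limit (C := C) ltr01 (ltW C0)) => x x01.
    have [] := reg x (ltac:(lra_from x01)); have := wpos x (ltac:(lra_from x01)).
    by rewrite ler_norml => h1 h2 _; lra_from h1 h2.
  by move=> h; lra_from h bn.
rewrite lt_neqAle b0 andbT; apply/eqP => bE.
have wend x : 0 <= x < 1 -> w x <= C * (1 - x).
  by move=> x01; have [] := reg x x01; rewrite -bE subr0 ler_norml => /andP[].
have C1 : 0 < (2 * C)^-1 by rewrite invr_gt0 mulr_gt0.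
have [h [h0 hC h2 _]] := pos_below3 C1 (ltac:(by rewrite invr_gt0) : 0 < 2^-1 :> R) ltr01.
pose X := 1 - h.
have Xp : 0 < X < 1 by rewrite /X; lra_from h0 h2.
have hCC : C * h < 1.
  by move: hC; rewrite invfM ler_pdivlMr// => hC; lra_from hC.
have w1 x : X <= x < 1 -> 0 < w x < 1.
  move=> xX; have x01 : 0 <= x < 1 by lra_from xX Xp.
  rewrite wpos//=; apply: (le_lt_trans (wend x x01)); apply: le_lt_trans hCC.
  by rewrite ler_pM2l//; move: xX; rewrite /X => xX; lra_from xX.
have dVpos x : X <= x < 1 -> 0 <= - (kappa * x ^+ m * (1 - x) * f (w x)).
  move=> xX; have := fmid _ (w1 x xX) => fx.
  rewrite oppr_ge0 mulr_ge0_le0 ?(ltW fx)//.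
  by apply: mulr_ge0; [apply: mulr_ge0; [exact: ltW|apply: exprn_ge0]|]; lra_from xX Xp.
have Vle0 x : X <= x < 1 -> V x <= 0.
  move=> xX; apply: (end_limit (C := C) (x0 := x) _ (ltW C0)); first by lra_from xX.
  move=> t tx; rewrite add0r.
  have := Vend t (ltac:(lra_from tx xX Xp)); rewrite ler_norml => /andP[_ hV].
  apply: le_trans hV.
  have sub u : x <= u <= t -> 0 <= u < 1 by move=> ut; lra_from ut tx xX Xp.
  apply: (nondecr_cc (ltac:(lra_from tx) : x <= t) (fun v vu => is_derive_cvg (VD v (sub v vu))) (fun v vu => VD v (sub v (ltac:(lra_from vu))))).
  by move=> v vu; apply: dVpos; lra_from vu tx xX.
have yle0 x : X <= x < 1 -> y x <= 0.
  move=> xX; have := Vle0 x xX; rewrite /V pmulr_rle0// exprn_gt0//; lra_from xX Xp.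
have wdec x t : X <= x -> x <= t -> t < 1 -> w t <= w x.
  move=> Xx xt t1.
  have sub u : x <= u <= t -> u < 1 by move=> ut; lra_from ut t1.
  apply: (nonincr_cc xt (fun v vu => profile_cont pr (sub v vu)) (fun v vu => profile_derive pr (sub v (ltac:(lra_from vu))))).
  move=> v vu; rewrite mulr_le0_ge0 ?invr_ge0 ?sqr_ge0// yle0//; lra_from vu Xx t1.
have Vlow x : X <= x < 1 -> - (kappa * L * w x * (1 - x) ^+ 2) <= V x.
  move=> xX; rewrite -lerN2 opprK.
  apply: (end_limit (C := C) (x0 := x) _ (ltW C0)); first by lra_from xX.
  move=> t tx.
  have := Vend t (ltac:(lra_from tx xX Xp)); rewrite ler_norml => /andP[hV _].
  have sub u : x <= u <= t -> 0 <= u < 1 by move=> ut; lra_from ut tx xX Xp.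
  have [c cx Ec] := MVT_cc (ltac:(lra_from tx) : x < t) (fun v vu => is_derive_cvg (VD v (sub v vu))) (fun v vu => VD v (sub v (ltac:(lra_from vu)))).
  have cX : X <= c < 1 by lra_from cx tx xX.
  have wxp := wpos x (ltac:(lra_from xX Xp)).
  have fc : - f (w c) <= L * w x.
    have h3 := fL (w c) 0; rewrite f0 !subr0 in h3.
    apply: (le_trans (ler_norm _)); rewrite normrN; apply: (le_trans h3).
    rewrite ler_pM2l// gtr0_norm; last by have /andP[] := w1 c cX.
    by apply: wdec; lra_from xX cx tx.
  have c01 : 0 <= c <= 1 by lra_from cX Xp.
  have cm : 0 <= c ^+ m <= 1 by rewrite exprn_ge0 ?exprn_ile1//; lra_from c01.
  have fcn : 0 <= - f (w c) by rewrite oppr_ge0 ltW// fmid// w1.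
  have : - (kappa * c ^+ m * (1 - c) * f (w c)) * (t - x) <= kappa * L * w x * (1 - x) ^+ 2.
    rewrite [leLHS](_ : _ = kappa * (c ^+ m * ((- f (w c)) * ((1 - c) * (t - x))))); last by ring.
    rewrite [leRHS](_ : _ = kappa * (1 * ((L * w x) * ((1 - x) * (1 - x))))); last by ring.
    have p1 : 0 <= (1 - c) * (t - x) by apply: mulr_ge0; lra_from c01 tx.
    rewrite ler_pM2l//; apply: ler_pM; [by case/andP: cm|exact: mulr_ge0|by case/andP: cm|].
    by apply: ler_pM => //; apply: ler_pM; lra_from c01 cx tx xX.
  by rewrite -Ec => hh; lra_from hh hV.
pose D := kappa * L * (X ^+ m.+1)^-1.
have Xm : 0 < X ^+ m.+1 by rewrite exprn_gt0//; case/andP: Xp.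
have D0 : 0 <= D by rewrite mulr_ge0 ?invr_ge0 ?(ltW Xm)// mulr_ge0// ltW.
have dw x : X <= x < 1 -> 0 <= y x / (1 - x) ^+ 2 + D * w x.
  move=> xX; have x1 : 0 < (1 - x) ^+ 2 by rewrite exprn_gt0//; lra_from xX.
  have x0 : 0 < x by lra_from xX Xp.
  have xm : 0 < x ^+ m.+1 by rewrite exprn_gt0.
  have Xx : X ^+ m.+1 <= x ^+ m.+1 by apply: lerXn2r; rewrite ?nnegrE; lra_from xX Xp.
  have := Vlow x xX; rewrite /V => hV.
  rewrite -(pmulr_rge0 _ x1) mulrDr mulrCA mulfV ?gt_eqF// mulr1.
  have wxp := wpos x (ltac:(lra_from xX Xp)).
  have : - (kappa * L * w x * (1 - x) ^+ 2) <= X ^+ m.+1 * y x.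
    by apply: (le_trans hV); rewrite ler_wnM2r// yle0.
  rewrite -(ler_pM2l (_ : 0 < (X ^+ m.+1)^-1)) ?invr_gt0// mulKf ?gt_eqF// => hh.
  rewrite /D; lra_from hh.
have ED (x : R) : X <= x < 1 -> is_derive x (1 : R) (fun t => w t * expR (D * t)) ((y x / (1 - x) ^+ 2 + D * w x) * expR (D * x)).
  move=> xX; have x1 : x < 1 by case/andP: xX.
  apply: (is_derive_eq (is_derive1M (profile_derive pr x1) (is_derive1_chain (is_derive_expR _) (is_derive1M (is_derive1_cst D x) (is_derive1_id x))))).
  by ring.
have wX := wpos X (ltac:(lra_from Xp)).
have low x : X <= x < 1 -> w X * expR (D * X) <= w x * expR D.
  move=> xX; have sub u : X <= u <= x -> X <= u < 1 by move=> ux; lra_from ux xX.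
  apply: (@le_trans _ _ (w x * expR (D * x))).
    apply: (nondecr_cc (ltac:(lra_from xX) : X <= x) (fun v vu => is_derive_cvg (ED v (sub v vu))) (fun v vu => ED v (sub v (ltac:(lra_from vu))))).
    by move=> v vu; rewrite mulr_ge0 ?expR_ge0// dw// sub//; lra_from vu.
  rewrite ler_pM2l; last by apply: wpos; lra_from xX Xp.
  by rewrite ler_expR ler_piMr//; lra_from xX.
have E0 := expR_gt0 D.
have : w X * expR (D * X) <= 0.
  apply: (end_limit (C := C * expR D) (x0 := X)); first by case/andP: Xp.
    by rewrite mulr_ge0// ltW.
  move=> x xX; rewrite add0r; apply: (le_trans (low x (ltac:(lra_from xX)))).
  by rewrite mulrAC ler_pM2r// wend//; lra_from xX Xp.
by rewrite leNgt mulr_gt0// expR_gt0.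
Qed.

End Positivity.

(** * The a priori bound *)

Section AprioriBound.
Variable R : realType.

(** Constant from 1 on, so that the boundary behaviour at 1 becomes continuity at the point 1. *)
Definition ext (g : R -> R) (l x : R) : R := if x < 1 then g x else l.

Lemma ext_lt (g : R -> R) (l x : R) : x < 1 -> ext g l x = g x.
Proof. by rewrite /ext => ->. Qed.

Lemma ext1 (g : R -> R) (l : R) : ext g l 1 = l.
Proof. by rewrite /ext ltxx. Qed.

Lemma ext_continuous (g : R -> R) (l x : R) : x < 1 -> {for x, continuous g} ->
  {for x, continuous (ext g l)}.
Proof.
move=> x1; apply: (@continuous_near R _ _ _ (1 - x)); first by rewrite subr_gt0.
by move=> y; rewrite ltr_norml => yx; rewrite ext_lt//; lra_from yx.
Qed.

Lemma is_derive_ext (g : R -> R) (l x d : R) : x < 1 -> is_derive x (1 : R) g d ->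
  is_derive x (1 : R) (ext g l) d.
Proof.
move=> x1; apply: (@is_derive1_near R _ _ _ _ (1 - x)); first by rewrite subr_gt0.
by move=> y; rewrite ltr_norml => yx; rewrite ext_lt//; lra_from yx.
Qed.

Lemma ext_continuous1 (g : R -> R) (l C : R) : 0 < C ->
  (forall x, 0 <= x < 1 -> `|g x - l| <= C * (1 - x)) -> {for 1, continuous (ext g l)}.
Proof.
move=> C0 H; apply/continuous_atP => e e0.
have p : 0 < e / C by rewrite divr_gt0.
have [d [d0 dC d1 _]] := pos_below3 p ltr01 ltr01.
exists d => // x; rewrite ltr_norml => xd; rewrite ext1 /ext.
case: (ltP x 1) => x1; last by rewrite subrr normr0.
apply: (@le_lt_trans _ _ (C * (1 - x))); first by apply: H; lra_from xd d1 x1.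
rewrite mulrC -ltr_pdivlMr//; apply: lt_le_trans dC; lra_from xd.
Qed.

Lemma profile_slope_derive (f : R -> R) (kappa : R) (m : nat) (a : R) (w y : R -> R) (x : R) :
  profile f kappa m a w y -> 0 < x < 1 ->
  is_derive x (1 : R) y (- (kappa * (1 - x) * f (w x) + m.+1%:R * y x) / x).
Proof.
move=> pr /andP[x0 x1].
have xn : x ^+ m.+1 != 0 by rewrite expf_neq0// gt_eqF.
have D := is_derive1M (profile_flux pr (ltac:(by rewrite ltW) : 0 <= x < 1))
   (is_derive1V (is_derive1X m.+1 (is_derive1_id x)) xn).
refine (is_derive1_near x0 _ (is_derive_eq D _)).
  move=> t; rewrite ltr_norml => tx.
  have t0 : t != 0 by rewrite gt_eqF//; lra_from tx.
  by rewrite mulrAC mulfV ?mul1r// expf_neq0.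
have xn0 : x != 0 by rewrite gt_eqF.
rewrite /= !exprS; have : x ^+ m != 0 by rewrite expf_neq0.
move: (x ^+ m) (f (w x)) (y x) => X F Y X0.
by field; rewrite X0 xn0.
Qed.

(** With t the distance to p_0 and x = sin^2 t, the first term is (dw/dt)^2 / 8: this is the
    mechanical energy of the radial equation. *)
Definition energy (kappa q M : R) (w y : R -> R) (x : R) : R :=
  x * y x ^+ 2 / (2 * (1 - x) ^+ 3) + kappa * prim q M (w x).

Lemma is_derive_energy (kappa q M a : R) (m : nat) (w y : R -> R) (x : R) :
  2 < q -> 1 < M -> profile (nlin q M) kappa m a w y -> 0 < x < 1 -> 0 < w x ->
  is_derive x (1 : R) (energy kappa q M w y)
    (y x ^+ 2 / (1 - x) ^+ 4 * ((m%:R + 2) * x - (m%:R + 2^-1))).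
Proof.
move=> q2 M1 pr x01 wx; have /andP[x0 x1] := x01.
have n0 : 1 - x != 0 by rewrite subr_eq0 gt_eqF.
have n3 : 2 * (1 - x) ^+ 3 != 0 by rewrite mulf_neq0 ?expf_neq0// pnatr_eq0.
have Dy := profile_slope_derive pr x01.
have D1 := is_derive1M (is_derive1M (is_derive1_id x) (is_derive1X 2 Dy))
  (is_derive1V (is_derive1M (is_derive1_cst 2 x) (is_derive1X 3 (is_derive1B (is_derive1_cst 1 x) (is_derive1_id x)))) n3).
have D2 := is_derive1M (is_derive1_cst kappa x) (is_derive1_chain (is_derive_prim q2 M1 wx) (profile_derive pr x1)).
apply: (is_derive_eq (is_derive1D D1 D2)).
have xn0 : x != 0 by rewrite gt_eqF.
rewrite /= -natr1; move: (nlin q M (w x)) (y x) => F Y.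
by field; rewrite n0 xn0.
Qed.

(* Pohozaev multiplier: x^al (1-x)^2 is p phi for p the volume density of the geodesic spheres
   around the singular orbit x = 1 and phi = p^(1/3) *)
Definition pohozaev (kappa q M al : R) (m : nat) (w y : R -> R) (x : R) : R :=
  x `^ al * ((1 - x) ^+ 2 * energy kappa q M w y x
             - ((2 * m%:R + 4) * x - (2 * m%:R + 1)) / 3 * (w x * y x) / 2).

(** The multiplier is chosen so that the terms in y^2 cancel. What remains is the density 4 F(w) - w
    f(w) and a term in w y, whose coefficient is nonnegative for x >= [turning] m when m >= 1. The
    value of al is the exponent of x in p^(4/3) for p = sin^(4n-1) cos^3 and 2n = m + 1. *)
Lemma is_derive_pohozaev (kappa q M a al : R) (m : nat) (w y : R -> R) (x : R) :
  al = (4 * m%:R + 2) / 3 ->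
  2 < q -> 1 < M -> profile (nlin q M) kappa m a w y -> 0 < x < 1 -> 0 < w x ->
  is_derive x (1 : R) (pohozaev kappa q M al m w y)
   (- (kappa / 2 * ((1 - x) * x `^ (al - 1) * (((2 * m%:R + 4) * x - (2 * m%:R + 1)) / 3) *
         (4 * prim q M (w x) - w x * nlin q M (w x)))
      + x `^ (al - 1) * ((m%:R + 1) * x + (2 * m%:R + 1) * (1 - m%:R) / 9 * (1 - x)) * (w x * y x) / 2)).
Proof.
move=> alE q2 M1 pr x01 wx; have /andP[x0 x1] := x01.
have n0 : 1 - x != 0 by rewrite subr_eq0 gt_eqF.
have xn0 : x != 0 by rewrite gt_eqF.
have De := is_derive_energy q2 M1 pr x01 wx.
have Dy := profile_slope_derive pr x01.
have Dl := is_derive1M (is_derive1M (is_derive1B (is_derive1M (is_derive1_cst (2 * m%:R + 4) x) (is_derive1_id x))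
   (is_derive1_cst (2 * m%:R + 1) x)) (is_derive1_cst 3^-1 x)) (is_derive1M (profile_derive pr x1) Dy).
have D := is_derive1M (is_derive1_powR al x0)
  (is_derive1B (is_derive1M (is_derive1X 2 (is_derive1B (is_derive1_cst 1 x) (is_derive1_id x))) De)
     (is_derive1M Dl (is_derive1_cst 2^-1 x))).
apply: (is_derive_eq D).
have -> : x `^ al = x * x `^ (al - 1).
  by rewrite mulr_powRB1// ?ltW// alE divr_gt0// ltr_wpDl// mulr_ge0.
rewrite /energy alE /= -[m.+1%:R]natr1; move: (w x) (nlin q M (w x)) (prim q M (w x)) (y x) (m%:R) => W F P Y n.
move: (x `^ _) => Z.
by field; rewrite n0 xn0.
Qed.

End AprioriBound.

(** * Monotonicity of the energy and the bound at x = 1 *)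

Section AprioriBound2.
Variable R : realType.

(** The zero of the last factor in the derivative of the energy; for m + 1 = 2n it is the x of the
    geodesic sphere about p_0 of largest volume, where sin^(4n-1) cos^3 is maximal. *)
Definition turning (m : nat) : R := (2 * m%:R + 1) / (2 * m%:R + 4).

Lemma turning_bounds (m : nat) : 0 < turning m < 1.
Proof.
have m0 : 0 <= m%:R :> R by [].
rewrite /turning; apply/andP; split; first by rewrite divr_gt0; lra_from m0.
by rewrite ltr_pdivrMr; lra_from m0.
Qed.

Lemma energy_continuous (kappa q M a : R) (m : nat) (w y : R -> R) (x : R) :
  2 < q -> 1 < M -> profile (nlin q M) kappa m a w y -> x < 1 -> 0 < w x ->
  {for x, continuous (energy kappa q M w y)}.
Proof.
move=> q2 M1 pr x1 wx.
have n3 : 2 * (1 - x) ^+ 3 != 0 by rewrite mulf_neq0 ?expf_neq0 ?pnatr_eq0// subr_eq0 gt_eqF.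
have cy := profile_slope_cont pr x1.
have c1 := continuous1M (is_derive_cvg (is_derive1_id x)) (@continuous1_chain R (fun t => t ^+ 2) y x (is_derive_cvg (is_derive1X 2 (is_derive1_id (y x)))) cy).
have c2 := is_derive_cvg (is_derive1V (is_derive1M (is_derive1_cst 2 x) (is_derive1X 3 (is_derive1B (is_derive1_cst 1 x) (is_derive1_id x)))) n3).
have c3 := continuous1M (is_derive_cvg (is_derive1_cst kappa x)) (@continuous1_chain R (prim q M) w x (is_derive_cvg (is_derive_prim q2 M1 wx)) (profile_cont pr x1)).
exact: (continuous1D (continuous1M c1 c2) c3).
Qed.

(** Regularity makes the kinetic term O(1 - x), so only kappa F(b) is left at 1. *)
Lemma energy_end (kappa q M b C : R) (w y : R -> R) :
  2 < q -> 1 < M -> 0 < C -> regular w y b C -> 0 < b ->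
  {for 1, continuous (ext (energy kappa q M w y) (kappa * prim q M b))}.
Proof.
move=> q2 M1 C0 reg b0.
pose kin x := x * y x ^+ 2 / (2 * (1 - x) ^+ 3).
have -> : ext (energy kappa q M w y) (kappa * prim q M b) =
    (fun x => ext kin 0 x + kappa * prim q M (ext w b x)).
  by apply/funext => x; rewrite /ext /energy; case: ifP => // _; rewrite add0r.
have cw : {for 1, continuous (ext w b)}.
  by apply: (ext_continuous1 C0) => x x01; have [] := reg x x01.
have ck : {for 1, continuous (ext kin 0)}.
  apply: (@ext_continuous1 R _ _ (C ^+ 2)); first exact: exprn_gt0.
  move=> x x01; have [_ hy] := reg x x01; rewrite subr0 /kin.
  have /andP[x0 x1] := x01; have d0 : 0 < 1 - x by rewrite subr_gt0.
  have d3 : 0 < 2 * (1 - x) ^+ 3 by rewrite mulr_gt0// exprn_gt0.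
  rewrite normrM normfV (gtr0_norm d3) ler_pdivrMr// normrM (ger0_norm x0) normrX.
  have h : `|y x| ^+ 2 <= (C * (1 - x) ^+ 2) ^+ 2.
    by rewrite lerXn2r// nnegrE mulr_ge0 ?sqr_ge0// ltW.
  apply: (@le_trans _ _ (1 * (C * (1 - x) ^+ 2) ^+ 2)).
    by apply: ler_pM => //; exact: ltW.
  have p : 0 <= C ^+ 2 * (1 - x) ^+ 4 by rewrite mulr_ge0 ?exprn_ge0// ltW.
  by lra_from p.
have cb : {for ext w b 1, continuous (prim q M)}.
  by rewrite ext1; exact: (is_derive_cvg (is_derive_prim q2 M1 b0)).
exact: (continuous1D ck (continuous1M (is_derive_cvg (is_derive1_cst kappa 1))
  (@continuous1_chain R (prim q M) (ext w b) 1 cb cw))).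
Qed.

Lemma energy_nonincr (kappa q M a : R) (m : nat) (w y : R -> R) (x : R) :
  2 < q -> 1 < M -> profile (nlin q M) kappa m a w y ->
  (forall x, 0 <= x < 1 -> 0 < w x) -> 0 <= x <= turning m ->
  energy kappa q M w y x <= kappa * prim q M a.
Proof.
move=> q2 M1 pr wpos /andP[x0 xs]; have /andP[s0 s1] := turning_bounds m.
have e0 : energy kappa q M w y 0 = kappa * prim q M a.
  by rewrite /energy !mul0r add0r (profile_init pr).
rewrite -e0.
have lt1 u : 0 <= u <= x -> 0 <= u < 1 by move=> ux; lra_from ux xs s1.
apply: (nonincr_cc x0 (fun u ux => energy_continuous q2 M1 pr (proj2 (andP (lt1 u ux))) (wpos u (lt1 u ux)))).
  move=> u ux; have u01 : 0 < u < 1 by lra_from ux xs s1.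
  by apply: (is_derive_energy q2 M1 pr u01); apply: wpos; lra_from u01.
move=> u ux; apply: mulr_ge0_le0.
  by rewrite mulr_ge0 ?sqr_ge0// invr_ge0 -[4%N]/(2 * 2)%N exprM sqr_ge0.
have m0 : 0 <= m%:R :> R by [].
have : u <= turning m by lra_from ux xs.
have t4 : 0 < 2 * m%:R + 4 :> R by lra_from m0.
by rewrite /turning ler_pdivlMr// => h; lra_from h.
Qed.

Lemma energy_nondecr (kappa q M a b C : R) (m : nat) (w y : R -> R) (u v : R) :
  2 < q -> 1 < M -> profile (nlin q M) kappa m a w y -> 0 < C -> regular w y b C -> 0 < b ->
  (forall x, 0 <= x < 1 -> 0 < w x) -> turning m <= u -> u <= v -> v <= 1 ->
  ext (energy kappa q M w y) (kappa * prim q M b) u <= ext (energy kappa q M w y) (kappa * prim q M b) v.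
Proof.
move=> q2 M1 pr C0 reg b0 wpos su uv v1; have /andP[s0 s1] := turning_bounds m.
apply: (@nondecr_cc R _ (fun x => y x ^+ 2 / (1 - x) ^+ 4 * ((m%:R + 2) * x - (m%:R + 2^-1))) _ _ uv).
- move=> x xuv; have : x <= 1 by lra_from xuv v1.
  rewrite le_eqVlt => /predU1P[->|x1]; first exact: (@energy_end kappa q M b C w y q2 M1 C0 reg b0).
  apply: ext_continuous => //; apply: (energy_continuous q2 M1 pr x1).
  by apply: wpos; lra_from xuv su s0 x1.
- move=> x xuv; have x1 : x < 1 by lra_from xuv v1.
  have x01 : 0 < x < 1 by lra_from xuv su s0 x1.
  apply: (is_derive_ext _ x1); apply: (is_derive_energy q2 M1 pr x01).
  by apply: wpos; lra_from x01.
move=> x xuv; apply: mulr_ge0.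
  by rewrite mulr_ge0 ?sqr_ge0// invr_ge0 -[4%N]/(2 * 2)%N exprM sqr_ge0.
have m0 : 0 <= m%:R :> R by [].
have : turning m <= x by lra_from xuv su.
have t4 : 0 < 2 * m%:R + 4 :> R by lra_from m0.
by rewrite /turning ler_pdivrMr// => h; lra_from h.
Qed.

(** The energy first decreases and then increases, so it is at most its larger end value, kappa F(a)
    or kappa F(b), and both are at most kappa F(M). As it dominates kappa F(w), no value of w
    exceeds M. *)
Lemma energy_bound (kappa q M a b C : R) (m : nat) (w y : R -> R) :
  2 < q -> q < 4 -> 1 < M -> 0 < kappa -> 2 <= pot q M M ->
  profile (nlin q M) kappa m a w y -> 0 < C -> regular w y b C -> 0 < a < 1 -> 0 < b <= M ->
  (forall x, 0 <= x < 1 -> 0 < w x) -> forall x, 0 <= x < 1 -> w x <= M.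
Proof.
move=> q2 q4 M1 k0 pM pr C0 reg a01 /andP[b0 bM] wpos x x01.
have M0 : 0 < M by lra_from M1.
have FM : 0 < prim q M M by exact: prim_gt0.
have /andP[s0 s1] := turning_bounds m.
have Fle u : 0 < u <= M -> prim q M u <= prim q M M.
  move=> /andP[u0 uM]; case: (leP u 1) => u1.
    by apply: ltW; apply: lt_trans FM; apply: prim_lt0 => //; rewrite u0.
  exact: prim_mono (ltW u1) uM.
rewrite leNgt; apply/negP => Mw.
have Fw : prim q M M < prim q M (w x) by apply: prim_smono => //; exact: ltW.
have eF : kappa * prim q M (w x) <= energy kappa q M w y x.
  rewrite /energy lerDr; have /andP[x0 x1] := x01.
  have x1' : 0 <= 1 - x by rewrite subr_ge0 ltW.
  exact: (divr_ge0 (mulr_ge0 x0 (sqr_ge0 _)) (mulr_ge0 (ler0n _ 2) (exprn_ge0 3 x1'))).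
have : energy kappa q M w y x <= kappa * prim q M M.
  case: (leP x (turning m)) => xs.
    have := energy_nonincr q2 M1 pr wpos (x := x); case/andP: (x01) => -> _; rewrite xs => /(_ isT) /le_trans; apply.
    by rewrite ler_pM2l// Fle//; lra_from a01 M1.
  have x1 : x <= 1 by lra_from x01.
  have := energy_nondecr q2 M1 pr C0 reg b0 wpos (ltW xs) x1 (lexx 1).
  rewrite ext1 ext_lt; last by case/andP: x01.
  by move=> /le_trans; apply; rewrite ler_pM2l// Fle// b0.
move=> /(le_trans eF); rewrite ler_pM2l// leNgt => /negP; exact.
Qed.

(* If b > M, then w >= b / 2 on a layer of width comparable to 1 / (C3 Th) at x = 1, across which
   the Pohozaev functional decreases by more than it can increase on the rest of [xs, 1]. *)
Lemma apriori_end (kappa q M a b C C1 C3 Th c c4 al xs : R) (m : nat) (w y : R -> R) :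
  xs = turning m -> C3 = kappa / xs ^+ m.+1 -> Th = M `^ (q - 2) -> c = 4 / q - 1 ->
  c4 = xs `^ (al - 1) / 2 ->
  (0 < m)%N -> al = (4 * m%:R + 2) / 3 -> 2 < q -> q < 4 -> 1 < M -> 0 < kappa ->
  profile (nlin q M) kappa m a w y -> 0 < C -> regular w y b C -> 0 < a < 1 -> 0 < b ->
  (forall x, 0 <= x < 1 -> 0 < w x) -> 0 <= C1 ->
  (forall u, 0 <= u -> - C1 <= u ^+ 2 * (c * pot q M u - 1)) ->
  8 <= c * Th -> 1 <= C3 * (1 - xs) * Th -> 256 * C3 ^+ 2 * C1 * Th < c4 * c * M ^+ 2 ->
  b <= M.
Proof.
move=> xsE C3E ThE cE c4E m0 alE q2 q4 M1 k0 pr C0 reg a01 b0 wpos C10 HC1 H1 H2 H3.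
rewrite leNgt; apply/negP => Mb.
have /andP[s0 s1] := turning_bounds m; rewrite -xsE in s0 s1.
have c0 : 0 < c by rewrite cE subr_gt0 ltr_pdivlMr ?mul1r//; lra_from q2.
have c1 : c < 1 by rewrite cE ltrBlDr ltr_pdivrMr; lra_from q2.
have Th0 : 0 < Th by rewrite ThE powR_gt0//; lra_from M1.
have sm : 0 < xs ^+ m.+1 by rewrite exprn_gt0.
have C30 : 0 < C3 by rewrite C3E divr_gt0.
have m1 : 1 <= m%:R :> R by rewrite ler1n.
have al1 : 0 <= al - 1 by rewrite alE subr_ge0 ler_pdivlMr; lra_from m1.
have potb : pot q M b = Th by rewrite ThE pot_geM// ltW.
have potle u : pot q M u <= Th by rewrite ThE; exact: pot_leM.
(* Halving the argument costs the factor 2^(2-q) >= 1/4, because q < 4. *)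
have pot2 : Th / 4 <= pot q M (b / 2).
  have h1 : M / 2 <= b / 2 by lra_from Mb.
  apply: le_trans (pot_mono q2 M1 h1); rewrite pot_id//; last by lra_from M1.
  rewrite ThE powRM ?invr_ge0//; last by lra_from M1.
  rewrite ler_pM2l ?powR_gt0//; last by lra_from M1.
  rewrite -[2^-1]powR_inv1// -powRrM mulN1r.
  have -> : 4^-1 = 2 `^ (- 2%:R) :> R by rewrite powR_invn// expr2 -natrM.
  by rewrite ler_powR//; lra_from q4.
have big u : b / 2 <= u -> c * Th / 8 <= c * pot q M u - 1.
  move=> ub; have := pot_mono q2 M1 ub => h.
  have : c * (Th / 4) <= c * pot q M u by rewrite ler_pM2l// (le_trans pot2).
  by move=> h2; lra_from h2 H1.
have Fbig u : b / 2 <= u -> 0 < prim q M u.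
  move=> ub; apply: prim_gt0 => //; first by lra_from ub b0.
  have : 2 <= c * pot q M u by have := big u ub => h; lra_from h H1.
  move=> h; have := pot_ge0 q M u => h2; clear -h h2 c0 c1; nra.
have Fb : 0 < prim q M b by apply: Fbig; lra_from b0.
set E := energy kappa q M w y.
pose ee := ext E (kappa * prim q M b).
have ees : ee xs <= 0.
  rewrite /ee ext_lt//.
  have := energy_nonincr q2 M1 pr wpos (x := xs); rewrite -xsE lexx ltW// => /(_ isT) /le_trans; apply.
  by rewrite pmulr_rle0// ltW// prim_lt0//; lra_from a01.
have ee1 : 0 < ee 1 by rewrite /ee ext1 mulr_gt0.
have eec x : xs <= x <= 1 -> {for x, continuous ee}.
  move=> /andP[xx]; rewrite le_eqVlt => /predU1P[->|x1]; first exact: (@energy_end kappa q M b C w y q2 M1 C0 reg b0).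
  apply: ext_continuous => //; apply: (energy_continuous q2 M1 pr x1).
  by apply: wpos; lra_from xx x1 s0.
(* The energy is at most 0 at xs, since F(a) < 0, and positive at 1. Beyond its last zero x1 the
   profile turns out to increase up to b. *)
have [x1 [/andP[sx1 x11] eex1 eepos]] := last_zero (ltW s1) eec ees ee1.
have x10 : 0 < x1 by exact: lt_le_trans sx1.
have ee0 x : x1 <= x < 1 -> 0 <= E x.
  move=> /andP[xx xl]; move: xx; rewrite le_eqVlt => /predU1P[<-|xx].
    by move: eex1; rewrite /ee ext_lt// => ->.
  by apply: ltW; have := eepos x; rewrite xx (ltW xl) /ee ext_lt// => /(_ isT).
have rng x : x1 <= x < 1 -> 0 <= x < 1 by move=> xx; lra_from xx x10.
pose V x := x ^+ m.+1 * y x.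
have VD (x : R) : 0 <= x < 1 -> is_derive x (1 : R) V (- (kappa * x ^+ m * (1 - x) * nlin q M (w x))).
  by move=> x01; exact: (profile_flux pr x01).
have Vend x : 0 <= x < 1 -> `|V x| <= C * (1 - x).
  move=> x01; have /andP[xp xl] := x01; have [_ hy] := reg x x01.
  rewrite /V normrM; apply: (@le_trans _ _ (1 * (C * (1 - x) ^+ 2))).
    by apply: ler_pM => //; rewrite ger0_norm ?exprn_ge0// exprn_ile1// ltW.
  rewrite mul1r ler_pM2l// expr2 ler_piMr//; first by rewrite subr_ge0 ltW.
  by rewrite gerBl.
have Vdec u v : 0 <= u -> u < v -> v < 1 -> (forall x, u < x < v -> 1 < w x) -> V v < V u.
  move=> u0 uv v1 w1.
  have sub x : u <= x <= v -> 0 <= x < 1 by move=> xx; lra_from xx u0 v1.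
  have [z zz Ez] := MVT_cc uv (fun x xx => is_derive_cvg (VD x (sub x xx))) (fun x xx => VD x (sub x (ltac:(lra_from xx)))).
  rewrite -subr_lt0 Ez pmulr_llt0 ?subr_gt0// oppr_lt0 mulr_gt0 ?nlin_gt0 ?w1//.
  by rewrite !mulr_gt0 ?exprn_gt0//; lra_from zz u0 v1.
have b1 : 1 < b by lra_from Mb M1.
(* As w tends to b > 1, it exceeds 1 near the end; there the flux strictly decreases towards 0, so
   it is positive. *)
have [X1 [X1x X11 wX1]] : exists X1, [/\ x1 <= X1, X1 < 1 & forall x, X1 <= x < 1 -> 1 < w x].
  have p : 0 < (b - 1) / (2 * C) by rewrite divr_gt0 ?subr_gt0 ?mulr_gt0.
  have p2 : 0 < 1 - x1 by rewrite subr_gt0.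
  have [h [h0 hp h1 _]] := pos_below3 p p2 ltr01.
  exists (1 - h); split; [lra_from h1|lra_from h0|move=> x xh].
  have x01 : 0 <= x < 1 by lra_from xh h1 x10.
  have [hw _] := reg x x01.
  have : C * (1 - x) <= (b - 1) / 2.
    apply: (@le_trans _ _ (C * h)); first by rewrite ler_pM2l//; lra_from xh.
    by move: hp; rewrite ler_pdivlMr ?mulr_gt0// => hp; lra_from hp.
  by move: hw; rewrite ler_norml => hw h2; lra_from hw h2 b1.
have Vpos_end x : X1 <= x < 1 -> 0 < V x.
  move=> xX; have x0 : 0 <= x by lra_from xX X1x x10.
  have Vge z : X1 <= z < 1 -> 0 <= V z.
    move=> zX; have z0 : 0 <= z by lra_from zX X1x x10.
    rewrite -lerN2 oppr0; apply: (end_limit (C := C) (x0 := z) _ (ltW C0)); first by case/andP: zX.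
    move=> t tz; have := Vend t (ltac:(lra_from tz z0)); rewrite ler_norml => /andP[h _].
    have : V t < V z.
      apply: Vdec => //; [by case/andP: tz|by case/andP: tz|].
      by move=> s st; apply: wX1; lra_from st tz zX.
    by move=> h2; lra_from h h2.
  pose z := (x + 1) / 2; have zx : x < z < 1 by rewrite /z; lra_from xX.
  have : V z < V x.
    by apply: Vdec => // [||s st]; [lra_from zx|lra_from zx|apply: wX1; lra_from st zx xX].
  by apply: le_lt_trans; apply: Vge; lra_from zx xX.
have ypos x : x1 <= x < 1 -> 0 < y x.
  move=> xx; have xm t : x1 <= t -> 0 < t ^+ m.+1 by move=> xt; rewrite exprn_gt0//; exact: lt_le_trans xt.
  have yend t : X1 <= t < 1 -> 0 < y t.
    move=> tX; have := Vpos_end t tX; rewrite /V pmulr_rgt0//; apply: xm; lra_from tX X1x.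
  rewrite ltNge; apply/negP => yx.
  have xX : x <= X1.
    by rewrite leNgt; apply/negP => Xx; have := yend x (ltac:(lra_from Xx xx)); rewrite ltNge yx.
  have yc t : x <= t <= X1 -> {for t, continuous y}.
    by move=> tx; apply: (profile_slope_cont pr); lra_from tx X11.
  (* At the last zero of y the energy equals kappa F(w) >= 0, so w > 1 there and afterwards; the
     flux would then decrease from 0, against y > 0. *)
  have [x3 [/andP[xx3 x3X] yx3 ygt]] := last_zero xX yc yx (yend X1 (ltac:(by rewrite lexx))).
  have ygt' t : x3 < t < 1 -> 0 < y t.
    move=> tx; case: (leP t X1) => tX; first by apply: ygt; lra_from tx tX.
    by apply: yend; lra_from tx tX.
  have x31 : x3 < 1 by exact: lt_trans X11.
  have x3r : x1 <= x3 < 1 by lra_from xx3 xx x31.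
  have := ee0 x3 x3r; rewrite /E /energy yx3 expr0n /= mulr0 mul0r add0r pmulr_rge0// => Fx3.
  have w3 : 1 < w x3.
    by apply: (prim_ge0_gt1 q2 M1 _ Fx3); apply: wpos; exact: rng.
  have winc t : x3 <= t < 1 -> 1 < w t.
    move=> /andP[x3t t1]; apply: (lt_le_trans w3).
    have sub s : x3 <= s <= t -> s < 1 by move=> st; lra_from st t1.
    apply: (nondecr_cc x3t (fun s st => profile_cont pr (sub s st)) (fun s st => profile_derive pr (sub s (ltac:(lra_from st))))).
    by move=> s st; rewrite divr_ge0 ?sqr_ge0// ltW// ygt'//; lra_from st t1.
  pose t := (x3 + 1) / 2; have tx : x3 < t < 1 by rewrite /t; lra_from x31.
  have : V t < V x3.
    apply: Vdec; [lra_from x3r x10|lra_from tx|lra_from tx|move=> s st; apply: winc; lra_from st tx].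
  rewrite /V yx3 mulr0 pmulr_rlt0; first by rewrite ltNge ltW// ygt'.
  by apply: xm; lra_from x3r tx.
have wle x : x1 <= x < 1 -> w x <= b.
  move=> xx; rewrite -subr_le0; apply: (end_limit (C := C) (x0 := x) _ (ltW C0)); first by case/andP: xx.
  move=> t tx; have := (reg t (ltac:(lra_from tx xx x10))).1; rewrite ler_norml => /andP[_ h].
  have sub s : x <= s <= t -> s < 1 by move=> st; lra_from st tx.
  have : w x <= w t.
    apply: (nondecr_cc (ltac:(lra_from tx) : x <= t) (fun s st => profile_cont pr (sub s st)) (fun s st => profile_derive pr (sub s (ltac:(lra_from st))))).
    by move=> s st; rewrite divr_ge0 ?sqr_ge0// ltW// ypos//; lra_from st tx xx.
  by move=> h2; lra_from h h2.
(* Since w <= b, the nonlinearity is at most b Th; integrating the flux equation back from 1 yields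
   two factors 1 - x, and x^(m+1) >= xs^(m+1). *)
have yup x : x1 <= x < 1 -> y x <= C3 * (b * Th) * (1 - x) ^+ 2.
  move=> xx; have x0 : 0 < x by lra_from xx x10.
  have : V x <= kappa * (b * Th) * (1 - x) ^+ 2.
    apply: (end_limit (C := C) (x0 := x) _ (ltW C0)); first by case/andP: xx.
    move=> t tx; have := Vend t (ltac:(lra_from tx xx x10)); rewrite ler_norml => /andP[_ h].
    have sub s : x <= s <= t -> 0 <= s < 1 by move=> st; lra_from st tx x0.
    have [z zz Ez] := MVT_cc (ltac:(lra_from tx) : x < t) (fun s st => is_derive_cvg (VD s (sub s st))) (fun s st => VD s (sub s (ltac:(lra_from st)))).
    have z01 : 0 <= z <= 1 by lra_from zz x0 tx.
    have zx1 : x1 <= z < 1 by lra_from zz xx tx.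
    have wz := wpos z (rng z zx1); have wzb := wle z zx1.
    have fz : nlin q M (w z) <= b * Th.
      rewrite /nlin; have := potle (w z); have := pot_ge0 q M (w z) => p0 p1.
      apply: (@le_trans _ _ (w z * pot q M (w z))); first by rewrite ler_pM2l// gerBl.
      by apply: ler_pM => //; exact: ltW.
    have bT : 0 <= b * Th by rewrite mulr_ge0 ?ltW.
    have zm : 0 <= z ^+ m <= 1 by have /andP[z0 z1] := z01; rewrite exprn_ge0//= exprn_ile1.
    have : V x - V t <= kappa * (b * Th) * (1 - x) ^+ 2.
      rewrite -opprB Ez mulNr opprK.
      rewrite [leLHS](_ : _ = kappa * ((z ^+ m * ((1 - z) * (t - x))) * nlin q M (w z))); last by ring.
      rewrite [leRHS](_ : _ = kappa * ((1 * ((1 - x) * (1 - x))) * (b * Th))); last by ring.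
      rewrite ler_pM2l//.
      have p1 : 0 <= (1 - z) * (t - x) by apply: mulr_ge0; lra_from z01 tx.
      have p2 : 0 <= z ^+ m * ((1 - z) * (t - x)) by apply: mulr_ge0 => //; case/andP: zm.
      apply: (@le_trans _ _ (z ^+ m * ((1 - z) * (t - x)) * (b * Th))); first exact: ler_wpM2l.
      apply: ler_wpM2r => //; apply: ler_pM => //; [by case/andP: zm|by case/andP: zm|].
      by apply: ler_pM; lra_from z01 tx zz xx.
    by move=> h2; lra_from h h2.
  have Xm : xs ^+ m.+1 <= x ^+ m.+1.
    by apply: lerXn2r; rewrite ?nnegrE; lra_from xx sx1 s0.
  move=> h; have : xs ^+ m.+1 * y x <= kappa * (b * Th) * (1 - x) ^+ 2.
    by apply: le_trans h; rewrite /V ler_wpM2r// ltW// ypos.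
  by rewrite mulrC -ler_pdivlMr// C3E => h2; lra_from h2.
have wlow x : x1 <= x < 1 -> b - C3 * (b * Th) * (1 - x) <= w x.
  move=> xx; apply: (end_limit (C := C) (x0 := x) _ (ltW C0)); first by case/andP: xx.
  move=> t tx; have := (reg t (ltac:(lra_from tx xx x10))).1; rewrite ler_norml => /andP[h _].
  have sub s : x <= s <= t -> s < 1 by move=> st; lra_from st tx.
  have [z zz Ez] := MVT_cc (ltac:(lra_from tx) : x < t) (fun s st => profile_cont pr (sub s st)) (fun s st => profile_derive pr (sub s (ltac:(lra_from st)))).
  have z1 : 0 < (1 - z) ^+ 2 by rewrite exprn_gt0//; lra_from zz tx.
  have hy := yup z (ltac:(lra_from zz xx tx)).
  have : w t - w x <= C3 * (b * Th) * (1 - x).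
    rewrite Ez; apply: ler_pM; [by rewrite divr_ge0 ?(ltW z1)// ltW// ypos//; lra_from zz xx tx|lra_from tx|by rewrite ler_pdivrMr|lra_from tx].
  by move=> h2; lra_from h h2.
(* The width of the layer: over it [wlow] loses at most C3 b Th h = b / 2. *)
have [h hE0] : exists h, h = (2 * C3 * Th)^-1 by exists (2 * C3 * Th)^-1.
have hp : 0 < 2 * C3 * Th by rewrite !mulr_gt0.
have h0 : 0 < h by rewrite hE0 invr_gt0.
have hE : C3 * Th * h = 2^-1 by rewrite hE0; field; rewrite !gt_eqF.
have half x : x1 <= x < 1 -> 1 - h <= x -> b / 2 <= w x.
  move=> xx xh; apply: le_trans (wlow x xx).
  have : C3 * Th * (1 - x) <= 2^-1 by rewrite -hE ler_pM2l ?mulr_gt0//; lra_from xh.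
  move=> h2; have : b * (C3 * Th * (1 - x)) <= b * 2^-1 by rewrite ler_pM2l.
  by move=> h3; lra_from h3.
have hs : h <= (1 - xs) / 2.
  by rewrite -(ler_pM2l hp) hE0 mulfV ?gt_eqF//; lra_from H2.
pose xb := 1 - h.
(* The layer lies in [x1, 1]: otherwise w >= b / 2 at x1, so F(w) > 0 there, while the energy
   vanishes. *)
have x1b : x1 <= xb.
  rewrite leNgt; apply/negP => xbx.
  have x1r : x1 <= x1 < 1 by rewrite lexx.
  have := Fbig _ (half x1 x1r (ltW xbx)) => Fp.
  move: eex1; rewrite /ee ext_lt// /E /energy => e0.
  have k1 : 0 < kappa * prim q M (w x1) by rewrite mulr_gt0.
  have k2 : 0 <= x1 * y x1 ^+ 2 / (2 * (1 - x1) ^+ 3).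
    have x1' : 0 <= 1 - x1 by rewrite subr_ge0 ltW.
    exact: (divr_ge0 (mulr_ge0 (ltW x10) (sqr_ge0 _)) (mulr_ge0 (ler0n _ 2) (exprn_ge0 3 x1'))).
  by lra_from e0 k1 k2.
have xb1 : xb < 1 by rewrite /xb; lra_from h0.
pose l x : R := ((2 * m%:R + 4) * x - (2 * m%:R + 1)) / 3.
have m4 : 0 < 2 * m%:R + 4 :> R by lra_from m1.
have lE x : l x = (2 * m%:R + 4) * (x - xs) / 3.
  by rewrite /l xsE /turning; field; rewrite gt_eqF.
have l0 x : xs <= x -> 0 <= l x.
  by move=> xx; rewrite lE divr_ge0// mulr_ge0 ?subr_ge0// ltW.
have l1 x : x <= 1 -> l x <= 1.
  by move=> xx; rewrite /l ler_pdivrMr// mul1r; clear -xx m1; nra.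
have lb x : xb <= x -> 2^-1 <= l x.
  move=> xx; rewrite lE ler_pdivlMr//.
  have e1 : (2 * m%:R + 4) * (1 - xs) = 3 by rewrite xsE /turning; field; rewrite gt_eqF.
  have : (2 * m%:R + 4) * ((1 - xs) / 2) <= (2 * m%:R + 4) * (x - xs).
    by rewrite ler_pM2l//; move: xx; rewrite /xb => xx; lra_from xx hs.
  by move=> h2; lra_from h2 e1.
pose Q x := pohozaev kappa q M al m w y x.
(* The Pohozaev functional written with the extensions of w, y and the energy: it is continuous up
   to 1, where it vanishes. *)
pose QQ x := x `^ al * ((1 - x) ^+ 2 * ee x - l x * (ext w b x * ext y 0 x) / 2).
pose om x := (1 - x) * x `^ (al - 1) * l x.
have Zpos x : 0 < x -> 0 < x `^ (al - 1) by move=> xx; exact: powR_gt0.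
pose dQ x := - (kappa / 2 * (om x * (4 * prim q M (w x) - w x * nlin q M (w x)))
      + x `^ (al - 1) * ((m%:R + 1) * x + (2 * m%:R + 1) * (1 - m%:R) / 9 * (1 - x)) * (w x * y x) / 2).
have QD (x : R) : x1 <= x < 1 -> is_derive x (1 : R) QQ (dQ x).
  move=> xx; have x01 : 0 < x < 1 by lra_from xx x10.
  have xl : 0 < 1 - x by lra_from x01.
  refine (is_derive1_near xl _ (is_derive_pohozaev alE q2 M1 pr x01 (wpos x (rng x xx)))).
  move=> t; rewrite ltr_norml => tx; have t1 : t < 1 by lra_from tx.
  by rewrite /QQ /ee !ext_lt.
have QQ1 : QQ 1 = 0 by rewrite /QQ subrr expr0n /= mul0r !ext1 !mulr0 mul0r subrr mulr0.
have QQc x : x1 <= x <= 1 -> {for x, continuous QQ}.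
  move=> xx; have x0 : 0 < x by lra_from xx x10.
  have cw : {for x, continuous (ext w b)}.
    move: xx => /andP[xx]; rewrite le_eqVlt => /predU1P[->|xl].
      by apply: (ext_continuous1 C0) => t t01; have [] := reg t t01.
    by apply: ext_continuous => //; exact: (profile_cont pr xl).
  have cy : {for x, continuous (ext y 0)}.
    move: xx => /andP[xx]; rewrite le_eqVlt => /predU1P[->|xl].
      apply: (ext_continuous1 C0) => t t01; have [_] := reg t t01; rewrite subr0 => /le_trans; apply.
      rewrite ler_pM2l// expr2 ler_piMr//; first by lra_from t01.
      by rewrite gerBl; case/andP: t01.
    by apply: ext_continuous => //; exact: (profile_slope_cont pr xl).
  have ce : {for x, continuous ee} by apply: eec; lra_from xx sx1.
  have c2 : {for x, continuous (fun x : R => (1 - x) ^+ 2)}.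
    exact: (is_derive_cvg (is_derive1X 2 (is_derive1B (is_derive1_cst 1 x) (is_derive1_id x)))).
  have cl : {for x, continuous l}.
    exact: (is_derive_cvg (is_derive1M (is_derive1B (is_derive1M (is_derive1_cst (2 * m%:R + 4) x) (is_derive1_id x))
      (is_derive1_cst (2 * m%:R + 1) x)) (is_derive1_cst 3^-1 x))).
  have cp := is_derive_cvg (is_derive1_powR al x0).
  exact: (continuous1M cp (continuous1B (continuous1M c2 ce)
    (continuous1M (continuous1M cl (continuous1M cw cy)) (is_derive_cvg (is_derive1_cst 2^-1 x))))).
have cross x : x1 <= x < 1 -> 0 <= x `^ (al - 1) * ((m%:R + 1) * x + (2 * m%:R + 1) * (1 - m%:R) / 9 * (1 - x)) * (w x * y x) / 2.
  move=> xx; have x0 : 0 < x by lra_from xx x10.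
  have p1 : 0 <= w x * y x by rewrite mulr_ge0// ltW ?ypos ?wpos ?rng.
  have p2 : 0 <= (m%:R + 1) * x + (2 * m%:R + 1) * (1 - m%:R) / 9 * (1 - x).
    have : 0 <= (2 * m%:R + 4) * (x - xs) by rewrite mulr_ge0 ?(ltW m4)// subr_ge0; lra_from xx sx1.
    have e1 : (2 * m%:R + 4) * xs = 2 * m%:R + 1 by rewrite xsE /turning; field; rewrite gt_eqF.
    rewrite mulrBr e1 => h2.
    have x1' : 0 <= 1 - x by lra_from xx.
    by clear -h2 m1 x0 x1'; nra.
  by rewrite divr_ge0// mulr_ge0// mulr_ge0// ltW// Zpos.
have om0 x : x1 <= x < 1 -> 0 <= om x <= 1.
  move=> xx; have x0 : 0 < x by lra_from xx x10.
  have Z1 : x `^ (al - 1) <= 1.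
    have xx1 : 0 < x <= 1 by lra_from xx x0.
    by rewrite -[leRHS](powRr0 x); exact: (ger_powR xx1 al1).
  have p0 : 0 <= 1 - x <= 1 by lra_from xx x0.
  have pl : 0 <= l x <= 1 by rewrite l0 ?l1//; lra_from xx sx1.
  have pZ := Zpos x x0.
  have p2 : 0 <= (1 - x) * x `^ (al - 1) <= 1.
    have /andP[a0 a1] := p0; rewrite mulr_ge0 ?(ltW pZ)//=.
    by rewrite -[leRHS]mul1r ler_pM// ltW.
  have /andP[a0 a1] := p2; have /andP[a2 a3] := pl; rewrite /om mulr_ge0//=.
  by rewrite -[leRHS]mul1r ler_pM.
have dens x : x1 <= x < 1 -> (w x) ^+ 2 * (c * pot q M (w x) - 1) <= 4 * prim q M (w x) - w x * nlin q M (w x).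
  by move=> xx; rewrite cE; apply: pohozaev_density => //; apply: ltW; apply: wpos; exact: rng.
have k2 : 0 < kappa / 2 by lra_from k0.
have dQ1 x : x1 <= x < 1 -> dQ x <= kappa / 2 * C1.
  move=> xx; have h1 := cross x xx; have h2 := dens x xx.
  have h3 := HC1 (w x) (ltW (wpos x (rng x xx))); have /andP[u0 u1] := om0 x xx.
  have h4 : - C1 <= 4 * prim q M (w x) - w x * nlin q M (w x) by exact: le_trans h2.
  have h5 : - C1 <= om x * (4 * prim q M (w x) - w x * nlin q M (w x)).
    apply: (@le_trans _ _ (om x * (- C1))); last by rewrite ler_wpM2l.
    by rewrite mulrN lerN2 ler_piMl.
  have h6 : kappa / 2 * (- C1) <= kappa / 2 * (om x * (4 * prim q M (w x) - w x * nlin q M (w x))).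
    by rewrite ler_pM2l.
  by rewrite /dQ; lra_from h1 h6.
(* On the layer om >= c4 (1 - x), w^2 >= b^2 / 4 and c pot w - 1 >= c Th / 8; K collects these
   factors. *)
pose K := kappa / 2 * (c4 * (b ^+ 2 / 4 * (c * Th / 8))).
have c40 : 0 < c4 by rewrite c4E divr_gt0// powR_gt0.
have dQ2 x : xb <= x < 1 -> dQ x <= - K * (1 - x).
  move=> xb'; have xx : x1 <= x < 1 by lra_from xb' x1b.
  have h1 := cross x xx; have h2 := dens x xx.
  have wb := half x xx (ltac:(by move: xb' => /andP[])).
  have h3 := big _ wb.
  have x1' : 0 <= 1 - x by lra_from xx.
  have cT : 0 <= c * Th / 8 by rewrite divr_ge0// mulr_ge0// ltW.
  have h4 : b ^+ 2 / 4 * (c * Th / 8) <= 4 * prim q M (w x) - w x * nlin q M (w x).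
    apply: le_trans h2; apply: ler_pM => //; first by rewrite divr_ge0// sqr_ge0.
    have -> : b ^+ 2 / 4 = (b / 2) ^+ 2 by field.
    by rewrite lerXn2r// nnegrE; lra_from b0 wb.
  have h5 : c4 * (1 - x) <= om x.
    rewrite /om c4E mulrC -mulrA; apply: ler_wpM2l => //.
    apply: ler_pM => //; [exact: powR_ge0|apply: ge0_ler_powR => //; rewrite ?nnegrE; lra_from xx sx1 s0|].
    by apply: lb; case/andP: xb'.
  have b2 : 0 <= b ^+ 2 / 4 * (c * Th / 8) by rewrite mulr_ge0// divr_ge0// sqr_ge0.
  have h6 : c4 * (1 - x) * (b ^+ 2 / 4 * (c * Th / 8)) <= om x * (4 * prim q M (w x) - w x * nlin q M (w x)).
    by apply: ler_pM => //; rewrite mulr_ge0// ltW.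
  have h7 : kappa / 2 * (c4 * (1 - x) * (b ^+ 2 / 4 * (c * Th / 8))) <= kappa / 2 * (om x * (4 * prim q M (w x) - w x * nlin q M (w x))).
    by rewrite ler_pM2l.
  by rewrite /dQ /K; lra_from h1 h7.
have C1k : 0 <= kappa / 2 * C1 by rewrite mulr_ge0// ltW.
have Qx1 : QQ x1 <= 0.
  rewrite /QQ eex1 mulr0 sub0r !ext_lt// mulrN oppr_le0 mulr_ge0 ?powR_ge0// divr_ge0//.
  have x1r : x1 <= x1 < 1 by rewrite lexx.
  by rewrite mulr_ge0 ?l0// mulr_ge0// ltW ?ypos ?wpos ?rng.
have Qxb : QQ xb <= kappa / 2 * C1.
  move: x1b; rewrite le_eqVlt => /predU1P[<-|x1b']; first exact: le_trans C1k.
  have [z zz Ez] := MVT_cc x1b' (fun t tt => QQc t (ltac:(lra_from tt xb1))) (fun t tt => QD t (ltac:(lra_from tt xb1))).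
  have hz := dQ1 z (ltac:(lra_from zz xb1)).
  have : dQ z * (xb - x1) <= kappa / 2 * C1 * 1.
    apply: (@le_trans _ _ (kappa / 2 * C1 * (xb - x1))); first by rewrite ler_wpM2r//; lra_from x1b'.
    by rewrite ler_wpM2l//; lra_from x1b' xb1 x10.
  by rewrite -Ez; move=> h2; lra_from h2 Qx1.
have : QQ 1 - K * (1 - 1) ^+ 2 / 2 <= QQ xb - K * (1 - xb) ^+ 2 / 2.
  have GD (x : R) : xb < x < 1 -> is_derive x (1 : R) (fun x => QQ x - K * (1 - x) ^+ 2 / 2) (dQ x + K * (1 - x)).
    move=> xx; have hq := QD x (ltac:(lra_from xx x1b)).
    apply: (is_derive_eq (is_derive1B hq (is_derive1M (is_derive1M (is_derive1_cst K x) (is_derive1X 2 (is_derive1B (is_derive1_cst 1 x) (is_derive1_id x)))) (is_derive1_cst 2^-1 x)))).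
    by rewrite expr1; field.
  have GC (x : R) : xb <= x <= 1 -> {for x, continuous (fun x => QQ x - K * (1 - x) ^+ 2 / 2)}.
    move=> xx; apply: (continuous1B (QQc x (ltac:(lra_from xx x1b)))).
    exact: (is_derive_cvg (is_derive1M (is_derive1M (is_derive1_cst K x) (is_derive1X 2 (is_derive1B (is_derive1_cst 1 x) (is_derive1_id x)))) (is_derive1_cst 2^-1 x))).
  apply: (nonincr_cc (ltW xb1) GC GD) => x xx.
  have := dQ2 x (ltac:(lra_from xx)) => h2; lra_from h2.
rewrite QQ1 subrr expr0n /= mulr0 mul0r subr0 /xb (_ : 1 - (1 - h) = h); last by ring.
move=> fin.
have K1 : K * h ^+ 2 / 2 <= kappa / 2 * C1 by lra_from fin Qxb.
(* The constant is 256 = 4 * 8 * 4 * 2: from b^2 / 4, from c Th / 8, from h^2 = (2 C3 Th)^-2, and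
   from integrating 1 - x over the layer. *)
have e2 : K * h ^+ 2 / 2 = kappa / 2 * ((c4 * c * b ^+ 2) / (256 * C3 ^+ 2 * Th)).
  by rewrite /K hE0; field; rewrite !gt_eqF.
have p256 : 0 < 256 * C3 ^+ 2 * Th.
  have C32 := exprn_gt0 2 C30; clear -C32 Th0; apply: mulr_gt0 Th0; exact: mulr_gt0 (ltr0Sn _ _) C32.
move: K1; rewrite e2 (ler_pM2l k2) (ler_pdivrMr _ _ p256).
have bM : c4 * c * M ^+ 2 <= c4 * c * b ^+ 2.
  have M0 : 0 <= M by lra_from M1.
  have bb : 0 <= b by exact: ltW.
  by rewrite ler_pM2l ?mulr_gt0// lerXn2r// ltW.
by move=> h2; lra_from h2 bM H3.
Qed.

End AprioriBound2.

(** * Choice of the truncation level *)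

Section TruncationLevel.
Variable R : realType.

Lemma powR_unbounded (p A : R) : 0 < p -> exists2 M0, 1 < M0 & forall M, M0 <= M -> A < M `^ p.
Proof.
move=> p0; pose B := `|A| + 2.
have B1 : 1 < B by have := normr_ge0 A; rewrite /B => h; lra_from h.
have B0 : 0 <= B by lra_from B1.
have pV : 0 < p^-1 by rewrite invr_gt0.
exists (B `^ p^-1) => [|M BM].
  rewrite -[ltLHS](_ : 1 `^ p^-1 = 1 :> R); last by rewrite powR1.
  by apply: gt0_ltr_powR => //; rewrite nnegrE.
have : B <= M `^ p.
  rewrite -[leLHS](powRr1 B0) -[X in B `^ X](mulVf (lt0r_neq0 p0)) powRrM.
  apply: ge0_ler_powR; rewrite ?nnegrE ?powR_ge0// ?(ltW p0)//.
  exact: le_trans (powR_ge0 _ _) BM.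
by have := ler_norm A; rewrite /B => h1 h2; lra_from h1 h2.
Qed.

(** M depends on kappa, q and m only, so one level serves every starting value. The three conditions
    of [apriori_end] ask that M^(q-2), M^(q-2) and M^(4-q) be large, the last one because M^2 =
    M^(4-q) Th. *)
Lemma truncation_level (kappa q : R) (m : nat) : (0 < m)%N -> 2 < q -> q < 4 -> 0 < kappa ->
  exists2 M, 1 < M & forall a (w y : R -> R) b C, profile (nlin q M) kappa m a w y -> 0 < C ->
    regular w y b C -> 0 < a < 1 -> 0 < b -> (forall x, 0 <= x < 1 -> 0 < w x) ->
    b <= M /\ forall x, 0 <= x < 1 -> w x <= M.
Proof.
move=> m0 q2 q4 k0.
have /andP[s0 s1] := turning_bounds R m.
have [xs xsE] : exists xs : R, xs = turning R m by exists (turning R m).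
rewrite -xsE in s0 s1.
have [al alE] : exists al : R, al = (4 * m%:R + 2) / 3 by exists ((4 * m%:R + 2) / 3).
have [C3 C3E] : exists C3 : R, C3 = kappa / xs ^+ m.+1 by exists (kappa / xs ^+ m.+1).
have [c cE] : exists c : R, c = 4 / q - 1 by exists (4 / q - 1).
have [c4 c4E] : exists c4 : R, c4 = xs `^ (al - 1) / 2 by exists (xs `^ (al - 1) / 2).
have c0 : 0 < c by rewrite cE subr_gt0 ltr_pdivlMr ?mul1r//; lra_from q2.
have c1 : c < 1 by rewrite cE ltrBlDr ltr_pdivrMr; lra_from q2.
have C30 : 0 < C3 by rewrite C3E divr_gt0// exprn_gt0.
have c40 : 0 < c4 by rewrite c4E divr_gt0// powR_gt0.
have p1 : 0 < q - 2 by lra_from q2.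
have p2 : 0 < 4 - q by lra_from q4.
(* The value at which c w^(q-2) = 1. The density is negative only below it, so w2^2 serves as the
   constant C1 of [apriori_end]. *)
have [w2 w2E] : exists w2 : R, w2 = c^-1 `^ (q - 2)^-1 by exists (c^-1 `^ (q - 2)^-1).
have [M1 M11 M1H] := powR_unbounded (8 / c) p1.
have [M2 M21 M2H] := powR_unbounded ((C3 * (1 - xs))^-1) p1.
have [M3 M31 M3H] := powR_unbounded (256 * C3 ^+ 2 * w2 ^+ 2 / (c4 * c)) p2.
pose M := M1 + M2 + M3.
have Mg1 : M1 <= M by rewrite /M; lra_from M21 M31.
have Mg2 : M2 <= M by rewrite /M; lra_from M11 M31.
have Mg3 : M3 <= M by rewrite /M; lra_from M11 M21.
have M_1 : 1 < M by exact: lt_le_trans Mg1.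
have M0 : 0 < M by exact: lt_trans M_1.
have [Th ThE] : exists Th, Th = M `^ (q - 2) by exists (M `^ (q - 2)).
have Th0 : 0 < Th by rewrite ThE powR_gt0.
have H1 : 8 <= c * Th.
  by have := M1H M Mg1; rewrite -ThE ltr_pdivrMr// mulrC => /ltW.
have H2 : 1 <= C3 * (1 - xs) * Th.
  have p : 0 < C3 * (1 - xs) by rewrite mulr_gt0// subr_gt0.
  by have := M2H M Mg2; rewrite -ThE -(ltr_pM2l p) mulfV ?gt_eqF// => /ltW.
have H3 : 256 * C3 ^+ 2 * w2 ^+ 2 * Th < c4 * c * M ^+ 2.
  have := M3H M Mg3; rewrite ltr_pdivrMr ?mulr_gt0// => h.
  have -> : M ^+ 2 = M `^ (4 - q) * Th.
    rewrite ThE -powRD; last by apply/implyP => _; rewrite gt_eqF.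
    rewrite (_ : 4 - q + (q - 2) = 2%:R); last by ring.
    by rewrite powR_mulrn// ltW.
  by rewrite [ltRHS]mulrA (ltr_pM2r Th0) [ltRHS]mulrC.
have potM : 2 <= pot q M M.
  rewrite pot_geM// -ThE.
  have h : c * Th < 1 * Th by rewrite ltr_pM2r.
  by lra_from h H1.
have HC1 u : 0 <= u -> - w2 ^+ 2 <= u ^+ 2 * (c * pot q M u - 1).
  move=> u0; case: (leP 1 (c * pot q M u)) => pu.
    apply: (@le_trans _ _ 0); first by rewrite oppr_le0 sqr_ge0.
    by rewrite mulr_ge0 ?sqr_ge0// subr_ge0.
  have uM : u <= M.
    rewrite leNgt; apply/negP => Mu; move: pu; rewrite pot_geM ?ltW// -ThE => pu; lra_from pu H1.
  have uw : u <= w2.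
    have h : u `^ (q - 2) <= c^-1.
      move: pu; rewrite pot_id ?u0// => pu.
      by rewrite -(ler_pM2l c0) mulfV ?gt_eqF// ltW.
    have -> : u = (u `^ (q - 2)) `^ (q - 2)^-1.
      by rewrite -powRrM mulfV ?gt_eqF// powRr1.
    by rewrite w2E; apply: ge0_ler_powR; rewrite ?nnegrE ?powR_ge0 ?invr_ge0 ?(ltW p1) ?(ltW c0).
  have uw2 : u ^+ 2 <= w2 ^+ 2 by rewrite lerXn2r// nnegrE (le_trans u0).
  have cp : 0 <= c * pot q M u by rewrite mulr_ge0 ?pot_ge0// ltW.
  have u2 : 0 <= u ^+ 2 * (c * pot q M u) by rewrite mulr_ge0 ?sqr_ge0.
  by rewrite mulrBr mulr1; lra_from uw2 u2.
exists M => // a w y b C pr C0 reg a01 b0 wpos.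
have bM : b <= M.
  exact: (apriori_end xsE C3E ThE cE c4E m0 alE q2 q4 M_1 k0 pr C0 reg a01 b0 wpos (sqr_ge0 w2) HC1 H1 H2 H3).
split=> //; apply: (energy_bound q2 q4 M_1 k0 potM pr C0 reg a01 _ wpos).
by rewrite b0.
Qed.

End TruncationLevel.

(** * Smoothness up to the endpoints *)

Section EndpointRegularity.
Variable R : realType.

Lemma continuous1N (f : R -> R) (x : R) : {for x, continuous f} -> {for x, continuous (fun t => - f t)}.
Proof. by move=> cf; exact: cvgN. Qed.

Lemma at_right_of_cvg (g : R -> R) : {for 0, continuous g} -> g x @[x --> (0 : R)^'+] --> g 0.
Proof. by move=> cg; apply: cvg_at_right_filter. Qed.

Lemma quotient_limit (H h : R -> R) (k : nat) (l r : R) : 0 < r ->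
  (forall x : R, 0 < x < r -> is_derive x (1 : R) H (x ^+ k * h x)) ->
  H x @[x --> (0 : R)^'+] --> (0 : R) -> h x @[x --> (0 : R)^'+] --> l ->
  H x / x ^+ k.+1 @[x --> (0 : R)^'+] --> l / k.+1%:R.
Proof.
move=> r0 HD H0 hl.
have k0 : k.+1%:R != 0 :> R by rewrite pnatr_eq0.
have fdf x : x \in `]0, r[ -> is_derive x (1 : R) H (x ^+ k * h x).
  by rewrite in_itv/=; exact: HD.
have gdg x : x \in `]0, r[ -> is_derive x (1 : R) (fun t : R => t ^+ k.+1) (k.+1%:R * x ^+ k).
  move=> _; apply: (is_derive_eq (is_derive1X k.+1 (is_derive1_id x))).
  by rewrite /= mulr1.
have g0 : x ^+ k.+1 @[x --> (0 : R)^'+] --> (0 : R).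
  have e0 : (0 : R) ^+ k.+1 = 0 by rewrite expr0n.
  rewrite -[X in _ --> X]e0.
  exact: (at_right_of_cvg (is_derive_cvg (is_derive1X k.+1 (is_derive1_id (0 : R))))).
have dg0 x : x \in `]0, r[ -> k.+1%:R * x ^+ k != 0.
  by rewrite in_itv/= => /andP[x0 _]; rewrite mulf_neq0// expf_neq0// gt_eqF.
apply: (lhopital_at_right r0 fdf gdg H0 g0 dg0).
have c : h x / k.+1%:R @[x --> (0 : R)^'+] --> l / k.+1%:R by exact: cvgM hl (cvg_cst _).
apply: cvg_trans c; apply: near_eq_cvg; near=> x.
have x0 : x ^+ k != 0 by rewrite expf_neq0// gt_eqF.
by move: x0 (h x) => + hx; move: (x ^+ k) => X X0; field; rewrite X0 addrC natr1 k0.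
Unshelve. all: by end_near. Qed.

Lemma at_right_comp_sub (g : R -> R) : {for 1, continuous g} ->
  g (1 - x) @[x --> (0 : R)^'+] --> g 1.
Proof.
move=> cg; apply: cvg_at_right_filter.
have cg' : {for 1 - 0, continuous g} by rewrite subr0.
have := @continuous1_chain R g (fun t => 1 - t) 0 cg' (is_derive_cvg (is_derive1B (is_derive1_cst 1 0) (is_derive1_id (0 : R)))).
by move=> h; apply: cvg_trans h _; rewrite subr0.
Qed.

Lemma at_rightP (g : R -> R) (l : R) : g x @[x --> (0 : R)^'+] --> l ->
  forall e, 0 < e -> exists2 d, 0 < d & forall x, 0 < x < d -> `|g x - l| < e.
Proof.
move=> /cvgrPdist_lt gl e e0; have := gl e e0; rewrite near_withinE => /nbhs_ballP[r /= r0 rH].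
exists r => // x /andP[x0 xr]; rewrite distrC; apply: rH => //=.
by rewrite -ball_normE /= sub0r normrN gtr0_norm.
Qed.

Lemma at_right_reflect (f g : R -> R) : {for 1, continuous g} ->
  (forall s, 0 < s < 1 -> f s = g (1 - s)) -> f s @[s --> (0 : R)^'+] --> g 1.
Proof.
move=> cg fg; apply: cvg_trans (at_right_comp_sub cg); apply: near_eq_cvg; near=> s.
by rewrite fg//; apply/andP; split; near: s; [exact: nbhs_right_gt|exact: nbhs_right_lt].
Unshelve. all: by end_near. Qed.

Lemma ext_continuous_reflect (f : R -> R) (l : R) : f (1 - s) @[s --> (0 : R)^'+] --> l ->
  {for 1, continuous (ext f l)}.
Proof.
move=> fl; apply/continuous_atP => e e0; have [d d0 dH] := at_rightP fl e0.
exists d => // x; rewrite ltr_norml => xd; rewrite ext1 /ext.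
case: (ltP x 1) => x1; last by rewrite subrr normr0.
by have := dH (1 - x); rewrite subKr; apply; lra_from xd x1.
Qed.

Definition glue01 (l0 l1 : R) (r : R -> R) (x : R) : R :=
  if x <= 0 then l0 else if 1 <= x then l1 else r x.

Lemma glue01_continuous (l0 l1 : R) (r : R -> R) :
  (forall x : R, 0 < x < 1 -> {for x, continuous r}) ->
  r x @[x --> (0 : R)^'+] --> l0 -> r (1 - x) @[x --> (0 : R)^'+] --> l1 ->
  continuous (glue01 l0 l1 r).
Proof.
move=> rc r0 r1 x; pose G := glue01 l0 l1 r.
have Gr y : 0 < y < 1 -> G y = r y.
  by move=> /andP[y0 y1]; rewrite /G /glue01 leNgt y0 /= leNgt y1.
have G0 y : y <= 0 -> G y = l0 by rewrite /G /glue01 => ->.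
have G1 y : 1 <= y -> G y = l1.
  move=> y1; rewrite /G /glue01 ifF ?y1//; apply/negbTE; rewrite -ltNge; exact: lt_le_trans y1.
have h01 : 0 < 1 :> R by exact: ltr01.
case: (ltgtP x 0) => x0.
- apply: (@continuous_near R (fun=> l0) _ _ (- x)); first by lra_from x0.
    by move=> y; rewrite ltr_norml => yx; rewrite -/G G0//; lra_from yx.
  exact: (is_derive_cvg (is_derive1_cst _ _)).
- case: (ltgtP x 1) => x1.
  + have p1 : 0 < 1 - x by lra_from x1.
    have [h [h0 hx h1 _]] := pos_below3 x0 p1 h01.
    apply: (@continuous_near R r _ _ h h0); last by apply: rc; rewrite x0.
    by move=> y; rewrite ltr_norml => yx; rewrite -/G Gr//; lra_from yx hx h1.
  + apply: (@continuous_near R (fun=> l1) _ _ (x - 1)); first by lra_from x1.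
      by move=> y; rewrite ltr_norml => yx; rewrite -/G G1//; lra_from yx.
    exact: (is_derive_cvg (is_derive1_cst _ _)).
  + apply/continuous_atP => e e0; have [d d0 dH] := at_rightP r1 e0.
    have [h [h0 hd h1 _]] := pos_below3 d0 h01 h01.
    exists h => // y; rewrite ltr_norml x1 -/G => yx; rewrite (G1 1)//.
    case: (leP 1 y) => y1; first by rewrite G1// subrr normr0.
    rewrite Gr; last by lra_from yx h1 y1.
    have := dH (1 - y); rewrite subKr; apply; lra_from yx hd y1.
rewrite x0; apply/continuous_atP => e e0; have [d d0 dH] := at_rightP r0 e0.
have [h [hp hd h1 _]] := pos_below3 d0 (ltac:(by rewrite invr_gt0) : 0 < 2^-1 :> R) h01.
exists h => // y; rewrite ltr_norml -/G => yx; rewrite (G0 0)//.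
case: (leP y 0) => y0; first by rewrite G0// subrr normr0.
rewrite Gr; last by lra_from yx h1 y0.
by apply: dH; lra_from yx hd y0.
Qed.

Lemma zero_at_endpoints (g : R -> R) : {for 0, continuous g} -> {for 1, continuous g} ->
  (forall x, 0 < x < 1 -> g x = 0) -> forall x, 0 <= x <= 1 -> g x = 0.
Proof.
move=> c0 c1 gz x /andP[x0 x1].
have h01 : 0 < 1 :> R by exact: ltr01.
have half : 0 < 2^-1 :> R by rewrite invr_gt0.
move: x0; rewrite le_eqVlt => /predU1P[<-|x0].
  apply/eqP; rewrite -normr_le0 leNgt; apply/negP => g0.
  have [d d0 dH] := (continuous_atP g 0).1 c0 _ g0.
  have d2 : 0 < d / 2 by lra_from d0.
  have [h [hp hd h1 _]] := pos_below3 d2 half h01.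
  have := dH h; rewrite subr0 gtr0_norm// gz; last by lra_from hp h1.
  by rewrite sub0r normrN ltxx => H; have := H (ltac:(lra_from hd d0)).
move: x1; rewrite le_eqVlt => /predU1P[->|x1]; last by rewrite gz// x0.
apply/eqP; rewrite -normr_le0 leNgt; apply/negP => g0.
have [d d0 dH] := (continuous_atP g 1).1 c1 _ g0.
have d2 : 0 < d / 2 by lra_from d0.
have [h [hp hd h1 _]] := pos_below3 d2 half h01.
have := dH (1 - h); rewrite (_ : 1 - h - 1 = - h); last by ring.
rewrite normrN gtr0_norm// gz; last by lra_from hp h1.
by rewrite sub0r normrN ltxx => H; have := H (ltac:(lra_from hd d0)).
Qed.

Lemma is_derive_power_nonlin (q u : R) : 0 < u ->
  is_derive u (1 : R) (fun t => t `^ (q - 1) - t) ((q - 1) * u `^ (q - 1 - 1) - 1).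
Proof. by move=> u0; exact: (is_derive1B (is_derive1_powR (q - 1) u0) (is_derive1_id u)). Qed.

Lemma equal_derivatives_eq (f g d : R -> R) (x0 : R) : 0 < x0 < 1 ->
  (forall x : R, 0 < x < 1 -> is_derive x (1 : R) f (d x)) ->
  (forall x : R, 0 < x < 1 -> is_derive x (1 : R) g (d x)) -> f x0 = g x0 ->
  forall x : R, 0 < x < 1 -> f x = g x.
Proof.
move=> x01 fD gD fg x xx.
have D (z : R) : 0 < z < 1 -> is_derive z (1 : R) (fun t => f t - g t) (d z - d z).
  by move=> zz; exact: (is_derive1B (fD z zz) (gD z zz)).
apply/eqP; rewrite -subr_eq0; apply/eqP; rewrite -[RHS](subrr (g x0)) -{1}fg.
case: (ltgtP x x0) => [h|h|->//].
  have [||c _ E] := @MVT_cc R (fun t => f t - g t) (fun z => d z - d z) x x0 h.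
  - by move=> z zz; apply: (is_derive_cvg (D z _)); lra_from zz xx x01.
  - by move=> z zz; apply: D; lra_from zz xx x01.
  by move: E; rewrite subrr mul0r => E; lra_from E.
have [||c _ E] := @MVT_cc R (fun t => f t - g t) (fun z => d z - d z) x0 x h.
- by move=> z zz; apply: (is_derive_cvg (D z _)); lra_from zz xx x01.
- by move=> z zz; apply: D; lra_from zz xx x01.
by move: E; rewrite subrr mul0r => E; lra_from E.
Qed.

(* Differentiating the equation once more gives a divergence-form equation for w',
   x^(m+2) (1-x)^3 w'' = H with H' = - x^(m+1) (1-x)^2 G, so w'' has limits at both ends. *)
Lemma smooth_extension (kappa q M a b C : R) (m : nat) (w y : R -> R) :
  2 < q -> 1 < M -> 0 < kappa -> profile (nlin q M) kappa m a w y -> 0 < C -> regular w y b C ->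
  0 < b <= M -> (forall x, 0 <= x < 1 -> 0 < w x <= M) ->
  exists W W1 W2 : R -> R, [/\ forall x : R, is_derive x (1 : R) W (W1 x),
    forall x : R, is_derive x (1 : R) W1 (W2 x), continuous W2, W 0 = a &
    forall x, 0 <= x <= 1 -> 0 < W x /\
      x * (1 - x) * W2 x + (m.+1%:R - m.+3%:R * x) * W1 x + kappa * (W x `^ (q - 1) - W x) = 0].
Proof.
move=> q2 M1 k0 pr C0 reg bM wM; have /andP[b0 bM'] := bM.
pose g u := u `^ (q - 1) - u; pose g' u := (q - 1) * u `^ (q - 1 - 1) - 1.
have gD (u : R) : 0 < u -> is_derive u (1 : R) g (g' u) by exact: is_derive_power_nonlin.
have g'c (u : R) : 0 < u -> {for u, continuous g'}.
  move=> u0; exact: (continuous1B (continuous1M (is_derive_cvg (is_derive1_cst (q - 1) u))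
    (is_derive_cvg (is_derive1_powR (q - 1 - 1) u0))) (is_derive_cvg (is_derive1_cst 1 u))).
have wp x : 0 <= x < 1 -> 0 < w x by move=> /wM /andP[].
have fg x : 0 <= x < 1 -> nlin q M (w x) = g (w x).
  by move=> x01; rewrite nlinE//; have := wM x x01 => h; lra_from h.
have lt1 (x : R) : 0 < x < 1 -> 1 - x != 0 by move=> /andP[_ x1]; rewrite subr_eq0 gt_eqF.
have gt0 (x : R) : 0 < x < 1 -> x != 0 by move=> /andP[x0 _]; rewrite gt_eqF.
pose p x := y x / (1 - x) ^+ 2.
have wD (x : R) : 0 < x < 1 -> is_derive x (1 : R) w (p x).
  by move=> /andP[_ x1]; exact: (profile_derive pr x1).
pose S x := kappa * g (w x) + (m.+1%:R - m.+3%:R * x) * p x.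
pose r x := - S x / (x * (1 - x)).
have pD (x : R) : 0 < x < 1 -> is_derive x (1 : R) p (r x).
  move=> x01; have n0 := lt1 x x01; have x0 := gt0 x x01.
  have n2 : (1 - x) ^+ 2 != 0 by rewrite expf_neq0.
  have D := is_derive1M (profile_slope_derive pr x01) (is_derive1V (is_derive1X 2 (is_derive1B (is_derive1_cst 1 x) (is_derive1_id x))) n2).
  apply: (is_derive_eq D); rewrite /r /S /p fg; last by rewrite ltW; case/andP: x01.
  rewrite -[m.+3%:R]natr1 -[m.+2%:R]natr1 -[m.+1%:R]natr1 /=.
  by move: (g (w x)) (y x) => F Y; field; rewrite n0 x0.
pose G x := (kappa * g' (w x) - m.+3%:R) * p x.
pose H x := - (x ^+ m.+1 * (1 - x) ^+ 2 * S x).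
have HD (x : R) : 0 < x < 1 -> is_derive x (1 : R) H (- (x ^+ m.+1 * (1 - x) ^+ 2 * G x)).
  move=> x01; have n0 := lt1 x x01; have x0 := gt0 x x01.
  have D1 := is_derive1M (is_derive1X m.+1 (is_derive1_id x)) (is_derive1X 2 (is_derive1B (is_derive1_cst 1 x) (is_derive1_id x))).
  have wx : 0 < w x by apply: wp; lra_from x01.
  have D2 := is_derive1D (is_derive1M (is_derive1_cst kappa x) (is_derive1_chain (gD _ wx) (wD x x01)))
    (is_derive1M (is_derive1B (is_derive1_cst m.+1%:R x) (is_derive1M (is_derive1_cst m.+3%:R x) (is_derive1_id x))) (pD x x01)).
  apply: (is_derive_eq (is_derive1N (is_derive1M D1 D2))).
  rewrite /G /r /S /= !(exprS x m).
  move: (g (w x)) (g' (w x)) (p x) (x ^+ m) => F F' P X.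
  rewrite -[m.+3%:R]natr1 -[m.+2%:R]natr1 -[m.+1%:R]natr1.
  by field; rewrite n0 x0.
have rE x : 0 < x < 1 -> r x = H x / x ^+ m.+2 / (1 - x) ^+ 3.
  move=> x01; have n0 := lt1 x x01; have x0 := gt0 x x01.
  rewrite /H /r (exprS x m.+1); have : x ^+ m.+1 != 0 by rewrite expf_neq0.
  by move: (x ^+ m.+1) => X X0; field; rewrite X0 n0 x0.
have pc (x : R) : 0 <= x < 1 -> {for x, continuous p}.
  move=> /andP[x0 x1]; have n2 : (1 - x) ^+ 2 != 0 by rewrite expf_neq0// subr_eq0 gt_eqF.
  exact: (continuous1M (profile_slope_cont pr x1) (is_derive_cvg (is_derive1V (is_derive1X 2 (is_derive1B (is_derive1_cst 1 x) (is_derive1_id x))) n2))).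
have Sc (x : R) : 0 <= x < 1 -> {for x, continuous S}.
  move=> x01; have x1 : x < 1 by case/andP: x01.
  exact: (continuous1D (continuous1M (is_derive_cvg (is_derive1_cst kappa x)) (continuous1_chain (is_derive_cvg (gD _ (wp x x01))) (profile_cont pr x1)))
    (continuous1M (is_derive_cvg (is_derive1B (is_derive1_cst m.+1%:R x) (is_derive1M (is_derive1_cst m.+3%:R x) (is_derive1_id x)))) (pc x x01))).
have Gc (x : R) : 0 <= x < 1 -> {for x, continuous G}.
  move=> x01; have x1 : x < 1 by case/andP: x01.
  exact: (continuous1M (continuous1B (continuous1M (is_derive_cvg (is_derive1_cst kappa x)) (continuous1_chain (g'c _ (wp x x01)) (profile_cont pr x1)))
    (is_derive_cvg (is_derive1_cst m.+3%:R x))) (pc x x01)).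
have z01 : 0 <= (0 : R) < 1 by rewrite lexx ltr01.
have r_at0 : r x @[x --> (0 : R)^'+] --> - G 0 / m.+2%:R.
  have h : H x / x ^+ m.+2 @[x --> (0 : R)^'+] --> - ((1 - 0) ^+ 2 * G 0) / m.+2%:R.
    apply: (@quotient_limit H (fun x => - ((1 - x) ^+ 2 * G x)) m.+1 _ 1 ltr01).
    - by move=> x /HD D; apply: (is_derive_eq D); ring.
    - have e0 : H 0 = 0 by rewrite /H expr0n /= !mul0r oppr0.
      rewrite -[X in _ --> X]e0.
      apply: at_right_of_cvg.
      have D1 := is_derive1M (is_derive1X m.+1 (is_derive1_id (0 : R))) (is_derive1X 2 (is_derive1B (is_derive1_cst 1 0) (is_derive1_id (0 : R)))).
      exact: (continuous1N (continuous1M (is_derive_cvg D1) (Sc 0 z01))).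
    - apply: (@at_right_of_cvg (fun x => - ((1 - x) ^+ 2 * G x))).
      exact: (continuous1N (continuous1M (is_derive_cvg (is_derive1X 2 (is_derive1B (is_derive1_cst 1 0) (is_derive1_id (0 : R))))) (Gc 0 z01))).
  have n3 : (1 - 0) ^+ 3 != 0 :> R by rewrite subr0 expr1n oner_eq0.
  have h3 := at_right_of_cvg (is_derive_cvg (is_derive1V (is_derive1X 3 (is_derive1B (is_derive1_cst 1 0) (is_derive1_id (0 : R)))) n3)).
  have := cvgM h h3; rewrite subr0 !expr1n invr1 mulr1 mul1r => hh.
  apply: cvg_trans (hh _); apply: near_eq_cvg; near=> x.
  have x01 : 0 < x < 1 by apply/andP; split; near: x; [exact: nbhs_right_gt|exact: nbhs_right_lt].
  by rewrite /= -rE.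
pose wb := ext w b.
have wb_lt (x : R) : x < 1 -> wb x = w x by exact: ext_lt.
have wb1 : wb 1 = b by exact: ext1.
have wbc : {for 1, continuous wb}.
  by apply: (ext_continuous1 C0) => x x01; case: (reg x x01).
have yc : {for 1, continuous (ext y 0)}.
  apply: (ext_continuous1 C0) => x x01; rewrite subr0; have [_ h] := reg x x01.
  apply: le_trans h _; rewrite ler_pM2l// expr2 -subr_ge0.
  by have : 0 <= x * (1 - x); [rewrite mulr_ge0//; lra_from x01|move: x01 => _ h; lra_from h].
have cX k : {for 1, continuous (fun t : R => t ^+ k)}.
  exact: (is_derive_cvg (is_derive1X k (is_derive1_id (1 : R)))).
have sub01 (s : R) : 0 < s < 1 -> 0 <= 1 - s < 1 by move=> h; lra_from h.
have sub01' (s : R) : 0 < s < 1 -> 0 < 1 - s < 1 by move=> h; lra_from h.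
have subD (s : R) : is_derive s (1 : R) (fun t => 1 - t) (0 - 1).
  exact: (is_derive1B (is_derive1_cst 1 s) (is_derive1_id s)).
have gb : {for wb 1, continuous g} by rewrite wb1; exact: (is_derive_cvg (gD b b0)).
have g'b : {for wb 1, continuous g'} by rewrite wb1; exact: g'c.
(* The value of w' that the equation forces at x = 1, where it reads -2 w' + kappa g(b) = 0. *)
pose p1 := kappa * (1 ^+ m * g b) / 2.
have p_at1 : p (1 - s) @[s --> (0 : R)^'+] --> p1.
  have h : (1 - s) ^+ m.+1 * y (1 - s) / s ^+ 2 @[s --> (0 : R)^'+] --> p1.
    apply: (@quotient_limit (fun s => (1 - s) ^+ m.+1 * y (1 - s))
       (fun s => kappa * ((1 - s) ^+ m * g (w (1 - s)))) 1 _ 1 ltr01).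
    - move=> s s01; have D := profile_flux pr (sub01 s s01).
      apply: (is_derive_eq (@is_derive1_chain R _ (fun t => 1 - t) s _ _ D (subD s))); rewrite fg; last exact: sub01.
      by rewrite expr1; ring.
    - have e0 : 1 ^+ m.+1 * ext y 0 1 = 0 by rewrite ext1 mulr0.
      rewrite -[X in _ --> X]e0.
      apply: (at_right_reflect (g := fun x => x ^+ m.+1 * ext y 0 x) (continuous1M (cX m.+1) yc)).
      by move=> s s01; rewrite ext_lt//; case/andP: (sub01 s s01).
    - have c := continuous1M (is_derive_cvg (is_derive1_cst kappa 1)) (continuous1M (cX m) (continuous1_chain gb wbc)).
      have := at_right_reflect c _; rewrite wb1; apply.
      by move=> s s01; rewrite wb_lt//; case/andP: (sub01 s s01).
  have n1 : (1 : R) ^+ m.+1 != 0 by rewrite expr1n oner_eq0.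
  have c1 := is_derive_cvg (is_derive1V (is_derive1X m.+1 (is_derive1_id 1)) n1).
  have := cvgM h (at_right_comp_sub c1); rewrite expr1n invr1 mulr1 => hh.
  apply: cvg_trans (hh _); apply: near_eq_cvg; near=> s.
  have s01 : 0 < s < 1 by apply/andP; split; near: s; [exact: nbhs_right_gt|exact: nbhs_right_lt].
  rewrite /p /= subKr; have s1 := gt0 _ (sub01' s s01); have s0 := gt0 s s01.
  have : (1 - s) ^+ m.+1 != 0 by rewrite expf_neq0.
  by move: (_ ^+ m.+1) (y _) => X Y X0; field; rewrite X0 s0.
pose pb := ext p p1.
have pb_lt (x : R) : x < 1 -> pb x = p x by exact: ext_lt.
have pb1 : pb 1 = p1 by exact: ext1.
have pbc : {for 1, continuous pb} by exact: ext_continuous_reflect.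
have Sbc : {for 1, continuous (fun x => kappa * g (wb x) + (m.+1%:R - m.+3%:R * x) * pb x)}.
  exact: (continuous1D (continuous1M (is_derive_cvg (is_derive1_cst kappa 1)) (continuous1_chain gb wbc))
    (continuous1M (is_derive_cvg (is_derive1B (is_derive1_cst m.+1%:R 1) (is_derive1M (is_derive1_cst m.+3%:R 1) (is_derive1_id 1)))) pbc)).
have Gbc : {for 1, continuous (fun x => (kappa * g' (wb x) - m.+3%:R) * pb x)}.
  exact: (continuous1M (continuous1B (continuous1M (is_derive_cvg (is_derive1_cst kappa 1)) (continuous1_chain g'b wbc))
    (is_derive_cvg (is_derive1_cst m.+3%:R 1))) pbc).
pose l1 := 1 ^+ m.+1 * ((kappa * g' (wb 1) - m.+3%:R) * pb 1) / 3.
have r_at1 : r (1 - s) @[s --> (0 : R)^'+] --> l1.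
  have h : H (1 - s) / s ^+ 3 @[s --> (0 : R)^'+] --> l1.
    apply: (@quotient_limit (fun s => H (1 - s)) (fun s => (1 - s) ^+ m.+1 * G (1 - s)) 2 _ 1 ltr01).
    - move=> s s01; apply: (is_derive_eq (@is_derive1_chain R _ (fun t => 1 - t) s _ _ (HD _ (sub01' s s01)) (subD s))).
      by ring.
    - have c := continuous1N (continuous1M
         (continuous1M (cX m.+1) (is_derive_cvg (is_derive1X 2 (subD 1)))) Sbc).
      have e0 : - (1 ^+ m.+1 * (1 - 1) ^+ 2 * (kappa * g (wb 1) + (m.+1%:R - m.+3%:R * 1) * pb 1)) = 0.
        by rewrite subrr expr0n /= mulr0 mul0r oppr0.
      rewrite -[X in _ --> X]e0.
      apply: (at_right_reflect c) => s s01; have /andP[_ s1] := sub01 s s01.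
      by rewrite /H /S wb_lt// pb_lt.
    - apply: (at_right_reflect (continuous1M (cX m.+1) Gbc)) => s s01.
      by have /andP[_ s1] := sub01 s s01; rewrite /G wb_lt// pb_lt.
  have n1 : (1 : R) ^+ m.+2 != 0 by rewrite expr1n oner_eq0.
  have c1 := is_derive_cvg (is_derive1V (is_derive1X m.+2 (is_derive1_id 1)) n1).
  have := cvgM h (at_right_comp_sub c1); rewrite expr1n invr1 mulr1 => hh.
  apply: cvg_trans (hh _); apply: near_eq_cvg; near=> s.
  have s01 : 0 < s < 1 by apply/andP; split; near: s; [exact: nbhs_right_gt|exact: nbhs_right_lt].
  by rewrite rE ?sub01'// subKr mulrAC.
have rc (x : R) : 0 < x < 1 -> {for x, continuous r}.
  move=> x01; have /andP[x0 x1] := x01; have xle : 0 <= x < 1 by rewrite ltW.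
  have n : x * (1 - x) != 0 by apply: mulf_neq0; [exact: gt0|exact: lt1].
  have c := continuous1M (continuous1N (Sc x xle))
    (is_derive_cvg (is_derive1V (is_derive1M (is_derive1_id x) (subD x)) n)).
  exact: c.
pose W2 := glue01 (- G 0 / m.+2%:R) l1 r.
(* The continuous extension of w'' is integrated twice, with constants fixed at 1/2. This gives a
   C^2 function on the whole line that agrees with w on (0, 1). *)
have W2c : continuous W2 by exact: glue01_continuous.
have W2r (x : R) : 0 < x < 1 -> W2 x = r x.
  by move=> /andP[x0 x1]; rewrite /W2 /glue01 leNgt x0 /= leNgt x1.
have half : 0 < (2^-1 : R) < 1 by rewrite invr_gt0 ltr0n /= invf_lt1 ?ltr0n// ltr1n.
pose W1 x := antider W2 x + (p 2^-1 - antider W2 2^-1).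
have W1D (x : R) : is_derive x (1 : R) W1 (W2 x).
  apply: (is_derive_eq (is_derive1D (is_derive_antider x W2c) (is_derive1_cst _ x))).
  by rewrite addr0.
have W1c : continuous W1 by move=> x; exact: (is_derive_cvg (W1D x)).
pose W x := antider W1 x + (w 2^-1 - antider W1 2^-1).
have WD (x : R) : is_derive x (1 : R) W (W1 x).
  apply: (is_derive_eq (is_derive1D (is_derive_antider x W1c) (is_derive1_cst _ x))).
  by rewrite addr0.
have W1p (x : R) : 0 < x < 1 -> W1 x = p x.
  have E : W1 2^-1 = p 2^-1 by rewrite /W1 addrC subrK.
  exact: (@equal_derivatives_eq W1 p r _ half (fun z z1 => is_derive_eq (W1D z) (W2r z z1)) pD E).
have Ww (x : R) : 0 < x < 1 -> W x = w x.
  have E : W 2^-1 = w 2^-1 by rewrite /W addrC subrK.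
  exact: (@equal_derivatives_eq W w p _ half (fun z z1 => is_derive_eq (WD z) (W1p z z1)) wD E).
have Wwb (x : R) : 0 <= x <= 1 -> W x = wb x.
  move=> x01; apply/eqP; rewrite -subr_eq0; apply/eqP; move: x x01.
  apply: (@zero_at_endpoints (fun x => W x - wb x)).
  - have c0 : {for 0, continuous wb} by exact: (ext_continuous ltr01 (profile_cont pr ltr01)).
    exact: (continuous1B (is_derive_cvg (WD 0)) c0).
  - exact: (continuous1B (is_derive_cvg (WD 1)) wbc).
  - by move=> x x01; rewrite Ww// wb_lt ?subrr//; case/andP: x01.
have Wp (x : R) : 0 <= x <= 1 -> 0 < W x.
  move=> x01; rewrite Wwb//; case/andP: x01 => x0; rewrite le_eqVlt => /predU1P[->|x1].
    by rewrite wb1.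
  by rewrite wb_lt// wp// x0.
exists W, W1, W2; split=> //.
  by rewrite Wwb ?lexx ?ler01// wb_lt// (profile_init pr).
move=> x x01; split; first exact: Wp.
move: x x01; apply: (@zero_at_endpoints (fun x => x * (1 - x) * W2 x + (m.+1%:R - m.+3%:R * x) * W1 x + kappa * g (W x))).
- have Wp0 : 0 < W 0 by apply: Wp; rewrite lexx ler01.
  exact: (continuous1D (continuous1D (continuous1M (is_derive_cvg (is_derive1M (is_derive1_id 0) (subD 0))) (W2c 0))
    (continuous1M (is_derive_cvg (is_derive1B (is_derive1_cst m.+1%:R 0) (is_derive1M (is_derive1_cst m.+3%:R 0) (is_derive1_id 0)))) (W1c 0)))
    (continuous1M (is_derive_cvg (is_derive1_cst kappa 0)) (continuous1_chain (is_derive_cvg (gD _ Wp0)) (is_derive_cvg (WD 0))))).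
- have Wp1 : 0 < W 1 by apply: Wp; rewrite lexx ler01.
  exact: (continuous1D (continuous1D (continuous1M (is_derive_cvg (is_derive1M (is_derive1_id 1) (subD 1))) (W2c 1))
    (continuous1M (is_derive_cvg (is_derive1B (is_derive1_cst m.+1%:R 1) (is_derive1M (is_derive1_cst m.+3%:R 1) (is_derive1_id 1)))) (W1c 1)))
    (continuous1M (is_derive_cvg (is_derive1_cst kappa 1)) (continuous1_chain (is_derive_cvg (gD _ Wp1)) (is_derive_cvg (WD 1))))).
move=> x x01; rewrite W2r// W1p// Ww// /r /S.
have x0 := gt0 x x01; have n0 := lt1 x x01.
by move: (g (w x)) (p x) => F P; field; rewrite x0 n0.
Unshelve. all: by end_near.
Qed.

End EndpointRegularity.

(** * Radial functions on the sphere *)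

(** The differential of g at x serves for f, since the two remainders agree near x. *)
Lemma differentiable_near_eq (R : numFieldType) (V W : normedModType R) (f g : V -> W) (x : V) :
  (\forall y \near x, f y = g y) -> differentiable g x -> differentiable f x.
Proof.
move=> fg dg; apply/diffP.
apply: (@getPex _ (fun (df : {linear V -> W}) => continuous df /\
  forall y, f y = f (lim (nbhs x)) + df (y - lim (nbhs x))
                  +o_(y \near x) (y - lim (nbhs x)))).
exists ('d g x); split; first exact: diff_continuous.
have /eqaddoP H : g = (fun y => g (lim (nbhs x)) + 'd g x (y - lim (nbhs x))) +o_ (nbhs x) (fun y => y - lim (nbhs x)).
  by rewrite funeqE => y; exact: (diffE dg).
have fgx := nbhs_singleton fg.
suff E : f = (fun y => f (lim (nbhs x)) + 'd g x (y - lim (nbhs x))) +o_ (nbhs x) (fun y => y - lim (nbhs x)).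
  by move=> y; exact: (congr1 (fun h => h y) E).
apply/eqaddoP => e e0; have := H e e0.
move: fg; apply: filterS2 => y fgy; rewrite lim_id//.
by rewrite !fctE fgy fgx.
Qed.
Section RadialFunctions.
Variables (R : realType) (n : nat).
Implicit Types (z : Hvec R n) (i j : 'I_n.+1) (c d : 'I_4).

Definition first_sq z : R := \sum_(c < 4) z ord0 c ^+ 2.

Lemma sq_norm_ge0 z : 0 <= sq_norm z.
Proof. by apply: sumr_ge0 => i _; apply: sumr_ge0 => c _; exact: sqr_ge0. Qed.

Lemma first_sq_ge0 z : 0 <= first_sq z.
Proof. by apply: sumr_ge0 => c _; exact: sqr_ge0. Qed.

Lemma first_sq_le z : first_sq z <= sq_norm z.
Proof.
rewrite /sq_norm big_ord_recl lerDl.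
by apply: sumr_ge0 => i _; apply: sumr_ge0 => c _; exact: sqr_ge0.
Qed.

Lemma sq_norm_eq0 z : sq_norm z = 0 -> z = 0.
Proof.
move=> D0; apply/matrixP => i c; rewrite mxE; apply/eqP; rewrite -(@sqrf_eq0 R).
have S0 j : 0 <= \sum_(d < 4) z j d ^+ 2 by apply: sumr_ge0 => d _; exact: sqr_ge0.
have /eqP := D0; rewrite psumr_eq0// => /allP/(_ i); rewrite mem_index_enum => /(_ isT) /=.
rewrite psumr_eq0; last by move=> d _; exact: sqr_ge0.
by move=> /allP/(_ c); rewrite mem_index_enum => /(_ isT).
Qed.

(* At z = 0 both sides are W 1, by 0^-1 = 0. *)
Lemma hextE (W : R -> R) z :
  hext (fun y => W (1 - first_sq y)) z = W (1 - first_sq z / sq_norm z).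
Proof.
rewrite /hext; congr (W (1 - _)); rewrite /first_sq mulr_suml; apply: eq_bigr => c _.
by rewrite mxE exprMn exprVn sqr_sqrtr ?sq_norm_ge0// mulrC.
Qed.

Lemma sum_single m (F : 'I_m -> R) (k : 'I_m) : (forall l, l != k -> F l = 0) -> \sum_l F l = F k.
Proof. by move=> F0; rewrite (bigD1 k)//= big1 ?addr0. Qed.

Lemma first_sq_line z i c t :
  first_sq (t *: delta_mx i c + z) = first_sq z + (i == ord0)%:R * (2 * t * z i c + t ^+ 2).
Proof.
rewrite /first_sq; under eq_bigr do rewrite !mxE [ord0 == i]eq_sym.
have [->|_] := eqVneq i ord0; last first.
  by rewrite mul0r addr0; apply: eq_bigr => d _; rewrite mulr0 add0r.
have -> : 2 * t * z ord0 c + t ^+ 2 = \sum_d (d == c)%:R * (2 * t * z ord0 d + t ^+ 2).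
  by rewrite (@sum_single _ _ c) ?eqxx ?mul1r// => d /negbTE->; rewrite mul0r.
rewrite mul1r -big_split; apply: eq_bigr => d _ /=.
by case: (d == c); rewrite /= ?mulr1 ?mulr0; ring.
Qed.

Lemma sq_norm_line z i c t : sq_norm (t *: delta_mx i c + z) = sq_norm z + (2 * t * z i c + t ^+ 2).
Proof.
pose F j d : R := (j == i)%:R * (d == c)%:R * (2 * t * z j d + t ^+ 2).
have -> : 2 * t * z i c + t ^+ 2 = \sum_j \sum_d F j d.
  rewrite (@sum_single _ (fun j => \sum_d F j d) i).
    rewrite (@sum_single _ (F i) c) /F ?eqxx ?mul1r//.
    by move=> d /negbTE->; rewrite mulr0 mul0r.
  by move=> j /negbTE ji; apply: big1 => d _; rewrite /F ji !mul0r.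
rewrite /sq_norm -big_split; apply: eq_bigr => j _ /=; rewrite -big_split; apply: eq_bigr => d _ /=.
rewrite /F !mxE; case: (j == i); case: (d == c) => /=; ring.
Qed.

Lemma coord_line z i c j d t :
  (t *: delta_mx j d + z) i c = z i c + ((i == j) && (c == d))%:R * t.
Proof. by rewrite !mxE addrC mulrC. Qed.

(** Reduces partial derivatives to one-variable calculus along a line. *)
Lemma is_derive_line (f : Hvec R n -> R) z (e : Hvec R n) (l : R) :
  is_derive (0 : R) (1 : R) (fun t : R => f (t *: e + z)) l -> is_derive z e f l.
Proof.
have E : (fun h : R => h^-1 *: (f ((h *: (1 : R) + 0) *: e + z) - f (0 *: e + z)))
       = (fun h : R => h^-1 *: (f (h *: e + z) - f z)).
  by apply/funext => h; rewrite scale0r add0r addr0 [h *: (1 : R)]mulr1.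
case=> [Dx Ex]; split.
  by move: Dx; rewrite /derivable E.
by move: Ex; rewrite /derive E.
Qed.

Definition xi z : R := 1 - first_sq z / sq_norm z.

(** Together with [ddxi], the first and second partial derivatives of [xi], in a closed rational
    form whose only denominators are powers of |z|^2. *)
Definition dxi i c z : R :=
  2 * z i c * (first_sq z - (i == ord0)%:R * sq_norm z) / sq_norm z ^+ 2.

Definition ddxi i c j d z : R :=
  2 * ((i == j) && (c == d))%:R * (first_sq z - (i == ord0)%:R * sq_norm z) / sq_norm z ^+ 2
  + 4 * z i c * (((j == ord0)%:R - (i == ord0)%:R) * z j d) / sq_norm z ^+ 2
  - 8 * z i c * z j d * (first_sq z - (i == ord0)%:R * sq_norm z) / sq_norm z ^+ 3.

Lemma is_derive_quadratic (a b : R) :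
  is_derive (0 : R) (1 : R) (fun t : R => a + (2 * t * b + t ^+ 2)) (2 * b).
Proof.
have D := is_derive1D (is_derive1_cst a 0) (is_derive1D
  (is_derive1M (is_derive1M (is_derive1_cst 2 0) (is_derive1_id 0)) (is_derive1_cst b 0))
  (is_derive1X 2 (is_derive1_id (0 : R)))).
by apply: (is_derive_eq D); rewrite /=; ring.
Qed.

Lemma is_derive_xi_line z i c : sq_norm z != 0 ->
  is_derive (0 : R) (1 : R) (fun t : R => xi (t *: delta_mx i c + z)) (dxi i c z).
Proof.
move=> D0.
have -> : (fun t : R => xi (t *: delta_mx i c + z)) =
    (fun t : R => 1 - (first_sq z + (i == ord0)%:R * (0 + (2 * t * z i c + t ^+ 2))) / (sq_norm z + (2 * t * z i c + t ^+ 2))).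
  by apply/funext => t; rewrite /xi first_sq_line sq_norm_line add0r.
have DQ := is_derive_quadratic (sq_norm z) (z i c).
have DA := is_derive1D (is_derive1_cst (first_sq z) 0) (is_derive1M (is_derive1_cst (i == ord0)%:R 0) (is_derive_quadratic 0 (z i c))).
have Q0 : sq_norm z + (2 * 0 * z i c + 0 ^+ 2) != 0 by rewrite mulr0 mul0r expr0n !addr0.
have D := is_derive1B (is_derive1_cst 1 0) (is_derive1M DA (is_derive1V DQ Q0)).
apply: (is_derive_eq D); rewrite /dxi /=; move: D0 => {Q0 D DA DQ}.
move: (first_sq z) (sq_norm z) (_%:R) (z i c) => A Q e b Q0.
by field; rewrite Q0.
Qed.

Lemma is_derive_dxi_line z i c j d : sq_norm z != 0 ->
  is_derive (0 : R) (1 : R) (fun t : R => dxi i c (t *: delta_mx j d + z)) (ddxi i c j d z).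
Proof.
move=> D0.
have -> : (fun t : R => dxi i c (t *: delta_mx j d + z)) =
    (fun t : R => 2 * (z i c + ((i == j) && (c == d))%:R * t)
      * ((first_sq z + (j == ord0)%:R * (0 + (2 * t * z j d + t ^+ 2)))
          - (i == ord0)%:R * (sq_norm z + (2 * t * z j d + t ^+ 2))) / (sq_norm z + (2 * t * z j d + t ^+ 2)) ^+ 2).
  by apply/funext => t; rewrite /dxi coord_line first_sq_line sq_norm_line add0r.
have DQ := is_derive_quadratic (sq_norm z) (z j d).
have DA := is_derive1D (is_derive1_cst (first_sq z) 0) (is_derive1M (is_derive1_cst (j == ord0)%:R 0) (is_derive_quadratic 0 (z j d))).
have DB := is_derive1B DA (is_derive1M (is_derive1_cst (i == ord0)%:R 0) DQ).
have DC := is_derive1M (is_derive1_cst 2 0) (is_derive1D (is_derive1_cst (z i c) 0) (is_derive1M (is_derive1_cst ((i == j) && (c == d))%:R 0) (is_derive1_id (0 : R)))).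
have Q0 : (sq_norm z + (2 * 0 * z j d + 0 ^+ 2)) ^+ 2 != 0 by rewrite mulr0 mul0r expr0n !addr0 expf_neq0.
have D := is_derive1M (is_derive1M DC DB) (is_derive1V (is_derive1X 2 DQ) Q0).
apply: (is_derive_eq D); rewrite /ddxi /=; move: D0 => {Q0 D DA DB DC DQ}.
move: (first_sq z) (sq_norm z) ((i == ord0)%:R) ((j == ord0)%:R) (_%:R) (z i c) (z j d) => A Q ei ej e b b' Q0.
by field; rewrite Q0.
Qed.

End RadialFunctions.

(** * Regularity of radial functions away from the origin *)

Section Smoothness.
Variables (R : realType) (n : nat).
Implicit Types (z : Hvec R n) (i j : 'I_n.+1) (c d : 'I_4) (f g : Hvec R n -> R).

Lemma differentiable_mul f g z : differentiable f z -> differentiable g z ->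
  differentiable (fun y => f y * g y) z.
Proof. by move=> df dg; exact: differentiableM. Qed.

Lemma differentiable_add f g z : differentiable f z -> differentiable g z ->
  differentiable (fun y => f y + g y) z.
Proof. by move=> df dg; exact: differentiableD. Qed.

Lemma differentiable_sub f g z : differentiable f z -> differentiable g z ->
  differentiable (fun y => f y - g y) z.
Proof. by move=> df dg; exact: differentiableB. Qed.

Lemma differentiable_pow f k z : differentiable f z -> differentiable (fun y => f y ^+ k) z.
Proof.
move=> df; elim: k => [|k IH]; first exact: differentiable_cst.
have -> : (fun y => f y ^+ k.+1) = (fun y => f y * f y ^+ k) by apply/funext => y; rewrite exprS.
exact: differentiable_mul.
Qed.

Lemma differentiable_inv_pow f k z : differentiable f z -> f z != 0 ->
  differentiable (fun y => (f y ^+ k)^-1) z.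
Proof.
move=> df f0; apply: (@differentiableV _ _ (fun y => f y ^+ k)); last by rewrite expf_neq0.
exact: differentiable_pow.
Qed.

Lemma differentiable_const (a : R) z : differentiable (fun _ : Hvec R n => a) z.
Proof. exact: differentiable_cst. Qed.

Lemma differentiable_entry i c z : differentiable (fun y : Hvec R n => y i c) z.
Proof. exact: differentiable_coord. Qed.

Lemma differentiable_bigsum m (F : 'I_m -> Hvec R n -> R) z : (forall k, differentiable (F k) z) ->
  differentiable (fun y => \sum_k F k y) z.
Proof.
move=> dF; have -> : (fun y => \sum_k F k y) = \sum_k F k by apply/funext => y; rewrite fct_sumE.
exact: differentiable_sum.
Qed.

Lemma differentiable_row_sq i z : differentiable (fun y : Hvec R n => \sum_(c < 4) y i c ^+ 2) z.
Proof.
by apply: differentiable_bigsum => c; apply: differentiable_pow; exact: differentiable_entry.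
Qed.

Lemma differentiable_first_sq z : differentiable (@first_sq R n) z.
Proof. exact: differentiable_row_sq. Qed.

Lemma differentiable_sq_norm z : differentiable (@sq_norm R n) z.
Proof. by apply: differentiable_bigsum => i; exact: differentiable_row_sq. Qed.

Lemma differentiable_inv_sq_norm k z : sq_norm z != 0 ->
  differentiable (fun y : Hvec R n => (sq_norm y ^+ k)^-1) z.
Proof. exact: (differentiable_inv_pow k (@differentiable_sq_norm z)). Qed.

Lemma sq_norm_near z : sq_norm z != 0 -> \forall y \near z, sq_norm y != 0.
Proof.
move=> z0; have := differentiable_continuous (@differentiable_sq_norm z).
by move=> /cvgr_neq0; exact.
Qed.

Lemma differentiable_xi z : sq_norm z != 0 -> differentiable (@xi R n) z.
Proof.
move=> z0; apply: differentiable_sub; first exact: differentiable_const.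
apply: differentiable_mul; first exact: differentiable_first_sq.
exact: (differentiable_inv_sq_norm 1 z0).
Qed.

Lemma differentiable_defect i z :
  differentiable (fun y : Hvec R n => first_sq y - (i == ord0)%:R * sq_norm y) z.
Proof.
apply: differentiable_sub; first exact: differentiable_first_sq.
by apply: differentiable_mul; [exact: differentiable_const|exact: differentiable_sq_norm].
Qed.

Lemma differentiable_dxi i c z : sq_norm z != 0 -> differentiable (@dxi R n i c) z.
Proof.
move=> z0; apply: differentiable_mul; last exact: differentiable_inv_sq_norm.
apply: differentiable_mul; last exact: differentiable_defect.
by apply: differentiable_mul; [exact: differentiable_const|exact: differentiable_entry].
Qed.

Lemma differentiable_ddxi i c j d z : sq_norm z != 0 -> differentiable (@ddxi R n i c j d) z.
Proof.
have C (a : R) : differentiable (fun _ : Hvec R n => a) z by exact: differentiable_const.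
have E k e : differentiable (fun y : Hvec R n => y k e) z by exact: differentiable_entry.
have F := differentiable_defect i z; have Q := differentiable_sq_norm z.
move=> z0; apply: differentiable_sub; first apply: differentiable_add.
- apply: differentiable_mul; last exact: differentiable_inv_sq_norm.
  exact: differentiable_mul.
- apply: differentiable_mul; last exact: differentiable_inv_sq_norm.
  apply: differentiable_mul; first exact: differentiable_mul.
  exact: differentiable_mul.
- apply: differentiable_mul; last exact: differentiable_inv_sq_norm.
  apply: differentiable_mul; last exact: F.
  by apply: differentiable_mul => //; exact: differentiable_mul.
Qed.

Lemma differentiable_scalar_comp (W W1 : R -> R) f z : (forall x : R, is_derive x (1 : R) W (W1 x)) ->
  differentiable f z -> differentiable (fun y => W (f y)) z.
Proof.
move=> WD df; apply: (@differentiable_comp _ _ _ _ f W) => //.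
by apply/derivable1_diffP; case: (WD (f z)).
Qed.

Lemma is_derive_radial (W W1 : R -> R) z i c : (forall x : R, is_derive x (1 : R) W (W1 x)) ->
  sq_norm z != 0 -> is_derive z (delta_mx i c) (fun y => W (xi y)) (W1 (xi z) * dxi i c z).
Proof.
move=> WD z0; apply: is_derive_line.
apply: (is_derive_eq (@is_derive1_chain R W (fun t => xi (t *: delta_mx i c + z)) 0 _ _ (WD _) (is_derive_xi_line i c z0))).
by rewrite scale0r add0r.
Qed.

Lemma is_derive_radial2 (W1 W2 : R -> R) z i c j d : (forall x : R, is_derive x (1 : R) W1 (W2 x)) ->
  sq_norm z != 0 -> is_derive z (delta_mx j d) (fun y => W1 (xi y) * dxi i c y)
    (W2 (xi z) * dxi j d z * dxi i c z + W1 (xi z) * ddxi i c j d z).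
Proof.
move=> WD z0; apply: is_derive_line.
have D := is_derive1M (@is_derive1_chain R W1 (fun t => xi (t *: delta_mx j d + z)) 0 _ _ (WD _) (is_derive_xi_line j d z0))
  (is_derive_dxi_line i c j d z0).
by apply: (is_derive_eq D); rewrite scale0r add0r; ring.
Qed.

Section Radial.
Variables W W1 W2 : R -> R.
Hypotheses (WD : forall x : R, is_derive x (1 : R) W (W1 x))
  (W1D : forall x : R, is_derive x (1 : R) W1 (W2 x)) (W2c : continuous W2).

Let u z : R := W (1 - first_sq z).

Lemma hext_radial : hext u = (fun z => W (xi z)).
Proof. by apply/funext => z; exact: hextE. Qed.

Lemma derive_radial i c z : sq_norm z != 0 ->
  'D_(delta_mx i c) (hext u) z = W1 (xi z) * dxi i c z.
Proof. by move=> z0; rewrite hext_radial; have [_ <-] := is_derive_radial i c WD z0. Qed.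

Lemma derive_radial_near i c z : sq_norm z != 0 ->
  \forall y \near z, 'D_(delta_mx i c) (hext u) y = W1 (xi y) * dxi i c y.
Proof. by move=> /sq_norm_near; apply: filterS => y; exact: derive_radial. Qed.

Lemma derive_radial2 i c j d z : sq_norm z != 0 ->
  'D_(delta_mx j d) ('D_(delta_mx i c) (hext u)) z =
    W2 (xi z) * dxi j d z * dxi i c z + W1 (xi z) * ddxi i c j d z.
Proof.
move=> z0; rewrite (near_eq_derive _ (derive_radial_near i c z0)).
by have [_ <-] := is_derive_radial2 i c j d W1D z0.
Qed.

Lemma C2_radial : C2_HP u.
Proof.
move=> z zn0; have z0 : sq_norm z != 0 by apply: contra_neq zn0; exact: sq_norm_eq0.
split; last split.
- by rewrite hext_radial; apply: (differentiable_scalar_comp WD); exact: differentiable_xi.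
- move=> i c; apply: differentiable_near_eq (derive_radial_near i c z0) _.
  apply: differentiable_mul; last exact: differentiable_dxi.
  by apply: (differentiable_scalar_comp W1D); exact: differentiable_xi.
move=> i j c d.
have near2 : \forall y \near z, W2 (xi y) * dxi j d y * dxi i c y + W1 (xi y) * ddxi i c j d y =
    'D_(delta_mx j d) ('D_(delta_mx i c) (hext u)) y.
  by move: (sq_norm_near z0); apply: filterS => y y0; rewrite derive_radial2.
have cx := differentiable_continuous (differentiable_xi z0).
have c1 := differentiable_continuous (differentiable_scalar_comp W1D (differentiable_xi z0)).
have c2 : {for z, continuous (fun y => W2 (xi y))} by apply: (continuous_comp cx); exact: W2c.
have cd k e := differentiable_continuous (differentiable_dxi k e z0).
have cdd := differentiable_continuous (differentiable_ddxi i c j d z0).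
suff h : 'D_(delta_mx j d) ('D_(delta_mx i c) (hext u)) y @[y --> z] --> W2 (xi z) * dxi j d z * dxi i c z + W1 (xi z) * ddxi i c j d z.
  by move: h; rewrite -derive_radial2.
apply: cvg_trans (near_eq_cvg near2) _.
exact: (cvgD (cvgM (cvgM c2 (cd j d)) (cd i c)) (cvgM c1 cdd)).
Qed.

End Radial.
End Smoothness.

(** * Symmetries of radial functions and reduction to the radial equation *)

Section RadialSolutions.
Variables (R : realType) (n : nat).
Implicit Types (z : Hvec R n) (i j : 'I_n.+1) (c d : 'I_4).

Lemma sum_quat (F : 'I_4 -> R) :
  \sum_c F c = F (inord 0) + F (inord 1) + F (inord 2) + F (inord 3).
Proof.
rewrite !big_ord_recl big_ord0 addr0 !addrA.
by congr (F _ + F _ + F _ + F _); apply/val_inj; rewrite /= inordK.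
Qed.

(** Euler's four-square identity; it makes |z_0| invariant under right multiplication by unit
    quaternions. *)
Lemma qmul_norm (a b : quat R) :
  \sum_c qmul a b ord0 c ^+ 2 = (\sum_c a ord0 c ^+ 2) * (\sum_c b ord0 c ^+ 2).
Proof.
rewrite !sum_quat /qmul !mxE /= !inordK//= /qc.
by ring.
Qed.

Lemma HP_function_radial (W : R -> R) : HP_function (fun z : Hvec R n => W (1 - first_sq z)).
Proof.
move=> z a _ a1; congr (W (1 - _)).
rewrite /first_sq; under eq_bigr do rewrite mxE.
by rewrite qmul_norm a1 mulr1; apply: eq_bigr => c _; rewrite mxE.
Qed.

Lemma Sp_invariant_radial (W : R -> R) : Sp_invariant (fun z : Hvec R n => W (1 - first_sq z)).
Proof.
move=> A z _ _; congr (W (1 - _)); apply: eq_bigr => c _.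
by rewrite mxE unlift_none.
Qed.

Lemma dxi_sphere z i c : sq_norm z = 1 -> dxi i c z = 2 * z i c * (first_sq z - (i == ord0)%:R).
Proof. by move=> z1; rewrite /dxi z1 expr1n divr1 mulr1. Qed.

Lemma ddxi_sphere z i c : sq_norm z = 1 ->
  ddxi i c i c z = (2 - 8 * z i c ^+ 2) * (first_sq z - (i == ord0)%:R).
Proof. by move=> z1; rewrite /ddxi z1 !expr1n !divr1 mulr1 !eqxx subrr /=; ring. Qed.

Lemma sum_first_sq z : \sum_i \sum_c (i == ord0)%:R * z i c ^+ 2 = first_sq z.
Proof.
rewrite (@sum_single _ _ (fun i => \sum_c (i == ord0)%:R * z i c ^+ 2) ord0).
  by apply: eq_bigr => c _; rewrite eqxx mul1r.
by move=> l /negbTE->; apply: big1 => c _; rewrite mul0r.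
Qed.

Lemma sum_dxi_sq z : sq_norm z = 1 ->
  \sum_i \sum_c dxi i c z ^+ 2 = 4 * first_sq z * (1 - first_sq z).
Proof.
have [A AE] : exists A, A = first_sq z by exists (first_sq z).
rewrite -AE => z1.
have -> : \sum_i \sum_c dxi i c z ^+ 2 =
    4 * A ^+ 2 * sq_norm z + 4 * (1 - 2 * A) * \sum_i \sum_c (i == ord0)%:R * z i c ^+ 2.
  rewrite /sq_norm !mulr_sumr -big_split; apply: eq_bigr => i _ /=.
  rewrite !mulr_sumr -big_split; apply: eq_bigr => c _ /=.
  by rewrite dxi_sphere// -AE; case: (i == ord0); rewrite /=; ring.
by rewrite sum_first_sq z1 -AE; ring.
Qed.

Lemma sum_ddxi z : sq_norm z = 1 ->
  \sum_i \sum_c ddxi i c i c z = 8 * n.+1%:R * first_sq z - 8.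
Proof.
have [A AE] : exists A, A = first_sq z by exists (first_sq z).
rewrite -AE => z1.
have -> : \sum_i \sum_c ddxi i c i c z =
    (\sum_(i < n.+1) \sum_(c < 4) (2 * (A - (i == ord0)%:R)) - 8 * A * sq_norm z)
    + 8 * \sum_i \sum_c (i == ord0)%:R * z i c ^+ 2.
  rewrite /sq_norm !mulr_sumr -sumrN -!big_split; apply: eq_bigr => i _ /=.
  rewrite !mulr_sumr -sumrN -!big_split; apply: eq_bigr => c _ /=.
  by rewrite ddxi_sphere// -AE; case: (i == ord0); rewrite /=; ring.
rewrite sum_first_sq z1 -AE.
have -> : \sum_(i < n.+1) \sum_(c < 4) (2 * (A - (i == ord0)%:R)) = 8 * n.+1%:R * A - 8.
  have -> : \sum_(i < n.+1) \sum_(c < 4) (2 * (A - (i == ord0)%:R)) = \sum_(i < n.+1) (8 * A - 8 * (i == ord0)%:R).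
    by apply: eq_bigr => i _; rewrite sumr_const card_ord -mulr_natl; ring.
  rewrite sumrB sumr_const card_ord (@sum_single _ _ (fun i => 8 * (i == ord0)%:R) ord0).
    by rewrite eqxx mulr1 -[_ *+ n.+1]mulr_natl; ring.
  by move=> l /negbTE->; rewrite mulr0.
by ring.
Qed.

(** Chain rule: W'' times the squared gradient of [xi] plus W' times its Laplacian. On the sphere
    these are 4 x (1 - x) and 8 n - 8 (n + 1) x. *)
Lemma lap_radial (W W1 W2 : R -> R) z :
  (forall x : R, is_derive x (1 : R) W (W1 x)) -> (forall x : R, is_derive x (1 : R) W1 (W2 x)) ->
  sq_norm z = 1 -> let x := 1 - first_sq z in
  lap_HP (fun y : Hvec R n => W (1 - first_sq y)) z =
    4 * x * (1 - x) * W2 x + (8 * n%:R - 8 * n.+1%:R * x) * W1 x.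
Proof.
move=> WD W1D z1 x; have z0 : sq_norm z != 0 by rewrite z1 oner_eq0.
have xE : xi z = x by rewrite /xi z1 divr1.
have -> : lap_HP (fun y : Hvec R n => W (1 - first_sq y)) z =
    W2 x * (\sum_i \sum_c dxi i c z ^+ 2) + W1 x * (\sum_i \sum_c ddxi i c i c z).
  rewrite /lap_HP /eucl_lap !mulr_sumr -big_split; apply: eq_bigr => i _ /=.
  rewrite !mulr_sumr -big_split; apply: eq_bigr => c _ /=.
  by rewrite (derive_radial2 WD W1D)// xE expr2 mulrA.
by rewrite sum_dxi_sq// sum_ddxi// /x -[n.+1%:R]natr1; ring.
Qed.

Lemma radial_solution (lambda q : R) (W W1 W2 : R -> R) :
  (forall x : R, is_derive x (1 : R) W (W1 x)) -> (forall x : R, is_derive x (1 : R) W1 (W2 x)) ->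
  continuous W2 ->
  (forall x, 0 <= x <= 1 -> 0 < W x /\ x * (1 - x) * W2 x
      + (2 * n%:R - (2 * n%:R + 2) * x) * W1 x + lambda / 4 * (W x `^ (q - 1) - W x) = 0) ->
  pos_inv_solution lambda q (fun z : Hvec R n => W (1 - first_sq z)).
Proof.
move=> WD W1D W2c ode.
have x01 z : on_sphere z -> 0 <= 1 - first_sq z <= 1.
  by move=> z1; have := first_sq_le z; have := first_sq_ge0 z; rewrite z1; lra.
split.
- exact: HP_function_radial.
- exact: (C2_radial WD W1D W2c).
- exact: Sp_invariant_radial.
- by move=> z /x01 /ode[].
move=> z z1; have [_] := ode _ (x01 z z1).
rewrite (lap_radial WD W1D z1) /= -[n.+1%:R]natr1.
move: (1 - first_sq z) => x; move: (W x) (W1 x) (W2 x) (W x `^ _) => a b c e.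
(* The partial differential equation is -4 times the radial one. *)
by move=> E; apply/eqP; rewrite -subr_eq0 -[X in _ == X](mulr0 (-4)) -E; apply/eqP; field.
Qed.

End RadialSolutions.

(** * The branches of solutions *)

Section Branches.
Variable R : realType.

Lemma branch_solution (kappa q : R) (m k : nat) : (0 < m)%N -> 2 < q -> q < 4 -> 0 < kappa ->
  (k * (k + m + 1 + 1))%:R < kappa * (q - 2) ->
  exists c : nat -> R, (forall i j, (i < j < k)%N -> c i <> c j) /\
    forall i, (i < k)%N -> exists W W1 W2 : R -> R, [/\ forall x : R, is_derive x (1 : R) W (W1 x),
      forall x : R, is_derive x (1 : R) W1 (W2 x), continuous W2, W 0 = c i &
      forall x, 0 <= x <= 1 -> 0 < W x /\
        x * (1 - x) * W2 x + (m.+1%:R - m.+3%:R * x) * W1 x + kappa * (W x `^ (q - 1) - W x) = 0].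
Proof.
move=> m0 q2 q4 k0 kq.
have [M M1 level] := truncation_level m0 q2 q4 k0.
have [L L0 Lip] := nlin_lipschitz q2 M1.
have [w [y [pr [dep const]]]] := shooting_family L0 k0 m0 Lip.
have sh : shooting (nlin q M) kappa L m w y.
  split=> //; [| |exact: nlin0|exact: nlin1].
  - by move=> X e X1 e0; have [d d0 H] := dep X e X1 e0; exists d => // a b x /H h /h[].
  - by move=> X e X1 e0; have [d d0 H] := dep X e X1 e0; exists d => // a b x /H h /h[].
pose branch j c := [/\ 0 < c < 1, alternates (w c) j, ~ alternates (w c) j.+1
  & forall X : R, near_end kappa L m X -> ~ trapped kappa L m w y c X].
(* Index 0 stands for the constant solution 1; indices from k on receive 1 as a placeholder. *)
have /choice[c Hc] : forall j, exists c : R, (j = 0%N -> c = 1) /\ ((0 < j < k)%N -> branch j c).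
  case=> [|j]; first by exists 1.
  case: (ltnP j.+1 k) => jk; last by exists 1.
  by have [c Hc] := branch_value sh (is_derive_nlin1 q2 M1) kq (jk : (0 < j.+1 < k)%N); exists c.
exists c; split.
  (* For 0 < i < j the profile of c j has i + 1 sign changes and that of c i has not; and c j < 1 =
     c 0. *)
  move=> i j /andP[ij jk] cij.
  have [j01 jalt _ _] := (Hc j).2 (ltac:(by rewrite jk (leq_ltn_trans _ ij)) : (0 < j < k)%N).
  case: i ij cij => [|i] ij cij.
    by have := (Hc 0%N).1 erefl; rewrite cij => c1; move: j01; rewrite c1 ltxx andbF.
  have [_ _ ialt _] := (Hc i.+1).2 (ltn_trans ij jk : (0 < i.+1 < k)%N).
  by apply: ialt; rewrite cij; exact: alternates_le jalt.
case=> [_|i ik].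
  exists (fun=> 1), (fun=> 0), (fun=> 0); split=> //.
  - by move=> x; exact: is_derive1_cst.
  - by move=> x; exact: is_derive1_cst.
  - by move=> x; exact: cvg_cst.
  - by rewrite (Hc 0%N).1.
  - by move=> x _; split=> //; rewrite !mulr0 powR1 subrr mulr0 !addr0.
have [c01 _ _ untrapped] := (Hc i.+1).2 (ik : (0 < i.+1 < k)%N).
have cp : 0 < c i.+1 by case/andP: c01.
have [X0 X0e] := near_end_ex m k0 L0.
have [|B B0 wB] := untrapped_bounded (pr (c i.+1)) k0 L0 X0e.
  move=> X /andP[X0X X1]; rewrite leNgt; apply/negP.
  exact: (untrapped X (near_end_mono k0 L0 X0e X0X X1)).
have [b [C C0 reg]] := bounded_regular (pr _) k0 L0 Lip (nlin0 q M) B0 wB.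
have [||wp b0] := regular_positive (pr _) k0 L0 Lip (nlin0 q M) _ _ cp C0 reg.
- by move=> u u0; rewrite (nlin_le0 q2 M1 u0) oppr_ge0.
- exact: nlin_lt0.
have [bM wM] := level _ _ _ _ _ (pr _) C0 reg c01 b0 wp.
apply: (smooth_extension q2 M1 k0 (pr _) C0 reg); first by rewrite b0.
by move=> x x01; rewrite wp// wM.
Qed.

End Branches.

Theorem theorem1p2 (R : realType) (n k : nat) (q lambda : R) :
  (1 <= n)%N -> (1 <= k)%N ->
  2 < q -> q < (4 * n%:R) / (2 * n%:R - 1) ->
  mu n k q < lambda -> lambda <= mu n k.+1 q ->
  exists s : 'I_k -> Hvec R n -> R,
    (forall i, pos_inv_solution lambda q (s i)) /\
    (forall i j, i != j -> HP_distinct (s i) (s j)).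
Proof.
move=> n1 k1 q2 qn lam _.
have q20 : 0 < q - 2 by rewrite subr_gt0.
have nR : 1 <= n%:R :> R by rewrite ler1n.
(* For n >= 1 the bound 4n / (2n - 1) is at most 4. *)
have q4 : q < 4.
  apply: lt_le_trans qn _; rewrite ler_pdivrMr; last by lra_from nR.
  lra_from nR.
have lam0 : 0 < lambda.
  apply: le_lt_trans lam; apply: divr_ge0 (ltW q20).
  by apply: mulr_ge0; [exact: mulr_ge0|rewrite !addr_ge0// mulr_ge0].
(* The parameter is m = 2n - 1, so that k (k + m + 2) = k (k + 2n + 1). *)
have m1E : (2 * n).-1.+1 = (2 * n)%N by rewrite prednK// muln_gt0.
(* The hypothesis mu_k < lambda, multiplied by (q - 2) / 4. *)
have kq : (k * (k + (2 * n).-1 + 1 + 1))%:R < lambda / 4 * (q - 2).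
  rewrite -[(k + _ + 1)%N]addnA [((2 * n).-1 + 1)%N]addn1 m1E.
  have := lam; rewrite /mu ltr_pdivrMr// => h.
  by rewrite natrM natrD natrD natrM; lra_from h.
have m0 : (0 < (2 * n).-1)%N by case: (n) n1 => // n'; rewrite mulnS.
have kap0 : 0 < lambda / 4 by rewrite divr_gt0.
have [c [cI cW]] := branch_solution m0 q2 q4 kap0 kq.
have /choice[W HW] : forall i : 'I_k, exists W : R -> R, W 0 = c i /\
    pos_inv_solution lambda q (fun z : Hvec R n => W (1 - first_sq z)).
  move=> i; have [W [W1 [W2 [WD W1D W2c W0 ode]]]] := cW i (ltn_ord i).
  exists W; split=> //; apply: (radial_solution WD W1D W2c) => x /ode; rewrite m1E.
  by rewrite -[(2 * n).+2]addn2 natrD natrM.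
exists (fun i z => W i (1 - first_sq z)); split=> [i|i j ij]; first by case: (HW i).
(* The point p_0, where x = 0 and the i-th solution takes the value c i. *)
pose z : Hvec R n := delta_mx ord0 ord0; exists z.
have zE : z = 1 *: delta_mx ord0 ord0 + 0 by rewrite scale1r addr0.
have sq0 : sq_norm (0 : Hvec R n) = 0.
  by apply: big1 => l _; apply: big1 => d _; rewrite mxE expr0n.
have z1 : first_sq z = 1.
  rewrite zE first_sq_line eqxx mxE mulr0 mul1r expr1n add0r.
  by rewrite /first_sq big1 ?add0r// => d _; rewrite mxE expr0n.
split; first by rewrite /on_sphere zE sq_norm_line sq0 mxE mulr0 expr1n !add0r.
rewrite z1 subrr (HW i).1 (HW j).1.
move: ij; rewrite -val_eqE /= neq_ltn => /orP[] ij.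
  by apply: cI; rewrite ij ltn_ord.
by apply/nesym/cI; rewrite ij ltn_ord.
Qed.
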